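(* Let $b>a>0$ and $\nu>1$. Let $\tau(t)=t^{\nu}$ for $t=1,2,\dots$. Suppose that $\mathbf{E}X_1^2<\infty$ and $\mathbf{E}Y_1<\infty$. Then, as $t\to+\infty$, the degree $d(v_t)$ of the vertex $v_t$ in the random graph $G_{X,Y}$ converges in distribution to the random variable $\Lambda_3$ having the probability distribution $$\mathbf{P}(\Lambda_3=r)=\mathbf{E}\,e^{-\lambda_3}\frac{\lambda_3^r}{r!},\qquad r=0,1,2,\dots.$$ Here $\lambda_3=\gamma\,a_2b_1Y_1$, where $a_2=\mathbf{E}X_1^2$, $b_1=\mathbf{E}Y_1$ and $$\gamma=4\nu\bigl(b^{1/(2\nu)}-a^{1/(2\nu)}\bigr)\bigl(a^{-1/(2\nu)}-b^{-1/(2\nu)}\bigr).$$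
   Context: Model. Let $X=\{X_i\}_{i\ge 1}$ and $Y=\{Y_j\}_{j\ge 1}$ be two sequences of non-negative random variables; each sequence is i.i.d., and the two sequences are independent of each other. Let $b>a>0$ be fixed numbers and let $\{\tau(t)\}_{t\ge1}$ be a nondecreasing positive sequence with $\tau(t)\to+\infty$. Given $X,Y$, let $H_{X,Y}$ be the random bipartite graph with bipartition $V=\{v_1,v_2,\dots\}$ and $W=\{w_1,w_2,\dots\}$ in which the edges $\{w_i,v_j\}$ are inserted (conditionally) independently with probabilities $$p_{ij}=\min\Bigl\{1,\frac{X_iY_j}{\sqrt{ij}}\Bigr\}\,\mathbb{I}_{\{a\tau(j)\le i\le b\tau(j)\}}.$$ The random intersection graph $G_{X,Y}$ is the graph on the vertex set $V$ in which two distinct vertices $u,v\in V$ are adjacent (written $u\sim v$) whenever they have a common neighbour in $H_{X,Y}$. $d(v_t)$ denotes the degree of $v_t$ in $G_{X,Y}$. *)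

(* Defs.v *)
From mathcomp Require Import all_boot all_order all_algebra finmap.
From mathcomp Require Import all_classical all_reals all_analysis.

Set Implicit Arguments.
Unset Strict Implicit.
Unset Printing Implicit Defensive.

Import Order.TTheory GRing.Theory Num.Theory.
Import numFieldNormedType.Exports.

Local Open Scope classical_set_scope.
Local Open Scope ring_scope.

Section probability_notions.
Context (d : measure_display) (T : measurableType d) (R : realType).
Variable P : probability T R.
Local Open Scope ereal_scope.

Definition sigma_gen (I : Type) (D : set I) (X : I -> T -> R) : set (set T) :=
  <<s \bigcup_(i in D) preimage_set_system setT (X i) measurable >>.

Definition mutually_independent (I : choiceType) (D : set I)
    (X : I -> T -> R) : Prop :=
  forall (F : {fset I}) (A : I -> set R),
    [set` F] `<=` D -> (forall i, measurable (A i)) ->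
    P (\bigcap_(i in [set` F]) (X i @^-1` A i)) =
      \prod_(i <- F) P (X i @^-1` A i).

(* Equality of laws is only required on Borel sets: the values of a measure
   outside its sigma-algebra carry no information. *)
Definition identically_distributed (I : Type) (D : set I)
    (X : I -> T -> R) : Prop :=
  forall i j, D i -> D j -> forall A : set R, measurable A ->
    P (X i @^-1` A) = P (X j @^-1` A).

Definition iid (I : choiceType) (D : set I) (X : I -> T -> R) : Prop :=
  mutually_independent D X /\ identically_distributed D X.

Definition independent_sigma (F G : set (set T)) : Prop :=
  forall A B, F A -> G B -> P (A `&` B) = P A * P B.

(* [f] is a version of the conditional probability P(A | G), for a
   sub-sigma-algebra [G]. *)
Definition cond_prob_version (G : set (set T)) (A : set T) (f : T -> R) : Prop :=
  [/\ forall U : set R, measurable U -> G (f @^-1` U),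
      P.-integrable setT (EFin \o f)
    & forall B, G B -> \int[P]_(w in B) (f w)%:E = P (A `&` B)].

(* Given [G], the events [A k], [k] in [D], are independent and have conditional
   probabilities [p k]; singletons [F] give the latter. *)
Definition cond_independent_events (K : choiceType) (D : set K)
    (G : set (set T)) (A : K -> set T) (p : K -> T -> R) : Prop :=
  forall F : {fset K}, [set` F] `<=` D ->
    cond_prob_version G (\bigcap_(k in [set` F]) A k)
      (fun w => (\prod_(k <- F) p k w)%R).

End probability_notions.

(* Convergence of the distribution functions at the continuity points of the
   limit. The variables [X n] may take the value +oo; the limit [L] is real and
   may live on another probability space. *)
Definition cvg_in_distribution (R : realType)
    (d : measure_display) (T : measurableType d) (P : probability T R)
    (d' : measure_display) (T' : measurableType d') (Q : probability T' R)
    (X : nat -> T -> \bar R) (L : {RV Q >-> R}) : Prop :=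
  forall x : R, {for x, continuous (cdf L)} ->
    P [set w | (X n w <= x%:E)%E] @[n --> \oo] --> cdf L x.

(* A bipartite graph with parts w_1, w_2, ... and v_1, v_2, ... is given by its
   adjacency [H i j], for the pair {w_i, v_j}. All indices start at 1, so that
   the values of [H], and of the sequences below, at index 0 are irrelevant. *)
Definition intersection_adj (H : nat -> nat -> bool) (u v : nat) : Prop :=
  u <> v /\ exists2 i : nat, (0 < i)%N & H i u /\ H i v.

Definition intersection_degree (R : realType) (H : nat -> nat -> bool)
    (t : nat) : \bar R :=
  counting [set u : nat | (0 < u)%N /\ intersection_adj H t u].

Definition edge_prob (R : realType) (a b : R) (tau : nat -> R)
    (x y : nat -> R) (i j : nat) : R :=
  Num.min 1 (x i * y j / Num.sqrt (i%:R * j%:R)) *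
  (a * tau j <= i%:R <= b * tau j)%R%:R.

Record random_intersection_model (R : realType)
    (d : measure_display) (T : measurableType d) (P : probability T R)
    (a b : R) (tau : nat -> R) (X Y : nat -> {RV P >-> R})
    (H : T -> nat -> nat -> bool) : Prop := {
  X_ge0 : forall i w, (0 < i)%N -> 0 <= X i w ;
  Y_ge0 : forall j w, (0 < j)%N -> 0 <= Y j w ;
  X_iid : iid P [set i | (0 < i)%N] (fun i => X i : T -> R) ;
  Y_iid : iid P [set j | (0 < j)%N] (fun j => Y j : T -> R) ;
  XY_independent : independent_sigma P
    (sigma_gen [set i | (0 < i)%N] (fun i => X i : T -> R))
    (sigma_gen [set j | (0 < j)%N] (fun j => Y j : T -> R)) ;
  edge_measurable : forall i j, (0 < i)%N -> (0 < j)%N ->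
    measurable [set w | H w i j] ;
  edge_cond_independent : cond_independent_events P
    [set e : nat * nat | (0 < e.1)%N /\ (0 < e.2)%N]
    (<<s sigma_gen [set i | (0 < i)%N] (fun i => X i : T -> R) `|`
         sigma_gen [set j | (0 < j)%N] (fun j => Y j : T -> R) >>)
    (fun e => [set w | H w e.1 e.2])
    (fun e w => edge_prob a b tau (fun i => X i w) (fun j => Y j w) e.1 e.2)
}.

(* Main.v *)
Require Import Defs.
From HB Require Import structures.
From mathcomp Require Import all_boot all_order all_algebra finmap.
From mathcomp Require Import all_classical all_reals all_analysis measurable_realfun.
From mathcomp Require Import ring lra.

(** Conditionally on X and Y, the edges are independent, and a neighbour of v_t is
    the end of a path v_t - w_i - v_u. Because nu > 1, w_i rarely has more than one
    further neighbour, and two paths from v_t rarely end at the same vertex, so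
    that d(v_t) is, up to a small error, the number of those w_i that are adjacent
    to v_t and to some other vertex. This is a sum of conditionally independent
    indicators with small probabilities, hence nearly Poisson (Le Cam), with
    parameter Y_t * sum_(i, u) X_i^2 Y_u / (i sqrt (t u)). By a second-moment
    computation this sum concentrates around a_2 b_1 sum_(i, u) 1 / (i sqrt (t u)),
    and the latter sum is a Riemann sum tending to gamma.

    Only X_1^2 and Y_1 are assumed integrable, so all this is carried out for the
    "light" vertices, those with X_i <= M and Y_u <= M. The paths through the other
    vertices have an expected number that is bounded, uniformly in t, by the tails
    of X_1^2 and Y_1 beyond M; finally M tends to infinity. *)

Set Implicit Arguments.
Unset Strict Implicit.
Unset Printing Implicit Defensive.

Import Order.TTheory GRing.Theory Num.Theory.
Import numFieldNormedType.Exports.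

Local Open Scope classical_set_scope.
Local Open Scope ring_scope.

(** * Poisson approximation of sums of independent indicators *)

Section Poisson.
Context {R : realType}.
Implicit Types (l q : R) (m n : nat).

(** Conditioning on X and Y is never carried out as such. The law of a count of conditionally
    independent indicators is a multilinear polynomial in the edge indicators, and such a polynomial
    keeps its expectation when each indicator is replaced by its conditional probability; this
    identity ([ml_Er]) stands in for conditional laws. The neighbours of v_t are not themselves
    conditionally independent, since two of them may use the same edge w_i - v_t, whereas the events
    attached to distinct w_i involve disjoint sets of edges; hence the detour through the w_i.
    Truncation serves the second-moment computation, whose variance would otherwise involve E X_1^4
    and E Y_1^2, and it makes the minimum with 1 in the edge probabilities inactive for large t. The
    factor Y_t is common to all paths, does not average out, and makes the limit a mixture. In
    gamma, the factor 2 (a^(-1/(2 nu)) - b^(-1/(2 nu))) comes from the sum over u, and 2 nu (b^(1/(2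
    nu)) - a^(1/(2 nu))) from that over i. *)

Definition pois l m : R := expR (- l) * (l ^+ m / m`!%:R).

(** The law of [Z + 1] when [f] is the law of [Z]. *)
Definition shift (f : nat -> R) m : R := if m is m'.+1 then f m' else 0.

Lemma pois_ge0 l m : 0 <= l -> 0 <= pois l m.
Proof. by move=> l0; rewrite /pois mulr_ge0 ?expR_ge0// divr_ge0 ?exprn_ge0. Qed.

Lemma pois_le1 l m : 0 <= l -> pois l m <= 1.
Proof.
move=> l0; rewrite /pois expRN mulrC ler_pdivrMr ?expR_gt0// mul1r.
case: m => [|m]; first by rewrite expr0 divr1 -expR0 ler_expR.
by apply: le_trans (expR_ge1Dxn m l0); rewrite lerDr.
Qed.

Lemma shift_pois01 l m : 0 <= l -> 0 <= shift (pois l) m <= 1.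
Proof.
by case: m => [|m] l0 /=; rewrite ?lexx ?ler01 ?pois_ge0 ?pois_le1.
Qed.

(** Forward equation of the Poisson process. *)
Lemma is_derive_pois l m :
  is_derive l 1 (pois ^~ m) (shift (pois l) m - pois l m).
Proof.
case: m => [|m]; rewrite /pois /=.
  rewrite (_ : (fun x => _) = (fun x : R => expR (- x))); last first.
    by apply/funext => x; rewrite expr0 divr1 mulr1.
  apply: trigger_derive; rewrite /GRing.scale/= expr0 divr1; ring.
rewrite (_ : (fun x => _) =
    (m.+1)`!%:R^-1 \*: ((fun x : R => expR (- x)) * (id ^+ m.+1))); last first.
  apply/funext => x; rewrite -[RHS]/(_^-1 * (expR (- x) * (id ^+ m.+1) x)).
  by rewrite exprfctE; ring.
apply: trigger_derive; rewrite /GRing.scale/= factS natrM.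
rewrite exprfctE; field.
Unshelve.
by rewrite nat1r !pnatr_eq0 -lt0n fact_gt0.
Qed.

Lemma pois_mvt l q m : 0 <= l -> 0 <= q -> exists2 x, l <= x <= l + q &
  pois (l + q) m - pois l m = (shift (pois x) m - pois x m) * q.
Proof.
move=> l0; rewrite le_eqVlt => /predU1P[<-|q0].
  by exists l; rewrite ?addr0 ?lexx// subrr mulr0.
have llq : l < l + q by rewrite ltrDl.
have [||x xin ->] := @MVT R (pois ^~ m) (fun x => shift (pois x) m - pois x m) _ _ llq.
- by move=> x _; exact: is_derive_pois.
- apply: derivable_within_continuous => x _.
  by case: (is_derive_pois x m).
- exists x; last by rewrite [l + q]addrC addrK.
  by move: xin; rewrite in_itv/= => /andP[/ltW-> /ltW->].
Qed.

(** The derivative is a difference of two numbers in [0, 1]. *)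
Lemma pois_lip l l' m : 0 <= l -> 0 <= l' ->
  `|pois l m - pois l' m| <= `|l - l'|.
Proof.
wlog: l l' / l' <= l => [hwlog l0 l'0|l'l l0 l'0].
  have [ll|/ltW ll] := leP l' l; first exact: hwlog.
  by rewrite distrC (distrC l); apply: hwlog.
have [x /andP[l'x _]] := @pois_mvt l' (l - l') m l'0 ltac:(by rewrite subr_ge0).
rewrite (addrC l') subrK => ->.
rewrite normrM ler_piMl//.
have x0 : 0 <= x by apply: le_trans l'x.
have /andP[? ?] := shift_pois01 m x0.
have := pois_ge0 m x0; have := pois_le1 m x0.
by rewrite ler_norml; lra.
Qed.

(** Cost of replacing a Bernoulli(q) summand by a Poisson(q) one. The first changes the mass by [q]
    times the derivative at [l], the second by [q] times the derivative at some [x] within [q] of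
    [l]; both terms of the derivative are 1-Lipschitz. *)
Lemma pois_bernoulli l q m : 0 <= l -> 0 <= q ->
  `|(1 - q) * pois l m + q * shift (pois l) m - pois (l + q) m| <= 2 * q ^+ 2.
Proof.
move=> l0 q0; have [x /andP[lx xlq] e] := @pois_mvt l q m l0 q0.
have x0 : 0 <= x by exact: le_trans lx.
rewrite -[pois (l + q) m](subrK (pois l m)) e.
rewrite (_ : _ - _ = q * ((shift (pois l) m - shift (pois x) m)
   + (pois x m - pois l m))); last by ring.
rewrite normrM (ger0_norm q0) expr2 mulrCA ler_wpM2l//.
have xl : `|x - l| <= q by rewrite ger0_norm ?subr_ge0// lerBlDl.
rewrite mulr_natl mulr2n (le_trans (ler_normD _ _))// lerD//; last first.
  exact: le_trans (pois_lip _ x0 l0) xl.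
case: m {e} => [|m] /=; first by rewrite subrr normr0.
by rewrite distrC; exact: le_trans (pois_lip _ x0 l0) xl.
Qed.

(** Law of a sum of independent Bernoulli variables, by conditioning on the last one. The indicators
    themselves obey the same recursion, which is how [ml_centre_count] identifies the law. *)
Fixpoint poisson_binomial (q : nat -> R) n m : R :=
  if n is n'.+1 then
    (1 - q n') * poisson_binomial q n' m + q n' * shift (poisson_binomial q n') m
  else (m == 0)%:R.

(** The Bernoulli summands are replaced one at a time. Mixing with weights [1 - q n] and [q n] does
    not enlarge the error inherited from the first [n] summands. *)
Lemma le_cam (q : nat -> R) n m : (forall i, 0 <= q i <= 1) ->
  `|poisson_binomial q n m - pois (\sum_(i < n) q i) m|
    <= 2 * \sum_(i < n) q i ^+ 2.
Proof.
move=> q01; elim: n m => [|n IH] m.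
  rewrite !big_ord0 mulr0 /pois oppr0 expR0 mul1r /= expr0n.
  by case: m => [|m]; rewrite /= ?divr1 ?mul0r subrr normr0.
rewrite !big_ord_recr /=; set l := \sum_(i < n) q i; set s := \sum_(i < n) q i ^+ 2.
have /andP[q0 q1] := q01 n.
have l0 : 0 <= l by apply: sumr_ge0 => i _; have /andP[] := q01 i.
have IHs : `|shift (poisson_binomial q n) m - shift (pois l) m| <= 2 * s.
  case: m => [|m] /=; last exact: IH.
  by rewrite subrr normr0 mulr_ge0// sumr_ge0// => i _; exact: sqr_ge0.
rewrite (_ : _ - _ =
   ((1 - q n) * (poisson_binomial q n m - pois l m)
    + q n * (shift (poisson_binomial q n) m - shift (pois l) m))
   + ((1 - q n) * pois l m + q n * shift (pois l) m - pois (l + q n) m)); last ring.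
rewrite [leRHS]mulrDr (le_trans (ler_normD _ _))// lerD ?pois_bernoulli//.
rewrite (le_trans (ler_normD _ _))// !normrM (ger0_norm q0).
have -> : `|1 - q n| = 1 - q n by rewrite ger0_norm// subr_ge0.
rewrite [leRHS](_ : _ = (1 - q n) * (2 * s) + q n * (2 * s)); last ring.
by rewrite lerD// ler_wpM2l ?subr_ge0.
Qed.

(** The first two Bonferroni inequalities, the second with the square of the sum in place of the sum
    over pairs, a form that passes through the induction. *)
Lemma prod_onem_bounds (p : nat -> R) (P : pred nat) n :
  (forall i, P i -> 0 <= p i <= 1) ->
  [/\ 0 <= \prod_(i < n | P i) (1 - p i) <= 1,
   1 - \sum_(i < n | P i) p i <= \prod_(i < n | P i) (1 - p i) &
   \prod_(i < n | P i) (1 - p i)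
    <= 1 - \sum_(i < n | P i) p i + (\sum_(i < n | P i) p i) ^+ 2].
Proof.
move=> p01; elim: n => [|n [/andP[IH0 IH1] IHl IHu]].
  by rewrite !big_ord0 ler01 lexx; split=> //; rewrite expr0n /=; lra.
rewrite [\sum_(i < n.+1 | P i) p i]big_mkcond big_ord_recr -big_mkcond /=.
rewrite [\prod_(i < n.+1 | P i) _]big_mkcond big_ord_recr -big_mkcond /=.
have s0 : 0 <= \sum_(i < n | P i) p i.
  by apply: sumr_ge0 => i Pi; have /andP[] := p01 _ Pi.
case: ifPn => [Pn|_]; last by rewrite !addr0 mulr1 IH0 IH1.
have /andP[q0 q1] := p01 _ Pn.
move: (\sum_(i < n | _) _) (\prod_(i < n | _) _) IH0 IH1 IHl IHu s0 => s r.
by move=> *; split; [apply/andP; split|..]; nra.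
Qed.

End Poisson.

(** * Sums of powers *)

(* The hypotheses make [e] a matching, and both sums count its edges. *)
Lemma sum_exists_swap (e : nat -> nat -> bool) (N U : nat) :
  (forall i u v, e i u -> e i v -> u = v) ->
  (forall i j u, e i u -> e j u -> i = j) ->
  (\sum_(u < U) [exists i : 'I_N, e i u] = \sum_(i < N) [exists u : 'I_U, e i u])%N.
Proof.
move=> e1 e2.
have sumE n (p : pred 'I_n) : (\sum_(i < n) p i)%N = #|[set i | p i]%SET|.
  by rewrite -sum1_card [RHS]big_mkcond; apply: eq_bigr => i _; rewrite inE; case: (p i).
rewrite (sumE U (fun u => [exists i : 'I_N, e i u])).
rewrite (sumE N (fun i => [exists u : 'I_U, e i u])).
pose Z := [set p : 'I_N * 'I_U | e p.1 p.2]%SET.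
rewrite (_ : [set u | _]%SET = [set p.2 | p in Z]%SET); last first.
  apply/setP => u; rewrite inE; apply/existsP/imsetP => [[i iu]|[[i v]]].
    by exists (i, u); rewrite ?inE.
  by rewrite inE /= => iv ->; exists i.
rewrite (_ : [set i | _]%SET = [set p.1 | p in Z]%SET); last first.
  apply/setP => i; rewrite inE; apply/existsP/imsetP => [[u iu]|[[j v]]].
    by exists (i, u); rewrite ?inE.
  by rewrite inE /= => iv ->; exists v.
rewrite !card_in_imset// => -[i u] [j v]; rewrite !inE/= => iu jv uv.
  by subst j; congr (_, _); apply: val_inj; apply: e1 iu jv.
by subst v; congr (_, _); apply: val_inj; apply: e2 iu jv.
Qed.

Section PowerSums.
Context {R : realType}.
Implicit Types (s x y A B : R).

Lemma powR_mvt s x y : 0 < x -> x <= y -> exists2 z, x <= z <= y &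
  y `^ s - x `^ s = s * z `^ (s - 1) * (y - x).
Proof.
move=> x0; rewrite le_eqVlt => /predU1P[<-|xy].
  by exists x; rewrite ?lexx// !subrr mulr0.
have [||z zin ->] := @MVT R (fun z => z `^ s) (fun z => s * z `^ (s - 1)) _ _ xy.
- by move=> z; rewrite in_itv/= => /andP[xz _]; apply: is_derive1_powR; exact: lt_trans xz.
- apply: derivable_within_continuous => z; rewrite in_itv/= => /andP[xz _].
  have z0 : 0 < z by exact: lt_le_trans xz.
  by case: (@is_derive1_powR R s z z0).
- exists z => //.
  by move: zin; rewrite in_itv/= => /andP[/ltW-> /ltW->].
Qed.

Lemma ler_powRN s x y : s <= 0 -> 0 < x -> x <= y -> y `^ s <= x `^ s.
Proof.
move=> s0 x0 xy; have y0 := lt_le_trans x0 xy.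
rewrite -[s]opprK !(powRN _ (- s)) lef_pV2 ?posrE ?powR_gt0//.
by rewrite ge0_ler_powR ?oppr_ge0// nnegrE ltW.
Qed.

Lemma powR_step s x : 0 < s < 1 -> 0 < x ->
  s * (x + 1) `^ (s - 1) <= (x + 1) `^ s - x `^ s <= s * x `^ (s - 1).
Proof.
move=> /andP[s0 s1] x0; have x1 : x <= x + 1 by rewrite lerDl.
have [z /andP[xz zx] ->] := powR_mvt s x0 x1.
rewrite addrAC subrr add0r mulr1 !ler_pM2l//.
by rewrite !ler_powRN// ?subr_le0 ?(ltW s1)//; exact: lt_le_trans xz.
Qed.

(** Comparison with the integral of the decreasing function x^(s-1), whose primitive is x^s / s; the
    error is at most one value of the function just before the left end. *)
Lemma sum_powR s A B N : 0 < s < 1 -> 1 < A -> A <= B -> B < N%:R ->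
  `|\sum_(i < N | A <= i%:R <= B) i%:R `^ (s - 1) - (B `^ s - A `^ s) / s|
     <= (A - 1) `^ (s - 1).
Proof.
move=> s01 A1 AB BN; have /andP[s0 s1] := s01.
have A0 : 0 < A by exact: lt_trans A1.
have B0 : 0 < B by exact: lt_le_trans AB.
have exm : exists n : nat, A <= n%:R by exists N; exact: le_trans AB (ltW BN).
have exn : exists n : nat, B < n%:R by exists N.
(* [m] is the first integer at least [A] and [n] the first one beyond [B], so that the sum runs over
   [m, n). *)
case: (ex_minnP exm) => m Am mmin; case: (ex_minnP exn) => n Bn nmin.
have m1 : (1 < m)%N by rewrite -(ltr_nat R); exact: lt_le_trans Am.
have mn : (m <= n)%N by rewrite mmin// (le_trans AB)// ltW.
have nN : (n <= N)%N by exact: nmin.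
have mA : m%:R < A + 1.
  rewrite ltNge; apply/negP => Am1.
  have := mmin m.-1; rewrite -subn1 natrB ?(ltnW m1)// lerBrDr => /(_ Am1).
  by rewrite subn1; case: (m) m1 => //= k; rewrite ltnn.
have n1 : (0 < n)%N by exact: leq_trans (ltnW m1) mn.
have nB : n%:R - 1 <= B.
  rewrite leNgt; apply/negP => Bn1.
  have := nmin n.-1; rewrite -subn1 natrB// => /(_ Bn1).
  by rewrite subn1; case: (n) n1 => //= k; rewrite ltnn.
have -> : \sum_(i < N | A <= i%:R <= B) i%:R `^ (s - 1) =
          \sum_(m <= i < n) i%:R `^ (s - 1) :> R.
  rewrite -(big_mkord (fun i => A <= i%:R <= B) (fun i => i%:R `^ (s - 1))).
  rewrite (big_nat_widenl m 0)// (big_nat_widen _ _ _ _ _ nN) big_nat_cond [RHS]big_nat_cond.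
  apply: eq_bigl => i; rewrite /=; case: (i < N)%N => //=.
  apply/andP/andP => -[h1 h2].
    by rewrite mmin// ltnNge; split=> //; apply/negP => ni; move: h2; rewrite leNgt (lt_le_trans Bn)// ler_nat.
  rewrite (le_trans Am) ?ler_nat//; split=> //.
  by rewrite leNgt; apply/negP => Bi; have := nmin _ Bi; rewrite leqNgt h2.
have lo : n%:R `^ s - m%:R `^ s <= s * \sum_(m <= i < n) i%:R `^ (s - 1).
  rewrite -(telescope_sumr (fun k => k%:R `^ s))// mulr_sumr.
  apply: ler_sum_nat => i /andP[mi _]; rewrite -natr1.
  have i0 : 0 < i%:R :> R by rewrite ltr0n (leq_trans _ mi)// ltnW.
  by have /andP[_] := powR_step s01 i0.
have up : s * \sum_(m <= i < n) i%:R `^ (s - 1) <= (n%:R - 1) `^ s - (m%:R - 1) `^ s.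
  rewrite -(telescope_sumr (fun k => (k%:R - 1) `^ s))// mulr_sumr.
  apply: ler_sum_nat => i /andP[mi _]; rewrite -[i.+1%:R]natr1 addrK.
  have i0 : 0 < i%:R - 1 :> R by rewrite subr_gt0 ltr1n (leq_trans m1).
  by have /andP[] := powR_step s01 i0; rewrite subrK.
set S := \sum_(_ <= _ < _) _ in lo up *.
have A10 : 0 < A - 1 by rewrite subr_gt0.
have /andP[_ hA] := powR_step s01 A0.
have /andP[_] := powR_step s01 A10; rewrite subrK => hA1.
have hAA : A `^ (s - 1) <= (A - 1) `^ (s - 1).
  by rewrite ler_powRN ?subr_le0 ?(ltW s1)// gerBl.
have mono x y : 0 <= x -> x <= y -> x `^ s <= y `^ s.
  by move=> x0 xy; rewrite ge0_ler_powR ?nnegrE ?(ltW s0)// (le_trans x0).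
have e1 : B `^ s <= n%:R `^ s by rewrite mono ?ltW.
have e2 : m%:R `^ s <= (A + 1) `^ s by rewrite mono// ltW.
have e3 : (n%:R - 1) `^ s <= B `^ s by rewrite mono// subr_ge0 ler1n.
have e4 : (A - 1) `^ s <= (m%:R - 1) `^ s by rewrite mono ?(ltW A10)// lerB.
rewrite -(ler_pM2l s0) -[X in X * `|_|](ger0_norm (ltW s0)) -normrM.
rewrite mulrBr mulrCA mulfV ?gt_eqF// mulr1 ler_norml.
have := ler_wpM2l (ltW s0) hAA.
by move=> *; apply/andP; split; lra.
Qed.

End PowerSums.

(** * Asymptotics of the total weight of the paths from t *)

Section Asymptotics.
Context {R : realType}.

Lemma powR_le_inv (nu x y : R) : 0 < nu -> 0 <= x -> 0 <= y ->
  (x `^ nu <= y) = (x <= y `^ nu^-1).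
Proof.
move=> nu0 x0 y0; have i0 : 0 <= nu^-1 by rewrite invr_ge0 ltW.
apply/idP/idP => [h|h].
  have := @ge0_ler_powR R _ i0 (x `^ nu) y.
  rewrite !nnegrE powR_ge0 y0 -powRrM mulfV ?gt_eqF// powRr1//.
  by move=> /(_ isT isT h).
have := @ge0_ler_powR R _ (ltW nu0) x (y `^ nu^-1).
rewrite !nnegrE powR_ge0 x0 -powRrM mulVf ?gt_eqF// powRr1//.
by move=> /(_ isT isT h).
Qed.

Lemma powR_ge_inv (nu x y : R) : 0 < nu -> 0 <= x -> 0 <= y ->
  (y <= x `^ nu) = (y `^ nu^-1 <= x).
Proof.
move=> nu0 x0 y0; have i0 : 0 < nu^-1 by rewrite invr_gt0.
by rewrite (powR_le_inv i0)// invrK.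
Qed.

Lemma cvg_powRN (e : R) : 0 < e -> t%:R `^ (- e) @[t --> \oo] --> 0.
Proof.
move=> e0; apply/cvgrPdist_lt => d d0; near=> t.
have t0 : 0 < t%:R :> R by rewrite ltr0n; near: t; exact: nbhs_infty_gt.
rewrite sub0r normrN ger0_norm ?powR_ge0// powRN.
rewrite -[d]invrK ltf_pV2 ?posrE ?invr_gt0 ?powR_gt0//.
rewrite ltNge powR_le_inv// ?invr_ge0 ?(ltW d0)//.
by rewrite -ltNge; near: t; exact: nbhs_infty_gtr.
Unshelve. all: by end_near. Qed.

Definition in_range (a b nu : R) (t i : nat) : bool :=
  a * t%:R `^ nu <= i%:R <= b * t%:R `^ nu.

Variables a b nu : R.
Hypotheses (a0 : 0 < a) (ab : a < b) (nu1 : 1 < nu).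

Let b0 : 0 < b. Proof. exact: lt_trans ab. Qed.
Let nu0 : 0 < nu. Proof. exact: lt_trans nu1. Qed.
(** If [t] and [u] may share a centre [i], then a t^nu <= i <= b u^nu and conversely, so [u] lies
    between [rho * t] and [rho^-1 * t]. *)
Let rho : R := (a / b) `^ nu^-1.
Let rho0 : 0 < rho. Proof. by rewrite powR_gt0// divr_gt0. Qed.

Lemma in_range_gt0 t i : (0 < t)%N -> in_range a b nu t i -> (0 < i)%N.
Proof.
move=> t0 /andP[h _]; rewrite -(ltr_nat R); apply: lt_le_trans h.
by rewrite mulr_gt0// powR_gt0// ltr0n.
Qed.

(** Solving for [u] turns the leaves of a fixed centre [i] into an interval of summation. *)
Lemma in_rangeE u i : in_range a b nu u i =
  ((i%:R / b) `^ nu^-1 <= u%:R <= (i%:R / a) `^ nu^-1).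
Proof.
rewrite /in_range andbC -powR_ge_inv ?divr_ge0 ?(ltW b0)//.
rewrite -powR_le_inv ?divr_ge0 ?(ltW a0)//.
by rewrite ler_pdivrMr// ler_pdivlMr// mulrC (mulrC a).
Qed.

Lemma in_range_lower t i : in_range a b nu t i ->
  rho * t%:R <= (i%:R / b) `^ nu^-1.
Proof.
move=> /andP[ati _].
have -> : rho * t%:R = ((a * t%:R `^ nu) / b) `^ nu^-1.
  rewrite mulrAC powRM ?divr_ge0 ?powR_ge0 ?ltW//.
  by rewrite -powRrM mulfV ?gt_eqF// powRr1.
have i0 : 0 <= nu^-1 by rewrite invr_ge0 ltW.
have bv : 0 < b^-1 by rewrite invr_gt0.
rewrite ge0_ler_powR// ?nnegrE ?divr_ge0 ?mulr_ge0 ?powR_ge0 ?(ltW a0) ?(ltW b0)//.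
by rewrite ler_pM2r.
Qed.

Lemma in_range_upper t i : in_range a b nu t i ->
  (i%:R / a) `^ nu^-1 <= rho^-1 * t%:R.
Proof.
move=> /andP[_ tbi].
have -> : rho^-1 * t%:R = ((b * t%:R `^ nu) / a) `^ nu^-1.
  have -> : rho^-1 = (b / a) `^ nu^-1.
    have -> : b / a = (a / b) `^ (-1) by rewrite powR_inv1 ?divr_ge0 ?ltW// invf_div.
    by rewrite /rho -powRrM mulN1r powRN.
  rewrite [in RHS]mulrAC [in RHS]powRM ?divr_ge0 ?powR_ge0 ?ltW//.
  by rewrite -powRrM mulfV ?gt_eqF// powRr1.
have i0 : 0 <= nu^-1 by rewrite invr_ge0 ltW.
have av : 0 < a^-1 by rewrite invr_gt0.
rewrite ge0_ler_powR// ?nnegrE ?divr_ge0 ?mulr_ge0 ?powR_ge0 ?(ltW a0) ?(ltW b0)//.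
by rewrite ler_pM2r.
Qed.

Lemma in_range_both t u i : in_range a b nu t i -> in_range a b nu u i ->
  rho * t%:R <= u%:R <= rho^-1 * t%:R.
Proof.
move=> ti; rewrite in_rangeE => /andP[h1 h2]; apply/andP; split.
  exact: le_trans (in_range_lower ti) h1.
exact: le_trans h2 (in_range_upper ti).
Qed.

(** Square roots of leaf indices become powers [sigma] of centre indices, because u is of order
    i^(1/nu). *)
Let sigma : R := (2 * nu)^-1.
Let sigma0 : 0 < sigma. Proof. by rewrite invr_gt0 mulr_gt0. Qed.
Let sigma1 : sigma < 1.
Proof. by rewrite invf_lt1 ?mulr_gt0//; move: nu1; lra. Qed.
Let half01 : 0 < (2^-1 : R) < 1. Proof. by apply/andP; split; lra. Qed.

(** The first summand comes from the error of [sum_powR], the second from the excluded leaf u =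
    t. *)
Let K : R := (rho / 2) `^ (- 2^-1) + 1.

Lemma inner_sum_bound t i U : (0 < t)%N -> 2 <= rho * t%:R ->
  rho^-1 * t%:R < U%:R -> in_range a b nu t i ->
  `|\sum_(u < U | in_range a b nu u i && (u != t :> nat)) u%:R `^ (- 2^-1)
    - 2 * (a `^ (- sigma) - b `^ (- sigma)) * i%:R `^ sigma|
   <= K * t%:R `^ (- 2^-1).
Proof.
move=> t0 rt Ut ti.
have i0 := in_range_gt0 t0 ti.
have tU : (t < U)%N.
  rewrite -(ltr_nat R); apply: le_lt_trans Ut.
  by have /andP[] := in_range_both ti ti.
have hs : 2^-1 - 1 = - 2^-1 :> R by lra.
set A := (i%:R / b) `^ nu^-1; set B := (i%:R / a) `^ nu^-1.
have lA : rho * t%:R <= A by exact: in_range_lower.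
have A1 : 1 < A by apply: lt_le_trans lA; lra.
have lB : B < U%:R by apply: le_lt_trans Ut; exact: in_range_upper.
have AB : A <= B.
  rewrite ge0_ler_powR// ?nnegrE ?invr_ge0 ?divr_ge0 ?(ltW a0) ?(ltW b0) ?(ltW nu0)//.
  by rewrite ler_pM2l ?ltr0n// lef_pV2 ?posrE// ltW.
have := sum_powR half01 A1 AB lB; rewrite hs.
(* The full interval of leaves also contains [t], whose term is split off. *)
have -> : \sum_(u < U | A <= u%:R <= B) u%:R `^ (- 2^-1) =
  \sum_(u < U | in_range a b nu u i && (u != t :> nat)) u%:R `^ (- 2^-1)
   + t%:R `^ (- 2^-1) :> R.
  rewrite (bigD1 (Ordinal tU))/=; last by rewrite -in_rangeE.
  by rewrite addrC; congr (_ + _); apply: eq_bigl => u; rewrite -in_rangeE.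
have sE (c : R) : 0 < c -> (i%:R / c) `^ nu^-1 `^ 2^-1 = c `^ (- sigma) * i%:R `^ sigma.
  move=> c0; rewrite -powRrM [_^-1 * _^-1]mulrC -invfM -/sigma.
  rewrite powRM ?invr_ge0 ?(ltW c0)// mulrC; congr (_ * _).
  by rewrite -(powR_inv1 (ltW c0)) -powRrM mulN1r.
rewrite !sE//.
set S := \sum_(u < U | _) _.
(* Since [A] is at least [rho * t], which is at least 2, [A - 1] is at least half of [rho * t]. *)
have e : (A - 1) `^ (- 2^-1) <= (rho / 2) `^ (- 2^-1) * t%:R `^ (- 2^-1).
  rewrite -powRM ?divr_ge0 ?(ltW rho0)//.
  apply: ler_powRN; first lra.
    by rewrite mulr_gt0 ?divr_gt0 ?ltr0n.
  by rewrite mulrAC; lra.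
have tp := powR_ge0 (t%:R : R) (- 2^-1).
rewrite invrK /K !ler_norml => /andP[h1 h2]; apply/andP; split; lra.
Qed.

(** Each term is the deterministic factor in the conditional probability of a path t - i - u. The
    cutoffs [N] and [U] lose nothing once they exceed the ranges of [i] and [u]. *)
Definition path_weight t N U : R :=
  \sum_(i < N | in_range a b nu t i)
    \sum_(u < U | in_range a b nu u i && (u != t :> nat))
      i%:R^-1 * t%:R `^ (- 2^-1) * u%:R `^ (- 2^-1).

(** What remains of [path_weight], up to a constant, when the sum over the leaves of [i] is replaced
    by its main term, a multiple of i^sigma. *)
Let S t N : R := t%:R `^ (- 2^-1) *
  \sum_(i < N | in_range a b nu t i) i%:R `^ (sigma - 1).

(** Over the range from a t^nu to b t^nu, the sum of i^(sigma - 1) scales like t^(nu sigma) =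
    t^(1/2), which cancels the prefactor. *)
Lemma outer_sum_bound t N : (0 < t)%N -> 2 <= a * t%:R `^ nu ->
  b * t%:R `^ nu < N%:R ->
  `|S t N - (b `^ sigma - a `^ sigma) / sigma| <= t%:R `^ (- 2^-1).
Proof.
move=> t0 at2 bN; have t0' : 0 < t%:R :> R by rewrite ltr0n.
have sE c : 0 < c -> (c * t%:R `^ nu) `^ sigma = c `^ sigma * t%:R `^ 2^-1.
  move=> c0; rewrite powRM ?powR_ge0 ?(ltW c0)// -powRrM; congr (_ * _ `^ _).
  by rewrite /sigma; field; rewrite gt_eqF.
have := @sum_powR R sigma _ _ N _ _ _ bN.
rewrite sigma0 sigma1 => /(_ (a * t%:R `^ nu) isT).
have -> : 1 < a * t%:R `^ nu by lra.
rewrite ler_pM2r ?powR_gt0// (ltW ab) => /(_ isT isT).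
rewrite !sE//.
have e1 : (a * t%:R `^ nu - 1) `^ (sigma - 1) <= 1.
  rewrite -[leRHS](_ : 1 `^ (sigma - 1) = 1); last by rewrite powR1.
  apply: ler_powRN => //; first by rewrite subr_le0 ltW.
  lra.
move=> /le_trans/(_ e1) h.
have tt : t%:R `^ (- 2^-1) * t%:R `^ 2^-1 = 1 :> R.
  by rewrite -powRD ?addNr ?powRr0// (gt_eqF t0') implybT.
rewrite -[X in _ <= X]mulr1; set c := (X in X * 1).
have c0 : 0 <= c by exact: powR_ge0.
apply: le_trans (ler_wpM2l c0 h).
rewrite -[X in X * `|_|](ger0_norm c0) -normrM mulrBr.
rewrite [X in _ <= `|_ - X|](_ : _ = (b `^ sigma - a `^ sigma) / sigma)//.
by rewrite -[RHS]mul1r -[X in _ = X * _]tt -/c; ring.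
Qed.

(** The limit is 2 (a^(-sigma) - b^(-sigma)) times (b^sigma - a^sigma) / sigma, and 1 / sigma = 2
    nu. *)
Lemma cvg_path_weight (N U : nat -> nat) :
  (forall t, b * t%:R `^ nu < (N t)%:R) -> (forall t, rho^-1 * t%:R < (U t)%:R) ->
  path_weight t (N t) (U t) @[t --> \oo] -->
  4 * nu * (b `^ sigma - a `^ sigma) * (a `^ (- sigma) - b `^ (- sigma)).
Proof.
move=> hN hU.
set D := a `^ (- sigma) - b `^ (- sigma).
have cvgS : S t (N t) @[t --> \oo] --> (b `^ sigma - a `^ sigma) / sigma.
  apply/cvgrPdist_le => e e0; near=> t.
  rewrite distrC (le_trans (outer_sum_bound _ _ _))//.
  - by near: t; exact: nbhs_infty_gt.
  - rewrite mulrC -ler_pdivrMr// powR_ge_inv ?divr_ge0 ?(ltW a0)//.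
    near: t; exact: nbhs_infty_ger.
  - near: t.
    have := @cvg_powRN (2^-1); move=> /(_ ltac:(by rewrite invr_gt0)).
    by move=> /cvgrPdist_le/(_ _ e0); apply: filterS => t; rewrite sub0r normrN ger0_norm ?powR_ge0.
have main : path_weight t (N t) (U t) - 2 * D * S t (N t) @[t --> \oo] --> 0.
  have h : K * t%:R `^ (- 2^-1) * S t (N t) @[t --> \oo] --> 0.
    rewrite -[X in _ --> X](mul0r ((b `^ sigma - a `^ sigma) / sigma)).
    apply: cvgM => //; rewrite -[X in _ --> X](mulr0 K).
    by apply: cvgM (cvg_cst K) _; apply: cvg_powRN; rewrite invr_gt0.
  apply/cvgrPdist_le => e e0.
  move/cvgrPdist_le : h => /(_ _ e0) h; near=> t.
  have t0 : (0 < t)%N by near: t; exact: nbhs_infty_gt.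
  have rt : 2 <= rho * t%:R.
    rewrite mulrC -ler_pdivrMr//; near: t; exact: nbhs_infty_ger.
  rewrite sub0r normrN (le_trans (y := K * t%:R `^ (- 2^-1) * S t (N t)))//; last first.
    suff : `|0 - K * t%:R `^ (- 2^-1) * S t (N t)| <= e.
      by rewrite sub0r normrN; apply: le_trans; exact: ler_norm.
    by near: t.
  rewrite /path_weight /S !mulr_sumr -sumrB (le_trans (ler_norm_sum _ _ _))//.
  apply: ler_sum => i ti; rewrite -mulr_sumr.
  have := inner_sum_bound t0 rt (hU t) ti; rewrite -/D.
  have i0 : 0 < i%:R :> R by rewrite ltr0n; exact: in_range_gt0 ti.
  set X := \sum_(_ < _ | _) _ => hX.
  have T0 : 0 <= (t%:R : R) `^ (- 2^-1) by exact: powR_ge0.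
  have -> : (i%:R : R) `^ (sigma - 1) = i%:R^-1 * i%:R `^ sigma.
    rewrite powRB; last by rewrite (gt_eqF i0) implybT.
    by rewrite powRr1 ?(ltW i0)// mulrC.
  set T := t%:R `^ _ in T0 hX *; set I := i%:R `^ sigma in hX *.
  rewrite (_ : _ - _ = (i%:R^-1 * T) * (X - 2 * D * I)); last ring.
  rewrite normrM ger0_norm ?mulr_ge0 ?invr_ge0//.
  apply: le_trans (ler_wpM2l _ hX) _; first by rewrite mulr_ge0 ?invr_ge0.
  (* Multiplying each inner error by i^sigma >= 1 makes the errors add up to a vanishing multiple of
     [S]. *)
  have I1 : 1 <= I.
    have : 1 `^ sigma <= (i%:R : R) `^ sigma.
      by rewrite ge0_ler_powR ?nnegrE ?(ltW sigma0)// ler1n -(ltr_nat R).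
    by rewrite powR1.
  have K0 : 0 <= K by rewrite addr_ge0 ?powR_ge0.
  rewrite (_ : K * T * (T * _) = i%:R^-1 * T * (K * T) * I); last ring.
  by rewrite ler_peMr// !mulr_ge0 ?invr_ge0.
have := cvgD main (cvgM (cvg_cst (2 * D)) cvgS).
rewrite add0r (_ : 2 * D * _ = 4 * nu * (b `^ sigma - a `^ sigma) * D); last first.
  by rewrite /sigma invrK; ring.
move=> h; rewrite (_ : (fun t => path_weight t (N t) (U t)) =
  (fun t => path_weight t (N t) (U t) - 2 * D * S t (N t))
   \+ (fun t => 2 * D * S t (N t))); first exact: h.
by apply/funext => t; rewrite /= subrK.
Unshelve. all: by end_near. Qed.

End Asymptotics.

(** * Real expectations and independence *)

Section RealExpectation.
Context (d : measure_display) (T : measurableType d) (R : realType).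
Variable P : probability T R.
Implicit Types f g : T -> R.

Definition itg f := P.-integrable setT (EFin \o f).
Definition Er f : R := \int[P]_w f w.

Lemma itg_measurable f : itg f -> measurable_fun setT f.
Proof. by move=> /integrableP[/measurable_EFinP]. Qed.

Lemma itg_bounded f M : measurable_fun setT f -> (forall w, `|f w| <= M) -> itg f.
Proof.
move=> mf fM; apply: measurable_bounded_integrable => //.
  by rewrite (le_lt_trans (probability_le1 _ _)) ?ltry.
by exists M; split; [exact: num_real|move=> x Mx w _; exact: le_trans (fM w) (ltW Mx)].
Qed.

Lemma itg_cst r : itg (cst r).
Proof. by apply: (@itg_bounded _ `|r|). Qed.

Lemma itgD f g : itg f -> itg g -> itg (fun w => f w + g w).
Proof. by move=> hf hg; have := integrableD measurableT hf hg. Qed.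

Lemma itgZ r f : itg f -> itg (fun w => r * f w).
Proof. by move=> hf; have := integrableZl measurableT r hf. Qed.

Lemma itgB f g : itg f -> itg g -> itg (fun w => f w - g w).
Proof. by move=> hf hg; have := integrableB measurableT hf hg. Qed.

Lemma itg_sum (I : Type) (s : seq I) (Q : pred I) (F : I -> T -> R) :
  (forall i, Q i -> itg (F i)) -> itg (fun w => \sum_(i <- s | Q i) F i w).
Proof.
move=> hF; elim: s => [|i s IH].
  by under eq_fun do rewrite big_nil; exact: itg_cst.
under eq_fun do rewrite big_cons.
case: (boolP (Q i)) => [Qi|_]; last exact: IH.
exact: itgD (hF _ Qi) IH.
Qed.

Lemma itg_le f g : measurable_fun setT f -> (forall w, `|f w| <= g w) ->
  itg g -> itg f.
Proof.
move=> mf fg; apply: le_integrable => //; first exact/measurable_EFinP.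
by move=> w _ /=; rewrite lee_fin (le_trans (fg w))// ler_norm.
Qed.

Lemma itg_norm f : itg f -> itg (fun w => `|f w|).
Proof. by move=> /integrable_norm. Qed.

Lemma ErD f g : itg f -> itg g -> Er (fun w => f w + g w) = Er f + Er g.
Proof. by move=> hf hg; rewrite /Er RintegralD. Qed.

Lemma ErB f g : itg f -> itg g -> Er (fun w => f w - g w) = Er f - Er g.
Proof. by move=> hf hg; rewrite /Er RintegralB. Qed.

Lemma ErZ r f : itg f -> Er (fun w => r * f w) = r * Er f.
Proof. by move=> hf; rewrite /Er RintegralZl. Qed.

Lemma Er_cst r : Er (fun=> r) = r.
Proof. by rewrite /Er Rintegral_cst//= probability_setT mulr1. Qed.

Lemma Er_sum (I : Type) (s : seq I) (Q : pred I) (F : I -> T -> R) :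
  (forall i, Q i -> itg (F i)) ->
  Er (fun w => \sum_(i <- s | Q i) F i w) = \sum_(i <- s | Q i) Er (F i).
Proof.
move=> hF; elim: s => [|i s IH].
  by under eq_fun do rewrite big_nil; rewrite Er_cst big_nil.
under eq_fun do rewrite big_cons.
rewrite big_cons; case: (boolP (Q i)) => [Qi|_]; last exact: IH.
by rewrite ErD ?IH//; [exact: hF|exact: itg_sum].
Qed.

Lemma Er_le f g : itg f -> itg g -> (forall w, f w <= g w) -> Er f <= Er g.
Proof. by move=> hf hg fg; rewrite /Er le_Rintegral. Qed.

Lemma Er_ge0 f : (forall w, 0 <= f w) -> 0 <= Er f.
Proof. by move=> f0; rewrite /Er Rintegral_ge0. Qed.

Lemma Er_normr f : itg f -> `|Er f| <= Er (fun w => `|f w|).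
Proof. by move=> hf; rewrite /Er le_normr_Rintegral. Qed.

Lemma Er_EFin f : itg f -> (Er f)%:E = (\int[P]_w (f w)%:E)%E.
Proof. by move=> hf; rewrite /Er /Rintegral fineK//; apply: integrable_fin_num. Qed.

Lemma itg_ge0P f : measurable_fun setT f -> (forall w, 0 <= f w) ->
  (\int[P]_w (f w)%:E < +oo)%E -> itg f.
Proof.
move=> mf f0 h; apply/integrableP; split; first exact/measurable_EFinP.
by under eq_integral => w _ do rewrite /= ger0_norm//.
Qed.

Lemma measurable_bool (b : T -> bool) :
  measurable_fun setT b <-> measurable [set w | b w].
Proof.
split=> [mb|mb].
  by rewrite -[X in measurable X]setTI; apply: (mb measurableT [set true]).
by apply: (@measurable_fun_bool _ _ _ _ true); rewrite setTI.
Qed.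

Lemma natr_indic (b : T -> bool) :
  (fun w => (b w)%:R) = \1_[set w | b w] :> (T -> R).
Proof. by apply/funext => w; rewrite indicE mem_setE. Qed.

Lemma measurable_natr (b : T -> bool) : measurable_fun setT b ->
  measurable_fun setT (fun w => (b w)%:R : R).
Proof. by move=> /measurable_bool mb; rewrite natr_indic. Qed.

Lemma itg_bool (b : T -> bool) : measurable_fun setT b -> itg (fun w => (b w)%:R).
Proof.
move=> mb; apply: (@itg_bounded _ 1); first exact: measurable_natr.
by move=> w; case: (b w); rewrite ?normr1 ?normr0.
Qed.

Lemma Er_bool (b : T -> bool) : measurable_fun setT b ->
  (Er (fun w => (b w)%:R))%:E = P [set w | b w].
Proof.
move=> mb; rewrite Er_EFin; last exact: itg_bool.
rewrite -[in RHS](setIT [set w | b w]) -integral_indic//; last exact/measurable_bool.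
by apply: eq_integral => w _; rewrite -natr_indic.
Qed.

Lemma Er_set_int (B : set T) f : measurable B -> itg f ->
  (\int[P]_(w in B) (f w)%:E)%E = (Er (fun w => \1_B w * f w))%:E.
Proof.
move=> mB hf; rewrite integral_mkcond Er_EFin.
  by apply: eq_integral => w _; rewrite /patch indicE; case: ifP; rewrite ?mul1r ?mul0r.
apply: (itg_le (g := fun w => `|f w|)) (itg_norm hf).
  by apply: measurable_funM => //; exact: itg_measurable.
by move=> w; rewrite indicE; case: (_ \in _); rewrite ?mul1r// mul0r normr0.
Qed.

(** Takes the place of the Cauchy-Schwarz inequality: [e] is fixed first, then the second moment
    tends to 0. *)
Lemma Er_norm_le_sqr f e : 0 < e -> measurable_fun setT f ->
  itg (fun w => f w ^+ 2) ->
  Er (fun w => `|f w|) <= e + Er (fun w => f w ^+ 2) / e.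
Proof.
move=> e0 mf h2.
have amgm (x : R) : `|x| <= e + x ^+ 2 / e.
  rewrite -(ler_pM2r e0) mulrDl divfK ?gt_eqF// -real_normK ?num_real//.
  have := normr_ge0 x; move: `|x| => y y0; nra.
have h3 : itg (fun w => e + e^-1 * f w ^+ 2).
  by apply: itgD (itg_cst e) _; exact: itgZ.
rewrite mulrC -ErZ// -[X in X + _]Er_cst -ErD//; [|exact: itg_cst|exact: itgZ].
apply: Er_le => //; last by move=> w; rewrite mulrC.
apply: itg_le h3; first exact: measurableT_comp.
by move=> w; rewrite normr_id mulrC.
Qed.

Definition indep (U V : T -> R) := forall A B : set R, measurable A -> measurable B ->
  P (U @^-1` A `&` V @^-1` B) = (P (U @^-1` A) * P (V @^-1` B))%E.

(** The joint law agrees with the product of the marginals on rectangles, hence everywhere;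
    Tonelli's theorem then separates the integral. *)
Lemma indep_integralM (U V : {RV P >-> R}) : indep U V ->
  (forall w, 0 <= U w) -> (forall w, 0 <= V w) ->
  (\int[P]_w (U w * V w)%:E = (\int[P]_w (U w)%:E) * \int[P]_w (V w)%:E)%E.
Proof.
move=> UV U0 V0.
have mUV : measurable_fun setT (fun w => (U w, V w)).
  by apply: measurable_fun_pair.
pose W : {RV P >-> (R * R)%type} :=
  HB.pack (fun w => (U w, V w)) (isMeasurableFun.Build _ _ _ _ _ mUV).
have prodE : forall A, measurable A ->
    (distribution P U \x distribution P V)%E A = distribution P W A.
  by apply: product_measure_unique => A B mA mB; rewrite /= /pushforward -UV.
(* Absolute values make the integrand nonnegative on the whole plane without changing it on the
   values of [U] and [V]. *)
pose f (z : R * R) : \bar R := (`|z.1| * `|z.2|)%:E.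
have mf : measurable_fun setT f.
  apply/measurable_EFinP; apply: measurable_funM; apply: measurableT_comp => //.
have -> : (\int[P]_w (U w * V w)%:E = \int[distribution P W]_z f z)%E.
  rewrite ge0_integral_distribution//; last by move=> z; rewrite lee_fin mulr_ge0.
  by apply: eq_integral => w _; rewrite /f /= !ger0_norm.
transitivity (\int[distribution P U \x distribution P V]_z f z)%E.
  by apply: eq_measure_integral => A mA _; exact/esym/prodE.
rewrite fubini_tonelli1//; last by move=> z; rewrite lee_fin mulr_ge0.
have mn : measurable_fun setT (fun x : R => `|x|%:E) by apply/measurable_EFinP.
have -> : (\int[P]_w (U w)%:E = \int[distribution P U]_x `|x|%:E)%E.
  rewrite ge0_integral_distribution//.
  by apply: eq_integral => w _ /=; rewrite ger0_norm.
have -> : (\int[P]_w (V w)%:E = \int[distribution P V]_x `|x|%:E)%E.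
  rewrite ge0_integral_distribution//.
  by apply: eq_integral => w _ /=; rewrite ger0_norm.
rewrite -ge0_integralZr//; last by apply: integral_ge0.
apply: eq_integral => x _; rewrite /fubini_F /f /=.
by under eq_integral do rewrite EFinM; rewrite ge0_integralZl.
Qed.

Lemma indep_ErM f g : indep f g -> (forall w, 0 <= f w) -> (forall w, 0 <= g w) ->
  itg f -> itg g ->
  itg (fun w => f w * g w) /\ Er (fun w => f w * g w) = Er f * Er g.
Proof.
move=> fg f0 g0 hf hg.
have mf := itg_measurable hf; have mg := itg_measurable hg.
pose U : {RV P >-> R} := HB.pack f (isMeasurableFun.Build _ _ _ _ _ mf).
pose V : {RV P >-> R} := HB.pack g (isMeasurableFun.Build _ _ _ _ _ mg).
have e : (\int[P]_w (f w * g w)%:E = (\int[P]_w (f w)%:E) * \int[P]_w (g w)%:E)%E.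
  exact: (@indep_integralM U V fg f0 g0).
rewrite -(Er_EFin hf) -(Er_EFin hg) in e.
have h : itg (fun w => f w * g w).
  apply: itg_ge0P; first exact: measurable_funM.
    by move=> w; rewrite mulr_ge0.
  by rewrite e ltry.
by split=> //; apply: EFin_inj; rewrite Er_EFin// e EFinM.
Qed.

(** Dominated convergence: at each point the indicator is eventually 0, since [f] is finite
    there. *)
Lemma Er_tail f : itg f -> (forall w, 0 <= f w) ->
  Er (fun w => (n%:R < f w)%R%:R * f w) @[n --> \oo] --> 0.
Proof.
move=> hf f0; have mf := itg_measurable hf.
have mb n : measurable_fun setT (fun w => n%:R < f w).
  by apply: measurable_fun_ltr.
have bd n w : `|(n%:R < f w)%R%:R * f w| <= f w.
  by case: (_ < _); rewrite ?mul1r ?mul0r ?normr0// ger0_norm.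
have mtail n : measurable_fun setT (fun w => (n%:R < f w)%R%:R * f w).
  by apply: measurable_funM => //; exact: measurable_natr.
have itail n : itg (fun w => (n%:R < f w)%R%:R * f w) by exact: itg_le (bd n) hf.
have [|||||_ _] := @dominated_convergence _ _ _ P setT measurableT
   (fun n w => ((n%:R < f w)%R%:R * f w)%:E) (cst 0%E) (EFin \o f) => //.
- by move=> n; exact/measurable_EFinP.
- apply: aeW => w _; apply: cvg_near_cst; near=> n.
  suff -> : (n%:R < f w) = false by rewrite mul0r.
  by apply/negbTE; rewrite -leNgt; near: n; exact: nbhs_infty_ger.
- by apply: aeW => w n _; rewrite lee_fin.
rewrite integral_cst// mul0e; exact: fine_cvg.
Unshelve. all: by end_near. Qed.

End RealExpectation.

(** * Conditionally independent edges *)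

Lemma bigor_existsb (b : nat -> bool) n :
  [exists i : 'I_n, b i] = \big[orb/false]_(i < n) b i.
Proof.
rewrite big_has_cond; apply/existsP/hasP => [[i bi]|[i _]].
  by exists i => //; rewrite mem_index_enum.
by move=> /andP[_]; exists i.
Qed.

Section MeasurableCounts.
Context (d : measure_display) (T : measurableType d).

Lemma measurable_existsb (b : nat -> T -> bool) n :
  (forall i, measurable_fun setT (b i)) ->
  measurable_fun setT (fun w => [exists i : 'I_n, b i w]).
Proof.
move=> mb; under eq_fun => w do rewrite (bigor_existsb (fun i => b i w)).
elim: n => [|n IH]; first by under eq_fun do rewrite big_ord0; exact: measurable_cst.
under eq_fun do rewrite big_ord_recr /=.
exact: (measurable_fun_ifT IH (measurable_cst true) (mb n)).
Qed.

Lemma measurable_count (b : nat -> T -> bool) n m :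
  (forall i, measurable_fun setT (b i)) ->
  measurable_fun setT (fun w => (\sum_(i < n) b i w)%N == m).
Proof.
move=> mb; elim: n m => [|n IH] m.
  by under eq_fun do rewrite big_ord0; exact: measurable_cst.
pose prev w := if m is m'.+1 then (\sum_(i < n) b i w)%N == m' else false.
rewrite (_ : (fun w => _) = fun w =>
    if b n w then prev w else (\sum_(i < n) b i w)%N == m); last first.
  apply/funext => w; rewrite big_ord_recr /= /prev.
  by case: (b n w) => /=; rewrite ?addn0// addn1; case: (m).
apply: measurable_fun_ifT => //.
by rewrite /prev; case: (m) => [|m']; [exact: measurable_cst|exact: IH].
Qed.

End MeasurableCounts.

(* Pairs [(f, f')] such that [f] is a multilinear polynomial in the indicators of
   events [A k] and [f'] is the same polynomial in the conditional
   probabilities [p k]. *)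
Section Multilinear.
Context (d : measure_display) (T : measurableType d) (R : realType).
Variables (P : probability T R) (K : eqType) (A : K -> T -> bool) (p : K -> T -> R).
Hypothesis mA : forall k, measurable_fun setT (A k).
Hypothesis mp : forall k, measurable_fun setT (p k).
Hypothesis p01 : forall k w, 0 <= p k w <= 1.
Hypothesis Er_prod : forall s, uniq s ->
  Er P (fun w => \prod_(k <- s) (A k w)%:R) = Er P (fun w => \prod_(k <- s) p k w).

Inductive ml (S : pred K) : (T -> R) -> (T -> R) -> Prop :=
| ml_mono c s : uniq s -> all S s ->
    ml S (fun w => c * \prod_(k <- s) (A k w)%:R) (fun w => c * \prod_(k <- s) p k w)
| ml_add f f' g g' : ml S f f' -> ml S g g' ->
    ml S (fun w => f w + g w) (fun w => f' w + g' w).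

Lemma itg_prod01 (s : seq K) (F : K -> T -> R) :
  (forall k, measurable_fun setT (F k)) -> (forall k w, 0 <= F k w <= 1) ->
  itg P (fun w => \prod_(k <- s) F k w).
Proof.
move=> mF F01; apply: (@itg_bounded _ _ _ _ _ 1).
  elim: s => [|k s IH].
    by under eq_fun do rewrite big_nil; exact: measurable_cst.
  by under eq_fun do rewrite big_cons; exact: measurable_funM.
move=> w; have : 0 <= \prod_(k <- s) F k w <= 1.
  elim: s => [|k s /andP[h0 h1]]; first by rewrite big_nil ler01 lexx.
  have /andP[k0 k1] := F01 k w.
  by rewrite big_cons mulr_ge0//= mulr_ile1.
by move=> /andP[? ?]; rewrite ger0_norm.
Qed.

Lemma ml_Er S f f' : ml S f f' -> [/\ itg P f, itg P f' & Er P f = Er P f'].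
Proof.
elim=> {f f'} [c s us _|f f' g g' _ [if_ if' e] _ [ig ig' e']].
  have h1 : itg P (fun w => \prod_(k <- s) (A k w)%:R).
    apply: itg_prod01 => [k|k w]; first exact: measurable_natr.
    by case: (A k w); rewrite ?lexx ?ler01.
  have h2 : itg P (fun w => \prod_(k <- s) p k w) by exact: itg_prod01.
  by split; [exact: itgZ|exact: itgZ|rewrite !ErZ// Er_prod].
by split; [exact: itgD|exact: itgD|rewrite !ErD// e e'].
Qed.

Implicit Types (S SU : pred K) (c : R).

Lemma ml_mono_mul S S' SU c s g g' : uniq s -> all S s -> ml S' g g' ->
  (forall k, S k -> ~~ S' k) -> (forall k, S k || S' k -> SU k) ->
  ml SU (fun w => (c * \prod_(k <- s) (A k w)%:R) * g w)
         (fun w => (c * \prod_(k <- s) p k w) * g' w).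
Proof.
move=> us Ss h SS' SSU; elim: h => {g g'} [c' s' us' S's'|f f' g g' _ h1 _ h2].
  have e (F : K -> T -> R) : (fun w => (c * \prod_(k <- s) F k w) *
      (c' * \prod_(k <- s') F k w)) = (fun w => (c * c') * \prod_(k <- s ++ s') F k w).
    by apply/funext => w; rewrite big_cat /=; ring.
  rewrite (e (fun k w => (A k w)%:R)) (e p); apply: ml_mono.
    rewrite cat_uniq us us' andbT; apply/hasPn => k ks'; apply/negP => ks.
    have := SS' k (allP Ss _ ks).
    by rewrite (allP S's' _ ks').
  by rewrite all_cat; apply/andP; split; apply/allP => k ks; apply: SSU;
     rewrite ?(allP Ss _ ks)// (allP S's' _ ks) orbT.
have e (F G H : T -> R) : (fun w => F w * (G w + H w)) = (fun w => F w * G w + F w * H w).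
  by apply/funext => w; rewrite mulrDr.
by rewrite !e; exact: ml_add.
Qed.

(** Disjointness keeps the product multilinear: an indicator equals its square, a conditional
    probability in general does not. *)
Lemma ml_mul S S' SU f f' g g' : ml S f f' -> ml S' g g' ->
  (forall k, S k -> ~~ S' k) -> (forall k, S k || S' k -> SU k) ->
  ml SU (fun w => f w * g w) (fun w => f' w * g' w).
Proof.
move=> hf hg SS' SSU; elim: hf => {f f'} [c s us Ss|f f' h h' _ h1 _ h2].
  exact: ml_mono_mul hg SS' SSU.
have e (F G H : T -> R) : (fun w => (F w + G w) * H w) = (fun w => F w * H w + G w * H w).
  by apply/funext => w; rewrite mulrDl.
by rewrite !e; exact: ml_add.
Qed.

Lemma ml_cst S c : ml S (fun=> c) (fun=> c).
Proof.
have := @ml_mono S c [::] isT isT.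
by under eq_fun do rewrite big_nil mulr1; under [X in ml _ _ X]eq_fun do rewrite big_nil mulr1.
Qed.

Lemma ml_sub S S' f f' : ml S f f' -> (forall k, S k -> S' k) -> ml S' f f'.
Proof.
move=> h SS'; elim: h => {f f'} [c s us Ss|f f' h h' _ h1 _ h2]; last exact: ml_add.
by apply: ml_mono => //; apply: sub_all Ss.
Qed.

Lemma ml_opp S f f' : ml S f f' -> ml S (fun w => - f w) (fun w => - f' w).
Proof.
elim => {f f'} [c s us Ss|f f' h h' _ h1 _ h2].
  have e (F : T -> R) : (fun w => - (c * F w)) = (fun w => (- c) * F w).
    by apply/funext => w; rewrite mulNr.
  by rewrite (e (fun w => \prod_(k <- s) (A k w)%:R)) (e (fun w => \prod_(k <- s) p k w)); exact: ml_mono.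
have e (F G : T -> R) : (fun w => - (F w + G w)) = (fun w => - F w + - G w).
  by apply/funext => w; rewrite opprD.
by rewrite !e; exact: ml_add.
Qed.

Lemma ml_onem S f f' : ml S f f' -> ml S (fun w => 1 - f w) (fun w => 1 - f' w).
Proof. by move=> h; apply: ml_add (ml_cst _ _) (ml_opp h). Qed.

Lemma ml_atom (S : pred K) k : S k -> ml S (fun w => (A k w)%:R) (p k).
Proof.
move=> Sk; have := @ml_mono S 1 [:: k] isT.
rewrite /= andbT => /(_ Sk).
have e (F : K -> T -> R) : (fun w => 1 * \prod_(j <- [:: k]) F j w) = F k.
  by apply/funext => w; rewrite big_seq1 mul1r.
by rewrite (e (fun k w => (A k w)%:R)) (e p).
Qed.

End Multilinear.

(** * Neighbours of a vertex when the edges are conditionally independent *)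

Section PoissonApproximation.
Context (d : measure_display) (T : measurableType d) (R : realType).
Variables (P : probability T R) (A : nat * nat -> T -> bool) (p : nat * nat -> T -> R).
Hypothesis mA : forall k, measurable_fun setT (A k).
Hypothesis mp : forall k, measurable_fun setT (p k).
Hypothesis p01 : forall k w, 0 <= p k w <= 1.
Hypothesis Er_prod : forall s, uniq s ->
  Er P (fun w => \prod_(k <- s) (A k w)%:R) = Er P (fun w => \prod_(k <- s) p k w).
Variables (t N U : nat).

Local Notation Ae i u := (A ((i : nat), (u : nat))).
Local Notation pe i u := (p ((i : nat), (u : nat))).

Let cst n (c : R) : n%:R * c = \sum_(i < n) c.
Proof. by rewrite sumr_const card_ord mulr_natl. Qed.

Let two_path w i u := [&& Ae i t w, Ae i u w & u != t].

Definition neighbour_count w := (\sum_(u < U) [exists i : 'I_N, two_path w i u])%N.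
(** The events counted here use disjoint sets of edges for distinct [i], which makes them
    conditionally independent; those in [neighbour_count] share the edges at [t]. *)
Definition centre_count w := (\sum_(i < N) [exists u : 'I_U, two_path w i u])%N.

(** [q] is the conditional probability that [i] is a centre, and [r] the conditional mean number of
    paths through [i], which agrees with [q] to first order. *)
Let q i w : R := pe i t w * (1 - \prod_(u < U | u != t :> nat) (1 - pe i u w)).
Let r i w : R := pe i t w * \sum_(u < U | u != t :> nat) pe i u w.

Let centreE w i : [exists u : 'I_U, two_path w i u]%:R = (Ae i t w)%:R *
  (1 - \prod_(u < U | u != t :> nat) (1 - (Ae i u w)%:R)) :> R.
Proof.
case: existsP => [[u /and3P[-> iu ut]]|h].
  by rewrite (bigD1 u)//= iu subrr mul0r subr0 mulr1.
case At : (Ae i t w); last by rewrite mul0r.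
rewrite big1 ?subrr ?mulr0// => u ut.
case iu : (Ae i u w); last by rewrite subr0.
by case: h; exists u; rewrite /two_path At iu ut.
Qed.

Let ml_leaves i n : ml A p (fun k => [&& k.1 == i, (k.2 < n)%N & k.2 != t])
  (fun w => \prod_(u < n | u != t :> nat) (1 - (Ae i u w)%:R))
  (fun w => \prod_(u < n | u != t :> nat) (1 - pe i u w)).
Proof.
elim: n => [|n IH].
  have e (F : nat -> T -> R) : (fun w => \prod_(u < 0 | u != t :> nat) (1 - F u w)) = fun=> 1.
    by apply/funext => w; rewrite big_ord0.
  by rewrite (e (fun u w => (Ae i u w)%:R)) (e (fun u => pe i u)); exact: ml_cst.
have e (F : nat -> T -> R) :
    (fun w => \prod_(u < n.+1 | u != t :> nat) (1 - F u w)) =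
    if n != t then fun w => \prod_(u < n | u != t :> nat) (1 - F u w) * (1 - F n w)
    else fun w => \prod_(u < n | u != t :> nat) (1 - F u w).
  case: ifP => nt; apply/funext => w; rewrite big_mkcond big_ord_recr -big_mkcond /= nt//.
  by rewrite mulr1.
rewrite (e (fun u w => (Ae i u w)%:R)) (e (fun u => pe i u)).
case: ifP => nt; last first.
  by apply: ml_sub IH _ => k /and3P[-> kn ->]; rewrite ltnW.
apply: (ml_mul (S' := pred1 (i, n)) IH).
- by apply: ml_onem; apply: ml_atom; rewrite /= eqxx.
- move=> k /and3P[_ kn _]; apply/negP => /eqP kE; by move: kn; rewrite kE ltnn.
- move=> k /orP[/and3P[-> kn ->]|/eqP->]; first by rewrite ltnW.
  by rewrite /= eqxx ltnSn nt.
Qed.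

Let ml_centre i : ml A p (fun k => k.1 == i)
  (fun w => [exists u : 'I_U, two_path w i u]%:R) (q i).
Proof.
rewrite (funext (centreE ^~ i)).
apply: (ml_mul (S := pred1 (i, t)) _ (ml_onem (ml_leaves i U))).
- by apply: ml_atom; rewrite /= eqxx.
- by move=> k /eqP-> /=; rewrite !eqxx /= andbF.
- by move=> k /orP[/eqP->|/and3P[->]].
Qed.

(** The recursion on the last centre is that of [poisson_binomial]. The edges at [n] do not occur
    among those at earlier centres, so [ml_mul] applies. *)
Let ml_centre_count n m : ml A p (fun k => (k.1 < n)%N)
  (fun w => ((\sum_(i < n) [exists u : 'I_U, two_path w i u])%N == m)%:R)
  (fun w => poisson_binomial (fun i => q i w) n m).
Proof.
elim: n m => [|n IH] m.
  rewrite [X in ml _ _ _ X _](_ : _ = fun=> (m == 0%N)%:R); first exact: ml_cst.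
  by apply/funext => w; rewrite big_ord0 eq_sym.
pose Z w := [exists u : 'I_U, two_path w n u].
pose pv w : R := if m is m'.+1 then
  ((\sum_(i < n) [exists u : 'I_U, two_path w i u])%N == m')%:R else 0.
have -> : (fun w => ((\sum_(i < n.+1) [exists u : 'I_U, two_path w i u])%N == m)%:R) =
   (fun w => (1 - (Z w)%:R) * ((\sum_(i < n) [exists u : 'I_U, two_path w i u])%N == m)%:R
             + (Z w)%:R * pv w).
  apply/funext => w; rewrite big_ord_recr /= -/(Z w) /pv.
  case: (Z w) => /=; last by rewrite addn0 subr0 mul1r mul0r addr0.
  by rewrite addn1 subrr mul0r add0r mul1r; case: (m).
have disj (k : nat * nat) : k.1 == n -> ~~ (k.1 < n)%N by move=> /eqP->; rewrite ltnn.
have cover (k : nat * nat) : (k.1 == n) || (k.1 < n)%N -> (k.1 < n.+1)%N.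
  by rewrite ltnS (leq_eqVlt k.1 n).
apply: ml_add.
  exact: ml_mul (ml_onem (ml_centre n)) (IH m) disj cover.
apply: (ml_mul (ml_centre n) _ disj cover).
by rewrite /pv; case: (m) => [|m'] /=; [exact: ml_cst|exact: IH].
Qed.

Let q01 i w : 0 <= q i w <= 1.
Proof.
have [/andP[h0 h1] _ _] := @prod_onem_bounds R (fun u => pe i u w)
  (fun u => u != t) U (fun u _ => p01 (i, (u : nat)) w).
have /andP[p0 p1] := p01 ((i : nat), t) w.
rewrite /q; apply/andP; split; first by rewrite mulr_ge0// subr_ge0.
by rewrite mulr_ile1// ?subr_ge0// gerBl.
Qed.

Let q_r i w :
  0 <= r i w - q i w <= pe i t w * (\sum_(u < U | u != t :> nat) pe i u w) ^+ 2.
Proof.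
have [_ hl hu] := @prod_onem_bounds R (fun u => pe i u w)
  (fun u => u != t) U (fun u _ => p01 (i, (u : nat)) w).
have /andP[p0 p1] := p01 ((i : nat), t) w.
rewrite /r /q -mulrBr; apply/andP; split; first by rewrite mulr_ge0//; lra.
by rewrite ler_wpM2l//; lra.
Qed.

Let sum_p_ge0 i w : 0 <= \sum_(u < U | u != t :> nat) pe i u w.
Proof. by apply: sumr_ge0 => u _; have /andP[] := p01 (i, (u : nat)) w. Qed.

Definition path_intensity w : R := \sum_(i < N) r i w.

Lemma path_intensity_ge0 w : 0 <= path_intensity w.
Proof.
by apply: sumr_ge0 => i _; rewrite mulr_ge0//; have /andP[] := p01 ((i : nat), t) w.
Qed.

Lemma measurable_path_intensity : measurable_fun setT path_intensity.
Proof.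
apply: measurable_sum => i; apply: measurable_funM => //.
rewrite (_ : (fun w => _) = fun w => \sum_(u < U) if u != t :> nat then pe i u w else 0).
  by apply: measurable_sum => u; case: (u != t :> nat); [exact: mp|exact: measurable_cst].
by apply/funext => w; rewrite big_mkcond.
Qed.

Variable eps : R.
Hypothesis eps0 : 0 <= eps.
(** The bound concerns only the centres within reach of [t]; elsewhere, for small [i], edge
    probabilities may be large. *)
Hypothesis p_eps : forall i w, pe i t w != 0 -> forall u, pe i u w <= eps.

Let pt_le i w : pe i t w <= eps.
Proof.
by have [->//|/p_eps] := eqVneq (pe i t w) 0.
Qed.

Let sum_le i w : pe i t w != 0 ->
  \sum_(u < U | u != t :> nat) pe i u w <= U%:R * eps.
Proof.
move=> h; apply: le_trans (_ : \sum_(u < U) eps <= _); last first.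
  by rewrite sumr_const card_ord mulr_natl.
rewrite big_mkcond; apply: ler_sum => u _; case: ifP => // _; exact: p_eps.
Qed.

Let r_le i w : r i w <= eps * (U%:R * eps).
Proof.
rewrite /r; have [->|h] := eqVneq (pe i t w) 0; first by rewrite mul0r !mulr_ge0.
have /andP[p0 _] := p01 ((i : nat), t) w.
exact: ler_pM p0 (sum_p_ge0 i w) (pt_le i w) (sum_le h).
Qed.

Let r_q_le i w : `|q i w - r i w| <= eps * (U%:R * eps) ^+ 2.
Proof.
have /andP[h0 h1] := q_r i w.
rewrite distrC ger0_norm// (le_trans h1)//.
have [->|h] := eqVneq (pe i t w) 0; first by rewrite mul0r !mulr_ge0 ?sqr_ge0.
have /andP[p0 _] := p01 ((i : nat), t) w.
apply: ler_pM (pt_le i w) _ => //; first exact: sqr_ge0.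
have UE : 0 <= U%:R * eps by rewrite mulr_ge0.
by rewrite ler_pXn2r ?nnegrE//; exact: sum_le.
Qed.

Lemma measurable_pois (f : T -> R) m : measurable_fun setT f ->
  measurable_fun setT (fun w => pois (f w) m).
Proof.
move=> mf; apply: measurable_funM.
  by apply: measurableT_comp => //; exact: measurableT_comp.
by apply: measurable_funM => //; exact: measurable_funX.
Qed.

Lemma itg_pois (f : T -> R) m : measurable_fun setT f -> (forall w, 0 <= f w) ->
  itg P (fun w => pois (f w) m).
Proof.
move=> mf f0; apply: (@itg_bounded _ _ _ _ _ 1); first exact: measurable_pois.
by move=> w; rewrite ger0_norm ?pois_ge0 ?pois_le1.
Qed.

(** The first error term is that of Le Cam's inequality; the second comes from replacing the sum of
    the [q i] by that of the [r i]. *)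
Lemma centre_count_pois m :
  `|Er P (fun w => (centre_count w == m)%:R) - Er P (fun w => pois (path_intensity w) m)|
  <= N%:R * (2 * (eps * (U%:R * eps)) ^+ 2 + eps * (U%:R * eps) ^+ 2).
Proof.
have [ic ipb ->] := ml_Er mA mp p01 Er_prod (ml_centre_count N m).
have ipo := itg_pois m measurable_path_intensity path_intensity_ge0.
rewrite -ErB// (le_trans (Er_normr (itgB ipb ipo)))//.
set C := N%:R * _.
rewrite -[C](@Er_cst _ _ _ P); apply: Er_le (itg_norm (itgB ipb ipo)) (itg_cst _ _) _ => w.
have s0 : 0 <= \sum_(i < N) q i w by apply: sumr_ge0 => i _; have /andP[] := q01 i w.
rewrite -[X in `|X|](subrKA (pois (\sum_(i < N) q i w) m)) addrC.
rewrite (le_trans (ler_normD _ _))// addrC.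
rewrite /C mulrDr lerD//.
  apply: le_trans (le_cam N m (q01 ^~ w)) _.
  rewrite mulrCA ler_pM2l// [X in _ <= X]cst.
  apply: ler_sum => i _; have /andP[q0 _] := q01 i w.
  rewrite ler_pXn2r// ?nnegrE ?q0 ?mulr_ge0//.
  by apply: le_trans (r_le i w); have /andP[+ _] := q_r i w; rewrite subr_ge0.
apply: le_trans (pois_lip m s0 (path_intensity_ge0 w)) _.
rewrite -sumrB (le_trans (ler_norm_sum _ _ _))//.
rewrite [X in _ <= X]cst.
exact: ler_sum.
Qed.

Let mtwo i u : measurable_fun setT (fun w => two_path w i u).
Proof.
rewrite /two_path; apply: measurable_and => //; apply: measurable_and => //.
Qed.

Lemma measurable_neighbour_count m :
  measurable_fun setT (fun w => neighbour_count w == m).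
Proof.
apply: (measurable_count (b := fun u w => [exists i : 'I_N, two_path w i u])) => u.
apply: (measurable_existsb (b := fun i w => two_path w i u)) => i; exact: mtwo.
Qed.

(* Unless one of these two configurations occurs, the neighbours of [t] and the
   centres of the paths leading to them are in bijection. *)
Let cherry w i u v : R :=
  ((Ae i t w)%:R * (Ae i u w)%:R * (Ae i v w)%:R)
   * [&& u != v, u != t & v != t]%:R.
Let cycle4 w i j u : R :=
  ((Ae i t w)%:R * (Ae j t w)%:R * (Ae i u w)%:R * (Ae j u w)%:R)
   * ((i != j) && (u != t))%:R.

(** The left side is at most 1. If a cherry or a four-cycle occurs, the right side is at least 1;
    otherwise the paths form a matching of centres with neighbours. *)
Let counts_differ w m :
  `|(neighbour_count w == m)%:R - (centre_count w == m)%:R| <=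
    \sum_(i < N) \sum_(u < U) \sum_(v < U) cherry w i u v +
    \sum_(i < N) \sum_(j < N) \sum_(u < U) cycle4 w i j u.
Proof.
have c0 i u v : 0 <= cherry w i u v by rewrite !mulr_ge0.
have y0 i j u : 0 <= cycle4 w i j u by rewrite !mulr_ge0.
have sc0 : 0 <= \sum_(i < N) \sum_(u < U) \sum_(v < U) cherry w i u v.
  by do 3 (apply: sumr_ge0 => ? _).
have sy0 : 0 <= \sum_(i < N) \sum_(j < N) \sum_(u < U) cycle4 w i j u.
  by do 3 (apply: sumr_ge0 => ? _).
have [->|ne] := eqVneq (neighbour_count w) (centre_count w).
  by rewrite subrr normr0 addr_ge0.
apply: (@le_trans _ _ 1).
  by do 2 case: (_ == m); rewrite ?subrr ?subr0 ?sub0r ?normrN ?normr1 ?normr0.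
have [[i [u [v h]]]|nc] := pselect (exists i : 'I_N, exists u v : 'I_U, cherry w i u v = 1).
  apply: ler_wpDr => //.
  rewrite (bigD1 i)//= (bigD1 u)//= (bigD1 v)//= h -!addrA lerDl !addr_ge0//.
  - by apply: sumr_ge0.
  - by do 2 (apply: sumr_ge0 => ? _).
  - by do 3 (apply: sumr_ge0 => ? _).
have [[i [j [u h]]]|ny] := pselect (exists i j : 'I_N, exists u : 'I_U, cycle4 w i j u = 1).
  apply: ler_wpDl => //.
  rewrite (bigD1 i)//= (bigD1 j)//= (bigD1 u)//= h -!addrA lerDl !addr_ge0//.
  - by apply: sumr_ge0.
  - by do 2 (apply: sumr_ge0 => ? _).
  - by do 3 (apply: sumr_ge0 => ? _).
case/eqP: ne.
(* The bounds are built into the relation because [sum_exists_swap] asks for injectivity over all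
   natural numbers. *)
pose e i u := [&& (i < N)%N, (u < U)%N & two_path w i u].
have := @sum_exists_swap e N U.
have eE : (neighbour_count w = \sum_(u < U) [exists i : 'I_N, e i u])%N.
  apply: eq_bigr => u _; congr nat_of_bool; apply: eq_existsb => i.
  by rewrite /e !ltn_ord.
have eE' : (centre_count w = \sum_(i < N) [exists u : 'I_U, e i u])%N.
  apply: eq_bigr => u _; congr nat_of_bool; apply: eq_existsb => i.
  by rewrite /e !ltn_ord.
rewrite eE eE'; apply.
- move=> i u v /and3P[iN uU /and3P[At Au ut]] /and3P[_ vU /and3P[_ Av vt]].
  apply/eqP; apply: contrapT => /negP uv; apply: nc.
  exists (Ordinal iN), (Ordinal uU), (Ordinal vU).
  by rewrite /cherry /= At Au Av uv ut vt !mulr1.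
- move=> i j u /and3P[iN uU /and3P[At Au ut]] /and3P[jN _ /and3P[Bt Bu _]].
  apply/eqP; apply: contrapT => /negP ij; apply: ny.
  exists (Ordinal iN), (Ordinal jN), (Ordinal uU).
  by rewrite /cycle4 /= At Au Bt Bu ij ut !mulr1.
Qed.

(** [c] will say that the vertices of the configuration are distinct; without that, edges could
    coincide and [Er_prod] would not apply. *)
Let Er_prod_le s (c : bool) e : 0 <= e ->
  (c -> uniq s) -> (forall w, \prod_(k <- s) p k w <= e) ->
  itg P (fun w => \prod_(k <- s) (A k w)%:R * c%:R) /\
  Er P (fun w => \prod_(k <- s) (A k w)%:R * c%:R) <= e.
Proof.
move=> e0 us le; case: c us => [/(_ isT) us|_]; last first.
  by under eq_fun do rewrite mulr0; rewrite Er_cst; split => //; exact: itg_cst.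
under eq_fun do rewrite mulr1.
have h := @ml_mono _ _ _ _ A p xpredT 1 s us (all_predT s).
have [i1 i2 _] := ml_Er mA mp p01 Er_prod h.
have e1 (F : nat * nat -> T -> R) :
    (fun w => 1 * \prod_(k <- s) F k w) = (fun w => \prod_(k <- s) F k w).
  by apply/funext => w; rewrite mul1r.
rewrite (e1 (fun k w => (A k w)%:R)) in i1.
rewrite e1 in i2.
split=> //; rewrite Er_prod// -[e](@Er_cst _ _ _ P).
exact: Er_le i2 (itg_cst _ _) le.
Qed.

Let cherry_le i u v : itg P (fun w => cherry w i u v) /\
  Er P (fun w => cherry w i u v) <= eps ^+ 3.
Proof.
have := @Er_prod_le [:: (i, t); (i, u); (i, v)] [&& u != v, u != t & v != t] (eps ^+ 3).
rewrite /cherry.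
have -> : (fun w => \prod_(k <- [:: (i, t); (i, u); (i, v)]) (A k w)%:R *
    [&& u != v, u != t & v != t]%:R) = (fun w => cherry w i u v).
  by apply/funext => w; rewrite !big_cons big_nil mulr1 /cherry !mulrA.
apply; first exact: exprn_ge0.
- move=> /and3P[uv ut vt]; rewrite /= !inE !xpair_eqE !eqxx /= !(eq_sym t).
  by rewrite (negbTE uv) (negbTE ut) (negbTE vt).
move=> w; rewrite !big_cons big_nil mulr1.
have [->|h] := eqVneq (pe i t w) 0; first by rewrite mul0r exprn_ge0.
have /andP[p0 _] := p01 ((i : nat), t) w.
have /andP[p1 _] := p01 (i, (u : nat)) w.
have /andP[p2 _] := p01 (i, (v : nat)) w.
rewrite exprS expr2; apply: ler_pM => //; first exact: mulr_ge0.
by apply: ler_pM => //; exact: p_eps.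
Qed.

Let cycle4_le i j u : itg P (fun w => cycle4 w i j u) /\
  Er P (fun w => cycle4 w i j u) <= eps ^+ 4.
Proof.
have := @Er_prod_le [:: (i, t); (j, t); (i, u); (j, u)] ((i != j) && (u != t)) (eps ^+ 4).
have -> : (fun w => \prod_(k <- [:: (i, t); (j, t); (i, u); (j, u)]) (A k w)%:R *
    ((i != j) && (u != t))%:R) = (fun w => cycle4 w i j u).
  by apply/funext => w; rewrite !big_cons big_nil mulr1 /cycle4 !mulrA.
apply; first exact: exprn_ge0.
- move=> /andP[ij ut]; rewrite /= !inE !xpair_eqE !eqxx /= !(eq_sym t).
  by rewrite (negbTE ij) (negbTE ut) !andbF.
move=> w; rewrite !big_cons big_nil mulr1.
have [->|h] := eqVneq (pe i t w) 0; first by rewrite mul0r exprn_ge0.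
have [->|h'] := eqVneq (pe j t w) 0; first by rewrite mul0r mulr0 exprn_ge0.
have /andP[p0 _] := p01 ((i : nat), t) w.
have /andP[p1 _] := p01 (i, (u : nat)) w.
have /andP[p2 _] := p01 (j, t) w.
have /andP[p3 _] := p01 (j, (u : nat)) w.
rewrite exprS exprS expr2; apply: ler_pM => //; first by rewrite !mulr_ge0.
apply: ler_pM => //; first by rewrite !mulr_ge0.
by apply: ler_pM => //; exact: p_eps.
Qed.

(** The last two error terms bound the expected numbers of cherries and of four-cycles. *)
Lemma neighbour_count_pois m :
  `|Er P (fun w => (neighbour_count w == m)%:R)
    - Er P (fun w => pois (path_intensity w) m)|
  <= N%:R * (2 * (eps * (U%:R * eps)) ^+ 2 + eps * (U%:R * eps) ^+ 2)
   + (N%:R * (U%:R * (U%:R * eps ^+ 3)) + N%:R * (N%:R * (U%:R * eps ^+ 4))).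
Proof.
have [ic _ _] := ml_Er mA mp p01 Er_prod (ml_centre_count N m).
have inb := @itg_bool _ _ _ P _ (measurable_neighbour_count m).
rewrite -[X in `|X|](subrKA (Er P (fun w => (centre_count w == m)%:R))) addrC.
rewrite (le_trans (ler_normD _ _))// lerD ?centre_count_pois//.
rewrite -ErB// (le_trans (Er_normr (itgB inb ic)))//.
have i1 i : itg P (fun w => \sum_(u < U) \sum_(v < U) cherry w i u v).
  by apply: itg_sum => u _; apply: itg_sum => v _; have [] := cherry_le i u v.
have i2 i : itg P (fun w => \sum_(j < N) \sum_(u < U) cycle4 w i j u).
  by apply: itg_sum => u _; apply: itg_sum => v _; have [] := cycle4_le i u v.
have i1' : itg P (fun w => \sum_(i < N) \sum_(u < U) \sum_(v < U) cherry w i u v).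
  by apply: itg_sum => i _.
have i2' : itg P (fun w => \sum_(i < N) \sum_(j < N) \sum_(u < U) cycle4 w i j u).
  by apply: itg_sum => i _.
apply: le_trans (Er_le (itg_norm (itgB inb ic)) (itgD i1' i2') (counts_differ ^~ m)) _.
rewrite ErD// !cst lerD//.
  rewrite Er_sum//; apply: ler_sum => i _.
  rewrite Er_sum; last by move=> u _; apply: itg_sum => v _; have [] := cherry_le i u v.
  apply: ler_sum => u _.
  rewrite Er_sum; last by move=> v _; have [] := cherry_le i u v.
  by apply: ler_sum => v _; have [] := cherry_le i u v.
rewrite Er_sum//; apply: ler_sum => i _.
rewrite Er_sum; last by move=> u _; apply: itg_sum => v _; have [] := cycle4_le i u v.
apply: ler_sum => u _.
rewrite Er_sum; last by move=> v _; have [] := cycle4_le i u v.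
by apply: ler_sum => v _; have [] := cycle4_le i u v.
Qed.

End PoissonApproximation.

(** * The random intersection model *)

Section IndependentSequence.
Context (d : measure_display) (T : measurableType d) (R : realType).
Variables (P : probability T R) (X : nat -> {RV P >-> R}).
Let D := [set i : nat | (0 < i)%N].

(** [G] is left general: it is the generator of one family when X and Y are separated, and of both
    when an event is used for conditioning. *)
Lemma measurable_sigma_gen (G : set (set T)) i (f : R -> R) : D i ->
  sigma_gen D (fun i => X i : T -> R) `<=` <<s G >> -> measurable_fun setT f ->
  measurable_fun (setT : set (g_sigma_algebraType G)) (fun w => f (X i w)).
Proof.
move=> Di XG mf _ B mB; rewrite setTI.
apply: XG; apply: sub_sigma_algebra; exists i => //.
exists (f @^-1` B); last by rewrite setTI.
by rewrite -[X in measurable X]setTI; exact: mf.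
Qed.

Hypothesis X_iid : iid P D (fun i => X i : T -> R).

Lemma iid_indep i j (f g : R -> R) : D i -> D j -> i <> j ->
  measurable_fun setT f -> measurable_fun setT g ->
  indep P (fun w => f (X i w)) (fun w => g (X j w)).
Proof.
move=> Di Dj ij mf mg A B mA mB; have [ind _] := X_iid.
have mfA : measurable (f @^-1` A) by rewrite -[X in measurable X]setTI; exact: mf.
have mgB : measurable (g @^-1` B) by rewrite -[X in measurable X]setTI; exact: mg.
have ji : (j == i) = false by apply/eqP => e; apply: ij.
have := ind [fset i; j]%fset (fun k => if k == i then f @^-1` A else g @^-1` B).
have sD : [set` [fset i; j]%fset] `<=` D.
  by move=> k /=; rewrite !inE => /orP[] /eqP->.
move=> /(_ sD).
have mk k : measurable (if k == i then f @^-1` A else g @^-1` B) by case: ifP.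
move=> /(_ mk).
rewrite big_fsetU1 ?inE 1?eq_sym ?ji//= big_seq_fset1 eqxx ji => <-.
congr (P _); apply/seteqP; split => w.
  move=> [fA gB] k /=; rewrite !inE => /orP[] /eqP->; first by rewrite eqxx.
  by rewrite ji.
move=> h; split; first by have := h i; rewrite /= eqxx; apply; rewrite !inE eqxx.
by have := h j; rewrite /= ji; apply; rewrite !inE eqxx orbT.
Qed.

Lemma iid_integral i (f : R -> R) : D i -> measurable_fun setT f ->
  (forall x, 0 <= f x) ->
  (\int[P]_w (f (X i w))%:E = \int[P]_w (f (X 1%N w))%:E)%E.
Proof.
move=> Di mf f0; have [_ idd] := X_iid.
have mf' : measurable_fun setT (fun x => (f x)%:E) by exact/measurable_EFinP.
have h k : (\int[P]_w (f (X k w))%:E = \int[distribution P (X k)]_x (f x)%:E)%E.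
  by rewrite ge0_integral_distribution// => x; rewrite lee_fin.
rewrite !h; apply: eq_measure_integral => A mA _.
exact: idd.
Qed.

Lemma iid_itg i (f : R -> R) : D i -> measurable_fun setT f ->
  (forall x, 0 <= f x) -> itg P (fun w => f (X 1%N w)) -> itg P (fun w => f (X i w)).
Proof.
move=> Di mf f0 h; apply: itg_ge0P => //; first exact: measurableT_comp.
by rewrite iid_integral// -Er_EFin// ltry.
Qed.

Lemma iid_Er i (f : R -> R) : D i -> measurable_fun setT f ->
  (forall x, 0 <= f x) -> Er P (fun w => f (X i w)) = Er P (fun w => f (X 1%N w)).
Proof. by move=> Di mf f0; rewrite /Er /Rintegral iid_integral. Qed.

Lemma iid_ErM i j (f g : R -> R) : D i -> D j -> i <> j ->
  measurable_fun setT f -> measurable_fun setT g ->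
  (forall x, 0 <= f x) -> (forall x, 0 <= g x) ->
  itg P (fun w => f (X 1%N w)) -> itg P (fun w => g (X 1%N w)) ->
  itg P (fun w => f (X i w) * g (X j w)) /\
  Er P (fun w => f (X i w) * g (X j w)) =
    Er P (fun w => f (X 1%N w)) * Er P (fun w => g (X 1%N w)).
Proof.
move=> Di Dj ij mf mg f0 g0 hf hg.
rewrite -(iid_Er Di mf f0) -(iid_Er Dj mg g0).
apply: indep_ErM => //; first exact: iid_indep.
  exact: iid_itg.
exact: iid_itg.
Qed.

End IndependentSequence.

Section Model.
Context (R : realType) (d : measure_display) (T : measurableType d).
Variables (P : probability T R) (a b nu : R) (X Y : nat -> {RV P >-> R}).
Variable H : T -> nat -> nat -> bool.
Hypothesis model : random_intersection_model a b (fun t => t%:R `^ nu) X Y H.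

Let D := [set i : nat | (0 < i)%N].
Let XG := sigma_gen D (fun i => X i : T -> R).
Let YG := sigma_gen D (fun i => Y i : T -> R).
Let gen := XG `|` YG.

Lemma sigma_gen_indep (f g : T -> R) :
  measurable_fun (setT : set (g_sigma_algebraType (\bigcup_(i in D) preimage_set_system setT (X i) measurable))) f ->
  measurable_fun (setT : set (g_sigma_algebraType (\bigcup_(i in D) preimage_set_system setT (Y i) measurable))) g ->
  indep P f g.
Proof.
move=> mf mg A B mA mB; apply: (XY_independent model).
  by have := mf measurableT A mA; rewrite setTI.
by have := mg measurableT B mB; rewrite setTI.
Qed.

(** Two factors of each kind are what second moments of products X_i^2 Y_u require; lower moments
    follow by taking some functions constant. The indices may coincide. *)
Lemma pairs_ErM i j t u (f1 f2 g1 g2 : R -> R) : D i -> D j -> D t -> D u ->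
  measurable_fun setT f1 -> measurable_fun setT f2 ->
  measurable_fun setT g1 -> measurable_fun setT g2 ->
  (forall x, 0 <= f1 x) -> (forall x, 0 <= f2 x) ->
  (forall x, 0 <= g1 x) -> (forall x, 0 <= g2 x) ->
  itg P (fun w => f1 (X i w) * f2 (X j w)) ->
  itg P (fun w => g1 (Y t w) * g2 (Y u w)) ->
  itg P (fun w => (f1 (X i w) * f2 (X j w)) * (g1 (Y t w) * g2 (Y u w))) /\
  Er P (fun w => (f1 (X i w) * f2 (X j w)) * (g1 (Y t w) * g2 (Y u w))) =
    Er P (fun w => f1 (X i w) * f2 (X j w)) * Er P (fun w => g1 (Y t w) * g2 (Y u w)).
Proof.
move=> Di Dj Dt Du m1 m2 m3 m4 f10 f20 g10 g20 h1 h2.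
apply: indep_ErM => //; first (apply: sigma_gen_indep).
- by apply: measurable_funM;
    [apply: (@measurable_sigma_gen _ _ _ P X _ i f1)|apply: (@measurable_sigma_gen _ _ _ P X _ j f2)].
- by apply: measurable_funM;
    [apply: (@measurable_sigma_gen _ _ _ P Y _ t g1)|apply: (@measurable_sigma_gen _ _ _ P Y _ u g2)].
- by move=> w; rewrite mulr_ge0.
- by move=> w; rewrite mulr_ge0.
Qed.

Definition ep (k : nat * nat) (w : T) : R :=
  edge_prob a b (fun t => t%:R `^ nu) (fun i => X i w) (fun j => Y j w) k.1 k.2.

Definition positive (k : nat * nat) := (0 < k.1)%N && (0 < k.2)%N.

Lemma ep01 k w : positive k -> 0 <= ep k w <= 1.
Proof.
move=> /andP[k1 k2]; rewrite /ep /edge_prob.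
have h : 0 <= X k.1 w * Y k.2 w / Num.sqrt (k.1%:R * k.2%:R).
  by rewrite divr_ge0 ?sqrtr_ge0// mulr_ge0 ?(X_ge0 model) ?(Y_ge0 model).
set c := (a * _ <= _ <= _).
apply/andP; split; first by rewrite mulr_ge0// le_min ler01 h.
by case: c; rewrite ?mulr0 ?ler01// mulr1 ge_min lexx.
Qed.

Lemma edge_version (s : seq (nat * nat)) : uniq s -> all positive s ->
  cond_prob_version P <<s gen >> [set w | all (fun k => H w k.1 k.2) s]
    (fun w => \prod_(k <- s) ep k w).
Proof.
move=> us ps.
pose F := [fset k in s]%fset.
have sF : [set` F] `<=` [set e : nat * nat | (0 < e.1)%N /\ (0 < e.2)%N].
  by move=> k /=; rewrite inE => /(allP ps)/andP.
have := edge_cond_independent model sF.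
congr cond_prob_version.
  apply/seteqP; split => w /=.
    by move=> h; apply/allP => k ks; apply: h; rewrite /= inE.
  by move=> /allP h k /=; rewrite inE => /h.
apply/funext => w; apply: perm_big; apply: uniq_perm => //.
by move=> k; rewrite inE.
Qed.

Lemma measurable_edge k : positive k -> measurable_fun setT (fun w => H w k.1 k.2).
Proof.
by move=> /andP[k1 k2]; apply/measurable_bool; exact: (edge_measurable model).
Qed.

Lemma measurable_ep k : positive k -> measurable_fun setT (ep k).
Proof.
move=> pk; have [] := @edge_version [:: k] isT; first by rewrite /= pk.
move=> _ h _; have := itg_measurable (h : itg P _).
by under eq_fun do rewrite big_seq1.
Qed.

Lemma sub_gen_measurable : <<s gen >> `<=` @measurable _ T.
Proof.
have XS (Z : nat -> {RV P >-> R}) :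
    sigma_gen D (fun i => Z i : T -> R) `<=` @measurable _ T.
  apply: smallest_sub; first exact: sigma_algebra_measurable.
  by move=> B [i Di [C mC <-]]; rewrite setTI; exact: measurable_funPTI.
apply: smallest_sub; first exact: sigma_algebra_measurable.
by move=> B []; exact: XS.
Qed.

(** The defining property of the conditional probability, integrated over an event determined by X
    and Y; that event will express that vertices are light or heavy. *)
Lemma cond_Er s (c : T -> bool) : uniq s -> all positive s ->
  measurable_fun (setT : set (g_sigma_algebraType gen)) c ->
  Er P (fun w => (c w)%:R * \prod_(k <- s) (H w k.1 k.2)%:R) =
  Er P (fun w => (c w)%:R * \prod_(k <- s) ep k w).
Proof.
move=> us ps mc.
have [_ ip /(_ [set w | c w])] := edge_version us ps.
have gc : <<s gen >> [set w | c w].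
  have := mc measurableT [set true] (I : measurable [set true]).
  by rewrite setTI; congr (_ _); apply/seteqP; split => w /=.
move=> /(_ gc); have mc' := sub_gen_measurable gc.
rewrite Er_set_int// -natr_indic => e.
apply: EFin_inj; rewrite e.
have -> : (fun w => (c w)%:R * \prod_(k <- s) (H w k.1 k.2)%:R) =
    (fun w => (all (fun k => H w k.1 k.2) s && c w)%:R) :> (T -> R).
  apply/funext => w; rewrite -mulnb natrM mulrC; congr (_ * _).
  by elim: (s) => [|k s' IH]; rewrite ?big_nil// big_cons /= -mulnb natrM IH.
rewrite Er_bool.
  by congr (P _); apply/seteqP; split => w /=; [move=> /andP|move=> /andP].
apply: measurable_and; last exact/measurable_bool.
elim: s ps {us ip e} => [|k s IH] /=; first by move=> _; exact: measurable_cst.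
by move=> /andP[pk ps]; apply: measurable_and; [exact: measurable_edge|exact: IH].
Qed.

End Model.

(** * Cutoffs and the size of the error terms *)

Section ErrorTerms.
Context {R : realType}.
Variables a b nu : R.
Hypotheses (a0 : 0 < a) (ab : a < b) (nu1 : 1 < nu).
Let b0 : 0 < b. Proof. exact: lt_trans ab. Qed.
Let nu0 : 0 < nu. Proof. exact: lt_trans nu1. Qed.

Definition rho : R := (a / b) `^ nu^-1.
Lemma rho_gt0 : 0 < rho. Proof. by rewrite powR_gt0// divr_gt0. Qed.

(** Beyond these cutoffs there is no admissible path from [t]. *)
Definition centre_bound (t : nat) : nat := (Num.truncn (b * t%:R `^ nu)).+1.
Definition leaf_bound (t : nat) : nat := (Num.truncn (rho^-1 * t%:R)).+1.

Lemma centre_bound_gt t : b * t%:R `^ nu < (centre_bound t)%:R.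
Proof. exact: truncnS_gt. Qed.

Lemma leaf_bound_gt t : rho^-1 * t%:R < (leaf_bound t)%:R.
Proof. exact: truncnS_gt. Qed.

(* an upper bound of [1 / sqrt (i * u)] over all the paths [t - i - u] *)
Definition edge_bound (t : nat) : R := (Num.sqrt (a * t%:R `^ nu * (rho * t%:R)))^-1.

Lemma edge_bound_ge0 t : 0 <= edge_bound t.
Proof. by rewrite invr_ge0 sqrtr_ge0. Qed.

Lemma edge_bound_le t i u : (0 < t)%N -> in_range a b nu t i -> in_range a b nu u i ->
  (Num.sqrt (i%:R * u%:R))^-1 <= edge_bound t.
Proof.
move=> t0 ti ui; have t0' : 0 < t%:R :> R by rewrite ltr0n.
have r0 := rho_gt0.
have /andP[h1 _] := in_range_both a0 ab nu1 ti ui.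
have /andP[h2 _] := ti.
have p1 : 0 < a * t%:R `^ nu by rewrite mulr_gt0// powR_gt0.
have p2 : 0 < rho * t%:R by rewrite mulr_gt0.
have i0 := lt_le_trans p1 h2; have u0 := lt_le_trans p2 h1.
rewrite lef_pV2 ?posrE ?sqrtr_gt0 ?(mulr_gt0 p1 p2) ?(mulr_gt0 i0 u0)//.
by apply: ler_wsqrtr; apply: ler_pM => //; exact: ltW.
Qed.

(* All error terms turn out to be at most a constant times this. *)
Definition error_term (t : nat) : R :=
  (centre_bound t)%:R * (leaf_bound t)%:R ^+ 2 * edge_bound t ^+ 3
  + (centre_bound t)%:R * (leaf_bound t)%:R ^+ 2 * edge_bound t ^+ 4
  + (centre_bound t)%:R ^+ 2 * (leaf_bound t)%:R * edge_bound t ^+ 4.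

Let K : R := (Num.sqrt (a * rho))^-1.

Let edge_boundE t : edge_bound t = K * t%:R `^ (- ((nu + 1) / 2)).
Proof.
have r0 := rho_gt0.
rewrite /edge_bound /K (_ : _ * _ * _ = (a * rho) * (t%:R `^ nu * t%:R)); last by ring.
rewrite sqrtrM ?mulr_ge0 ?(ltW a0) ?(ltW r0)// invfM; congr (_ * _).
rewrite -[X in _ * X](powRr1 (ler0n R t)) -powRD; last first.
  by apply/implyP => /eqP h; exfalso; move: h nu0; lra.
by rewrite -powR12_sqrt ?powR_ge0// -powRrM powRN.
Qed.

Lemma edge_bound_cvg0 : edge_bound t @[t --> \oo] --> 0.
Proof.
rewrite (funext edge_boundE) -[X in _ --> X](mulr0 K).
apply: cvgM (cvg_cst K) (cvg_powRN _).
by rewrite divr_gt0// addr_gt0.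
Qed.

(** There are about t^nu centres and t leaves, and edge probabilities are of order t^(-(nu + 1) /
    2). The three terms are thus of orders t^(-(nu - 1) / 2), t^(-nu) and t^(-1); the first one
    vanishes because nu > 1. *)
Lemma error_term_cvg0 : error_term t @[t --> \oo] --> 0.
Proof.
have r0 := rho_gt0.
(* The added 1 absorbs the rounding in the cutoffs, as t^nu and t are at least 1. *)
set C1 := b + 1; set C2 := rho^-1 + 1.
have C10 : 0 <= C1 by rewrite addr_ge0// ltW.
have C20 : 0 <= C2 by rewrite addr_ge0// invr_ge0 ltW.
have K0 : 0 <= K by rewrite invr_ge0 sqrtr_ge0.
pose F (t : nat) : R := C1 * C2 ^+ 2 * K ^+ 3 * t%:R `^ (- ((nu - 1) / 2))
  + C1 * C2 ^+ 2 * K ^+ 4 * t%:R `^ (- nu)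
  + C1 ^+ 2 * C2 * K ^+ 4 * t%:R `^ (- 1).
have F0 : F t @[t --> \oo] --> 0.
  have z (c e : R) : 0 < e -> c * t%:R `^ (- e) @[t --> \oo] --> 0.
    move=> e0; rewrite -[X in _ --> X](mulr0 c).
    exact: cvgM (cvg_cst c) (cvg_powRN e0).
  rewrite -[X in _ --> X](addr0 0) -[X in _ --> X + _](addr0 0).
  apply: cvgD; last exact: z.
  by apply: cvgD; apply: z => //; rewrite divr_gt0// subr_gt0.
apply: (@squeeze_cvgr _ _ _ _ (cst 0) F) => //; last exact: cvg_cst.
near=> t; have t0 : (0 < t)%N by near: t; exact: nbhs_infty_gt.
have t0' : 0 < t%:R :> R by rewrite ltr0n.
have t1 : 1 <= t%:R :> R by rewrite ler1n.
have Nb : (centre_bound t)%:R <= C1 * t%:R `^ nu.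
  rewrite -natr1 mulrDl mul1r lerD//.
    by rewrite truncn_le mulr_ge0 ?powR_ge0 ?(ltW b0).
  have : 1 `^ nu <= (t%:R : R) `^ nu by rewrite ge0_ler_powR ?nnegrE// ltW.
  by rewrite powR1.
have Ub : (leaf_bound t)%:R <= C2 * t%:R.
  rewrite -natr1 mulrDl mul1r lerD//.
  by rewrite truncn_le mulr_ge0 ?invr_ge0 ?(ltW r0).
have e0 := edge_bound_ge0 t.
apply/andP; split.
  by rewrite /error_term !addr_ge0// !mulr_ge0 ?exprn_ge0.
have pE (e : R) n : (t%:R `^ e) ^+ n = t%:R `^ (e * n%:R) :> R.
  by rewrite -powR_mulrn ?powR_ge0// -powRrM.
have pD (x y : R) : t%:R `^ x * t%:R `^ y = t%:R `^ (x + y) :> R.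
  by rewrite -powRD//; rewrite (gt_eqF t0') implybT.
have tE : t%:R = t%:R `^ 1 :> R by rewrite powRr1.
have bnd (m n k : nat) (c : R) :
    nu * m%:R + n%:R + (- ((nu + 1) / 2)) * k%:R = c ->
    (centre_bound t)%:R ^+ m * (leaf_bound t)%:R ^+ n * edge_bound t ^+ k <=
    C1 ^+ m * C2 ^+ n * K ^+ k * t%:R `^ c.
  move=> <-.
  rewrite (_ : C1 ^+ m * C2 ^+ n * K ^+ k * t%:R `^ _ =
     (C1 * t%:R `^ nu) ^+ m * (C2 * t%:R) ^+ n * edge_bound t ^+ k).
    apply: ler_pM => //; rewrite ?mulr_ge0 ?exprn_ge0//.
    apply: ler_pM => //; rewrite ?exprn_ge0//.
      by rewrite lerXn2r// nnegrE ?mulr_ge0 ?powR_ge0.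
    by rewrite lerXn2r// nnegrE ?mulr_ge0.
  rewrite edge_boundE !exprMn [X in _ * (_ * X) * _](_ : _ = t%:R `^ n%:R); last first.
    by rewrite {1}tE pE mul1r.
  by rewrite !pE -!pD; ring.
have h1 := @bnd 1%N 2%N 3%N (- ((nu - 1) / 2)) ltac:(by field).
have h2 := @bnd 1%N 2%N 4%N (- nu) ltac:(by field).
have h3 := @bnd 2%N 1%N 4%N (- 1) ltac:(by field).
rewrite !expr1 in h1 h2 h3.
exact: lerD (lerD h1 h2) h3.
Unshelve. all: by end_near. Qed.

End ErrorTerms.

(** * Light vertices *)

(* Vanishing on negative numbers as well makes [trunc M] nonnegative everywhere. *)
Definition trunc {R : realType} (M x : R) : R := if 0 <= x <= M then x else 0.

Section Trunc.
Context {R : realType}.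
Implicit Types (M x : R).

Lemma trunc_ge0 M x : 0 <= trunc M x.
Proof. by rewrite /trunc; case: ifP => // /andP[]. Qed.

Lemma trunc_le M x : 0 <= M -> trunc M x <= M.
Proof. by move=> M0; rewrite /trunc; case: ifP => // /andP[]. Qed.

Lemma measurable_trunc M : measurable_fun setT (trunc M).
Proof.
apply: measurable_fun_ifT => //; first apply: measurable_and; exact: measurable_fun_ler.
Qed.

Lemma truncE M x : 0 <= x -> trunc M x = (x <= M)%R%:R * x.
Proof. by rewrite /trunc => ->/=; case: ifP; rewrite ?mul1r ?mul0r. Qed.

End Trunc.

Lemma path_weightE {R : realType} (i t u : nat) : (0 < i)%N ->
  i%:R^-1 * t%:R `^ (- 2^-1) * u%:R `^ (- 2^-1) =
  (Num.sqrt (i%:R * t%:R))^-1 * (Num.sqrt (i%:R * u%:R))^-1 :> R.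
Proof.
have sqrt_inv (x y : R) : 0 <= x -> 0 <= y ->
    (Num.sqrt (x * y))^-1 = x `^ (- 2^-1) * y `^ (- 2^-1).
  by move=> x0 y0; rewrite sqrtrM// invfM -!powR12_sqrt// !powRN.
move=> i0; rewrite !sqrt_inv//.
rewrite [RHS](_ : _ = (i%:R `^ (- 2^-1) * i%:R `^ (- 2^-1)) * t%:R `^ (- 2^-1) * u%:R `^ (- 2^-1)); last by ring.
congr (_ * _ * _); rewrite -powRD; last first.
  by rewrite pnatr_eq0 -lt0n i0 implybT.
rewrite (_ : - 2^-1 + - 2^-1 = - 1 :> R); last by lra.
by rewrite powR_inv1.
Qed.

Section TruncatedModel.
Context (R : realType) (d : measure_display) (T : measurableType d).
Variables (P : probability T R) (a b nu : R) (X Y : nat -> {RV P >-> R}).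
Variable H : T -> nat -> nat -> bool.
Hypotheses (a0 : 0 < a) (ab : a < b) (nu1 : 1 < nu).
Hypothesis model : random_intersection_model a b (fun t => t%:R `^ nu) X Y H.
Variable M : R.
Hypothesis M0 : 0 < M.

Let D := [set i : nat | (0 < i)%N].
Let epm := ep a b nu X Y.

Definition light (k : nat * nat) (w : T) : bool :=
  (X k.1 w <= M) && (Y k.2 w <= M).

Definition light_edge (k : nat * nat) (w : T) : bool :=
  positive k && (light k w && H w k.1 k.2).

Definition light_prob (k : nat * nat) (w : T) : R :=
  (positive k)%:R * ((light k w)%:R * epm k w).

Let measurable_light k : measurable_fun setT (light k).
Proof.
by apply: measurable_and; apply: measurable_fun_ler => //; exact: measurable_funPT.
Qed.

Lemma measurable_light_edge k : measurable_fun setT (light_edge k).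
Proof.
rewrite /light_edge; case: (boolP (positive k)) => pk /=; last exact: measurable_cst.
by apply: measurable_and; [exact: measurable_light|exact: (measurable_edge model)].
Qed.

Lemma measurable_light_prob k : measurable_fun setT (light_prob k).
Proof.
rewrite /light_prob; case: (boolP (positive k)) => pk /=; last first.
  by under eq_fun do rewrite mul0r; exact: measurable_cst.
apply: measurable_funM => //; apply: measurable_funM.
  by apply: measurable_natr; exact: measurable_light.
exact: (measurable_ep model).
Qed.

Lemma light_prob01 k w : 0 <= light_prob k w <= 1.
Proof.
rewrite /light_prob; case: (boolP (positive k)) => pk; last by rewrite mul0r lexx ler01.
have /andP[h0 h1] := ep01 model w pk.
by case: (light k w); rewrite ?mul1r ?mul0r ?mulr0 ?lexx ?ler01// h0.
Qed.

(** Deleting heavy edges preserves conditional independence: lightness is determined by X and Y, so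
    the product of its indicators is one event to which [cond_Er] applies. *)
Lemma light_Er_prod s : uniq s ->
  Er P (fun w => \prod_(k <- s) (light_edge k w)%:R) =
  Er P (fun w => \prod_(k <- s) light_prob k w).
Proof.
(* If some index is 0, both products vanish. *)
move=> us; case: (boolP (all positive s)) => [ps|/allPn[k ks pk]]; last first.
  congr (Er P _); apply/funext => w.
  rewrite !(big_rem k ks) /= /light_edge /light_prob (negbTE pk) /=.
  by rewrite !mul0r.
have mc : measurable_fun (setT : set (g_sigma_algebraType
      (sigma_gen D (fun i => X i : T -> R) `|` sigma_gen D (fun i => Y i : T -> R))))
    (fun w => all (fun k => light k w) s).
  elim: s ps {us} => [|k s IH] /=; first by move=> _; exact: measurable_cst.
  move=> /andP[/andP[k1 k2] ps]; apply: measurable_and; last exact: IH.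
  apply: measurable_and; apply: measurable_fun_ler => //.
    apply: (@measurable_sigma_gen _ _ _ P X _ k.1 id) => //.
    by move=> B hB; apply: sub_sigma_algebra; left.
  apply: (@measurable_sigma_gen _ _ _ P Y _ k.2 id) => //.
  by move=> B hB; apply: sub_sigma_algebra; right.
have e (F : nat * nat -> T -> R) w :
    \prod_(k <- s) ((positive k)%:R * ((light k w)%:R * F k w)) =
    (all (fun k => light k w) s)%:R * \prod_(k <- s) F k w.
  elim: s ps {us mc} => [|k s IH] /=; first by rewrite !big_nil mulr1.
  move=> /andP[pk ps]; rewrite !big_cons IH// pk mul1r -mulnb natrM; ring.
have := cond_Er model us ps mc.
congr (_ = _); congr (Er P _); apply/funext => w; last by rewrite -(e epm).
rewrite -(e (fun k w => (H w k.1 k.2)%:R)); apply: eq_bigr => k _; rewrite /light_edge.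
by rewrite -!mulnb !natrM.
Qed.

Let xi i w : R := trunc M (X i w) ^+ 2.
Let ups u w : R := trunc M (Y u w).

Let edge_b := edge_bound a b nu.

Lemma light_prob_range k w : light_prob k w != 0 ->
  [/\ positive k, in_range a b nu k.2 k.1 & light k w].
Proof.
rewrite /light_prob; case: (positive k); last by rewrite mul0r eqxx.
case: (light k w); last by rewrite mul0r mulr0 eqxx.
rewrite !mul1r /epm /ep /edge_prob => h; split => //.
by apply: contraNT h => h; rewrite /in_range in h; rewrite (negbTE h) mulr0.
Qed.

Lemma light_prob_eps t i w : (0 < t)%N -> light_prob (i, t) w != 0 ->
  forall u, light_prob (i, u) w <= M ^+ 2 * edge_b t.
Proof.
move=> t0 /light_prob_range[_ ti _] u.
have e0 : 0 <= M ^+ 2 * edge_b t by rewrite mulr_ge0 ?sqr_ge0 ?edge_bound_ge0.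
have [->//|h] := eqVneq (light_prob (i, u) w) 0.
have [pk ui /andP[Xi Yu]] := light_prob_range h.
rewrite /light_prob pk mul1r /light Xi Yu mul1r /epm /ep /edge_prob /=.
have ui' := ui; rewrite /in_range /= in ui'; rewrite ui' mulr1.
rewrite ge_min; apply/orP; right.
have /andP[i0 u0] := pk.
have x0 := X_ge0 model w i0; have y0 := Y_ge0 model w u0.
apply: ler_pM; rewrite ?mulr_ge0 ?invr_ge0 ?sqrtr_ge0//.
  by rewrite expr2; apply: ler_pM.
exact: (edge_bound_le a0 ab nu1).
Qed.

Let wt t i u : R := i%:R^-1 * t%:R `^ (- 2^-1) * u%:R `^ (- 2^-1).

(** The bound on [M ^+ 2 * edge_b t] makes the minimum in [edge_prob] inactive on light edges,
    whence an exact formula. *)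
Lemma light_path_prob t i u w : (0 < t)%N -> M ^+ 2 * edge_b t <= 1 ->
  in_range a b nu t i -> in_range a b nu u i ->
  light_prob (i, t) w * light_prob (i, u) w =
  wt t i u * (ups t w * (xi i w * ups u w)).
Proof.
move=> t0 e1 ti ui.
have i0 := in_range_gt0 a0 t0 ti.
have u0 : (0 < u)%N.
  rewrite -(ltr_nat R); have /andP[+ _] := in_range_both a0 ab nu1 ti ui.
  by apply: lt_le_trans; rewrite mulr_gt0 ?ltr0n// rho_gt0.
have x0 := X_ge0 model w i0; have y0 := Y_ge0 model w u0.
have z0 := Y_ge0 model w t0.
have main v : (0 < v)%N -> in_range a b nu v i ->
    light_prob (i, v) w = trunc M (X i w) * ups v w / Num.sqrt (i%:R * v%:R).
  move=> v0 vi; have yv := Y_ge0 model w v0.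
  rewrite /ups !truncE// /light_prob /positive i0 v0 mul1r /light /=.
  rewrite /epm /ep /edge_prob /=; have vi' := vi; rewrite /in_range in vi'; rewrite vi' mulr1.
  case: (leP (X i w) M) => Xi; last by rewrite !mul0r.
  case: (leP (Y v w) M) => Yv; last by rewrite /= !mul0r mulr0 mul0r.
  rewrite !mul1r min_r//; apply: le_trans e1.
  apply: ler_pM; rewrite ?mulr_ge0 ?invr_ge0 ?sqrtr_ge0//.
    by rewrite expr2; apply: ler_pM.
  exact: (edge_bound_le a0 ab nu1).
rewrite !main// /wt path_weightE// /xi; ring.
Qed.

Lemma wt_bound t i u : (0 < t)%N -> in_range a b nu t i -> in_range a b nu u i ->
  0 <= wt t i u <= edge_b t ^+ 2.
Proof.
move=> t0 ti ui; apply/andP; split.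
  by rewrite !mulr_ge0 ?invr_ge0 ?powR_ge0.
rewrite /wt path_weightE; last exact: in_range_gt0 ti.
by rewrite expr2; apply: ler_pM; rewrite ?invr_ge0 ?sqrtr_ge0//; exact: (edge_bound_le a0 ab nu1).
Qed.

End TruncatedModel.

(* [rl p q] marks the pairs for which [z p] and [z q] may be correlated. *)
Lemma weighted_variance (d : measure_display) (T : measurableType d) (R : realType)
    (P : probability T R) (J : finType) (Q : pred J) (c : J -> R)
    (z : J -> T -> R) (m B : R) (rl : rel J) :
  (forall p, Q p -> 0 <= c p) -> 0 <= B ->
  (forall p, Q p -> itg P (z p)) ->
  (forall p q, Q p -> Q q -> itg P (fun w => z p w * z q w)) ->
  (forall p, Q p -> Er P (z p) = m) ->
  (forall p q, Q p -> Q q -> ~~ rl p q -> Er P (fun w => z p w * z q w) = m ^+ 2) ->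
  (forall p q, Q p -> Q q -> Er P (fun w => z p w * z q w) <= B) ->
  itg P (fun w => (\sum_(p | Q p) c p * z p w - m * \sum_(p | Q p) c p) ^+ 2) /\
  Er P (fun w => (\sum_(p | Q p) c p * z p w - m * \sum_(p | Q p) c p) ^+ 2)
   <= B * \sum_(p | Q p) \sum_(q | Q q) c p * c q * (rl p q)%:R.
Proof.
move=> c0 B0 iz izz Ez Ezz Eb.
have -> : (fun w => (\sum_(p | Q p) c p * z p w - m * \sum_(p | Q p) c p) ^+ 2) =
  (fun w => \sum_(p | Q p) \sum_(q | Q q)
     c p * c q * ((z p w * z q w - m * z p w) - (m * z q w - m ^+ 2))).
  apply/funext => w; rewrite mulr_sumr -sumrB expr2 mulr_suml.
  apply: eq_bigr => p _; rewrite mulr_sumr; apply: eq_bigr => q _; ring.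
have i1 p q : Q p -> Q q ->
    itg P (fun w => (z p w * z q w - m * z p w) - (m * z q w - m ^+ 2)).
  move=> Qp Qq; apply: itgB; first by apply: itgB; [exact: izz|exact: itgZ (iz _ Qp)].
  by apply: itgB; [exact: itgZ (iz _ Qq)|exact: itg_cst].
have i2 p : Q p -> itg P (fun w => \sum_(q | Q q)
     c p * c q * ((z p w * z q w - m * z p w) - (m * z q w - m ^+ 2))).
  by move=> Qp; apply: itg_sum => q Qq; apply: itgZ; exact: i1.
split; first by apply: itg_sum.
rewrite Er_sum// mulr_sumr; apply: ler_sum => p Qp.
rewrite Er_sum; last by move=> q Qq; apply: itgZ; exact: i1.
rewrite mulr_sumr; apply: ler_sum => q Qq.
rewrite ErZ; last exact: i1.
rewrite mulrCA ler_wpM2l ?mulr_ge0 ?c0//.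
rewrite ErB; last 2 first.
- by apply: itgB; [exact: izz|exact: itgZ (iz _ Qp)].
- by apply: itgB; [exact: itgZ (iz _ Qq)|exact: itg_cst].
rewrite !ErB ?ErZ ?Er_cst ?Ez//; last first.
- exact: itgZ (iz _ Qp).
- exact: izz.
- exact: itg_cst.
- exact: itgZ (iz _ Qq).
- exact: iz.
- exact: iz.
- exact: itg_cst.
rewrite -!expr2 subrr subr0.
(* What is left is a covariance: zero for unrelated pairs, at most the mixed moment otherwise. *)
case: (boolP (rl p q)) => r; last by rewrite Ezz// subrr mulr0.
by rewrite mulr1 (le_trans _ (Eb _ _ Qp Qq))// gerBl sqr_ge0.
Qed.

(** * Concentration of the weighted number of light paths *)

Section TruncatedLimit.
Context (R : realType) (d : measure_display) (T : measurableType d).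
Variables (P : probability T R) (a b nu : R) (X Y : nat -> {RV P >-> R}).
Variable H : T -> nat -> nat -> bool.
Hypotheses (a0 : 0 < a) (ab : a < b) (nu1 : 1 < nu).
Hypothesis model : random_intersection_model a b (fun t => t%:R `^ nu) X Y H.
Variable M : R.
Hypothesis M0 : 0 < M.

Let D := [set i : nat | (0 < i)%N].
Let xi i w : R := trunc M (X i w) ^+ 2.
Let ups u w : R := trunc M (Y u w).
Let f2 (x : R) : R := trunc M x ^+ 2.
Let f20 x : 0 <= f2 x. Proof. exact: sqr_ge0. Qed.
Let mf2 : measurable_fun setT f2.
Proof. by apply: measurable_funX; exact: measurable_trunc. Qed.
Let mtr := @measurable_trunc R M.
Let tr0 := @trunc_ge0 R M.

Let xi_bnd i w : 0 <= xi i w <= M ^+ 2.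
Proof.
by rewrite /xi sqr_ge0 lerXn2r// ?nnegrE ?trunc_ge0 ?trunc_le ?(ltW M0).
Qed.

Let ups_bnd u w : 0 <= ups u w <= M.
Proof. by rewrite /ups trunc_ge0 trunc_le// ltW. Qed.

Let mxi i : measurable_fun setT (xi i).
Proof. exact: (measurableT_comp mf2). Qed.

Let mups u : measurable_fun setT (ups u).
Proof. exact: (measurableT_comp mtr). Qed.

Definition mean_sq := Er P (xi 1%N).
Definition mean_leaf := Er P (ups 1%N).

Let itg_xi i : itg P (xi i).
Proof.
apply: (@itg_bounded _ _ _ _ _ (M ^+ 2)) => // w.
by have /andP[h0 h1] := xi_bnd i w; rewrite ger0_norm.
Qed.

Let itg_ups i : itg P (ups i).
Proof.
apply: (@itg_bounded _ _ _ _ _ M) => // w.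
by have /andP[h0 h1] := ups_bnd i w; rewrite ger0_norm.
Qed.

Let z (p : nat * nat) w := xi p.1 w * ups p.2 w.

Let z_bnd p w : 0 <= z p w <= M ^+ 3.
Proof.
have /andP[h0 h1] := xi_bnd p.1 w; have /andP[h2 h3] := ups_bnd p.2 w.
by rewrite mulr_ge0//= exprSr; exact: ler_pM.
Qed.

Let mz p : measurable_fun setT (z p).
Proof. exact: measurable_funM. Qed.

Let itg_z p : itg P (z p).
Proof.
apply: (@itg_bounded _ _ _ _ _ (M ^+ 3)) => // w.
by have /andP[h0 h1] := z_bnd p w; rewrite ger0_norm.
Qed.

Let zz_bnd p q w : `|z p w * z q w| <= M ^+ 6.
Proof.
have /andP[h0 h1] := z_bnd p w; have /andP[h2 h3] := z_bnd q w.
have -> : M ^+ 6 = M ^+ 3 * M ^+ 3 by rewrite -exprD.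
rewrite (ger0_norm (mulr_ge0 h0 h2)); exact: ler_pM.
Qed.

Let itg_zz p q : itg P (fun w => z p w * z q w).
Proof.
apply: (@itg_bounded _ _ _ _ _ (M ^+ 6)) => //; exact: measurable_funM.
Qed.

Let Er_z p : D p.1 -> D p.2 -> Er P (z p) = mean_sq * mean_leaf.
Proof.
move=> D1 D2.
have m1 : measurable_fun setT (cst 1 : R -> R) by exact: measurable_cst.
have [||_] := pairs_ErM model D1 D1 D2 D2 mf2 m1 mtr m1 f20 (fun=> ler01) tr0 (fun=> ler01).
- by under eq_fun do rewrite mulr1; exact: itg_xi.
- by under eq_fun do rewrite mulr1; exact: itg_ups.
under eq_fun do rewrite !mulr1.
under [X in _ = Er P X * _ -> _]eq_fun do rewrite mulr1.
under [X in _ = _ * Er P X -> _]eq_fun do rewrite mulr1.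
move=> ->; rewrite (iid_Er (X_iid model) D1 mf2 f20).
by rewrite (iid_Er (Y_iid model) D2 mtr tr0).
Qed.

Let Er_zz p q : D p.1 -> D p.2 -> D q.1 -> D q.2 -> p.1 <> q.1 -> p.2 <> q.2 ->
  Er P (fun w => z p w * z q w) = (mean_sq * mean_leaf) ^+ 2.
Proof.
move=> D1 D2 D3 D4 n1 n2.
have [i1 e1] := iid_ErM (X_iid model) D1 D3 n1 mf2 mf2 f20 f20 (itg_xi 1) (itg_xi 1).
have [i2 e2] := iid_ErM (Y_iid model) D2 D4 n2 mtr mtr tr0 tr0 (itg_ups 1) (itg_ups 1).
have [_] := pairs_ErM model D1 D3 D2 D4 mf2 mf2 mtr mtr f20 f20 tr0 tr0 i1 i2.
rewrite e1 e2 exprMn !expr2 => <-.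
by congr (Er P _); apply/funext => w; rewrite /z /xi /ups /f2; ring.
Qed.

Let edge_b := edge_bound a b nu.
Let wt t i u : R := i%:R^-1 * t%:R `^ (- 2^-1) * u%:R `^ (- 2^-1).
Let N t := centre_bound b nu t.
Let U t := leaf_bound a b nu t.

(** The intensity of the light paths from [t] without its factor Y_t, which stays random in the
    limit. *)
Definition weighted_paths t w : R :=
  \sum_(i < N t | in_range a b nu t i)
    \sum_(u < U t | in_range a b nu u i && (u != t :> nat)) wt t i u * z ((i : nat), (u : nat)) w.

(** The double sum is flattened to a sum over pairs (centre, leaf), as [weighted_variance]
    expects. *)
Let Q t (p : 'I_(N t) * 'I_(U t)) := in_range a b nu t p.1 &&
  (in_range a b nu p.2 p.1 && (p.2 != t :> nat)).

Let QD t p : (0 < t)%N -> @Q t p -> [/\ D p.1, D p.2, in_range a b nu t p.1 & in_range a b nu p.2 p.1].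
Proof.
move=> t0 /andP[ti /andP[ui _]]; split => //; first exact: in_range_gt0 ti.
rewrite /D/= -(ltr_nat R); have /andP[+ _] := in_range_both a0 ab nu1 ti ui.
by apply: lt_le_trans; rewrite mulr_gt0 ?ltr0n// rho_gt0.
Qed.

(** Only pairs of paths sharing a centre or a leaf are correlated; each contributes at most
    [M ^+ 6 * edge_b t ^+ 4]. *)
Lemma weighted_paths_L2 t : (0 < t)%N ->
  itg P (fun w => (weighted_paths t w
     - mean_sq * mean_leaf * path_weight a b nu t (N t) (U t)) ^+ 2) /\
  Er P (fun w => (weighted_paths t w
     - mean_sq * mean_leaf * path_weight a b nu t (N t) (U t)) ^+ 2)
  <= M ^+ 6 * error_term a b nu t.
Proof.
move=> t0.
pose c (p : 'I_(N t) * 'I_(U t)) := wt t p.1 p.2.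
pose zp (p : 'I_(N t) * 'I_(U t)) := z ((p.1 : nat), (p.2 : nat)).
pose rl (p q : 'I_(N t) * 'I_(U t)) := (p.1 == q.1) || (p.2 == q.2).
have wb p : @Q t p -> 0 <= c p <= edge_b t ^+ 2.
  by move=> /(QD t0)[_ _ ti ui]; exact: wt_bound.
have vE w : weighted_paths t w = \sum_(p | @Q t p) c p * zp p w.
  rewrite /weighted_paths (pair_big_dep (fun i : 'I_(N t) => in_range a b nu t i)
    (fun (i : 'I_(N t)) (u : 'I_(U t)) => in_range a b nu u i && (u != t :> nat))
    (fun (i : 'I_(N t)) (u : 'I_(U t)) => wt t i u * z ((i : nat), (u : nat)) w))/=.
  by [].
have pE : path_weight a b nu t (N t) (U t) = \sum_(p | @Q t p) c p.
  rewrite /path_weight (pair_big_dep (fun i : 'I_(N t) => in_range a b nu t i)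
    (fun (i : 'I_(N t)) (u : 'I_(U t)) => in_range a b nu u i && (u != t :> nat))
    (fun (i : 'I_(N t)) (u : 'I_(U t)) => wt t i u))/=.
  by [].
rewrite pE; under eq_fun do rewrite vE.
have [|||||||h1 h2] := @weighted_variance _ _ _ P _ (@Q t) c zp (mean_sq * mean_leaf) (M ^+ 6) rl.
- by move=> p /wb/andP[].
- by rewrite exprn_ge0// ltW.
- by move=> p _; exact: itg_z.
- by move=> p q _ _; exact: itg_zz.
- by move=> p /(QD t0)[D1 D2 _ _]; exact: Er_z.
- move=> p q /(QD t0)[D1 D2 _ _] /(QD t0)[D3 D4 _ _]; rewrite negb_or => /andP[n1 n2].
  by apply: Er_zz => // e; [move/eqP: n1|move/eqP: n2]; apply; exact: val_inj.
- move=> p q _ _; rewrite -[X in _ <= X](@Er_cst _ _ _ P).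
  apply: Er_le (itg_zz _ _) (itg_cst _ _) _ => w.
  by apply: le_trans (zz_bnd _ _ w); exact: ler_norm.
split=> //; apply: le_trans h2 _.
rewrite ler_wpM2l ?exprn_ge0 ?(ltW M0)//.
have e0 := edge_bound_ge0 a b nu t.
apply: (@le_trans _ _ (\sum_(p : 'I_(N t) * 'I_(U t)) \sum_(q : 'I_(N t) * 'I_(U t))
    edge_b t ^+ 4 * ((p.1 == q.1)%:R + (p.2 == q.2)%:R))).
  rewrite big_mkcond; apply: ler_sum => p _; case: ifP => Qp; last first.
    by apply: sumr_ge0 => q _; rewrite mulr_ge0 ?exprn_ge0 ?addr_ge0.
  rewrite big_mkcond; apply: ler_sum => q _; case: ifP => Qq; last first.
    by rewrite mulr_ge0 ?exprn_ge0 ?addr_ge0.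
  have /andP[p0 p1] := wb _ Qp; have /andP[q0 q1] := wb _ Qq.
  apply: ler_pM => //; first exact: mulr_ge0.
    have -> : edge_b t ^+ 4 = edge_b t ^+ 2 * edge_b t ^+ 2 by rewrite -exprD.
    exact: ler_pM.
  by rewrite /rl; case: (p.1 == q.1); case: (p.2 == q.2) => /=; rewrite ?addr0 ?add0r ?lexx// lerDl.
(* For a given [p], U pairs share its centre and N share its leaf, so the inner sum is U + N. *)
under eq_bigr => p _.
  rewrite -mulr_sumr -(pair_bigA _ (fun i u => (p.1 == i)%:R + (p.2 == u)%:R))/=.
  under eq_bigr => i _.
    rewrite big_split /= sumr_const card_ord.
    rewrite (bigD1 p.2)//= eqxx big1 ?addr0; last by move=> u; rewrite eq_sym => /negbTE->.
    over.
  rewrite big_split /= sumr_const card_ord.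
  rewrite (bigD1 p.1)//= eqxx big1 ?addr0; last first.
    by move=> u; rewrite eq_sym => /negbTE->; rewrite mul0rn.
  over.
rewrite sumr_const card_prod !card_ord /error_term -/(N t) -/(U t) -/(edge_b t).
rewrite -[_ *+ (N t * U t)]mulr_natr natrM mulr1n.
rewrite (_ : _ * (_ * _) = (N t)%:R * (U t)%:R ^+ 2 * edge_b t ^+ 4
  + (N t)%:R ^+ 2 * (U t)%:R * edge_b t ^+ 4); last by ring.
by rewrite lerD2r lerDr !mulr_ge0 ?exprn_ge0.
Qed.

End TruncatedLimit.

(** * Poisson approximation of the light degree *)

Section TruncatedPoisson.
Context (R : realType) (d : measure_display) (T : measurableType d).
Variables (P : probability T R) (a b nu : R) (X Y : nat -> {RV P >-> R}).
Variable H : T -> nat -> nat -> bool.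
Hypotheses (a0 : 0 < a) (ab : a < b) (nu1 : 1 < nu).
Hypothesis model : random_intersection_model a b (fun t => t%:R `^ nu) X Y H.
Variable M : R.
Hypothesis M0 : 0 < M.

Let edge_b := edge_bound a b nu.
Let N t := centre_bound b nu t.
Let U t := leaf_bound a b nu t.
Let p := light_prob a b nu X Y M.

Definition light_degree t (w : T) : nat :=
  neighbour_count (light_edge X Y H M) t (N t) (U t) w.

Let VE t w := weighted_paths a b nu X Y M t w.
Let V0 t w : 0 <= VE t w.
Proof.
apply: sumr_ge0 => i _; apply: sumr_ge0 => u _.
by rewrite !mulr_ge0 ?invr_ge0 ?powR_ge0 ?exprn_ge0 ?trunc_ge0.
Qed.

Let path_intensityE t w : (0 < t)%N -> M ^+ 2 * edge_b t <= 1 ->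
  path_intensity p t (N t) (U t) w = trunc M (Y t w) * VE t w.
Proof.
move=> t0 e1; rewrite /path_intensity /VE /weighted_paths mulr_sumr [RHS]big_mkcond.
apply: eq_bigr => i _; case: ifPn => ti; last first.
  have [->|/light_prob_range[_ h _]] := eqVneq (p ((i : nat), t) w) 0; first by rewrite mul0r.
  by rewrite h in ti.
rewrite !mulr_sumr big_mkcond [RHS]big_mkcond; apply: eq_bigr => u _.
rewrite andbC; case: (u != t :> nat) => //=; case: ifPn => ui; last first.
  have [->|/light_prob_range[_ h _]] := eqVneq (p ((i : nat), (u : nat)) w) 0; first by rewrite mulr0.
  by rewrite h in ui.
rewrite [LHS](light_path_prob a0 ab nu1 model)//.
by rewrite mulrCA.
Qed.

Let measurable_V t : measurable_fun setT (VE t).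
Proof.
rewrite (_ : VE t = fun w => \sum_(i < N t) \sum_(u < U t)
  (if in_range a b nu t i && (in_range a b nu u i && (u != t :> nat)) then
     i%:R^-1 * t%:R `^ (- 2^-1) * u%:R `^ (- 2^-1) else 0) *
     (trunc M (X i w) ^+ 2 * trunc M (Y u w))).
  apply: measurable_sum => i; apply: measurable_sum => u.
  apply: measurable_funM => //; apply: measurable_funM.
    apply: measurable_funX; apply: measurableT_comp => //; exact: measurable_trunc.
  by apply: measurableT_comp => //; exact: measurable_trunc.
apply/funext => w; rewrite /VE /weighted_paths big_mkcond; apply: eq_bigr => i _.
case: ifP => ti /=; last by rewrite big1// => u _; rewrite mul0r.
by rewrite big_mkcond; apply: eq_bigr => u _; case: ifP => _; rewrite ?mul0r.
Qed.

(** The second group of errors comes from the Lipschitz dependence of the Poisson masses on the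
    intensity: [weighted_paths] deviates from its mean, with [del] the parameter of
    [Er_norm_le_sqr], and [path_weight] deviates from its future limit [gam]. *)
Lemma light_degree_pois t m (gam del : R) : (0 < t)%N -> M ^+ 2 * edge_b t <= 1 ->
  0 <= gam -> 0 < del ->
  `|Er P (fun w => (light_degree t w == m)%:R) -
    Er P (fun w => pois (gam * (mean_sq X M * mean_leaf Y M) * trunc M (Y t w)) m)|
  <= 2 * (M ^+ 6 + M ^+ 8) * error_term a b nu t +
     M * (del + M ^+ 6 * error_term a b nu t / del
          + mean_sq X M * mean_leaf Y M * `|path_weight a b nu t (N t) (U t) - gam|).
Proof.
move=> t0 e1 g0 d0.
have eps0 : 0 <= M ^+ 2 * edge_b t by rewrite mulr_ge0 ?sqr_ge0 ?edge_bound_ge0.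
have e0 := edge_bound_ge0 a b nu t.
have peps i w h := @light_prob_eps _ _ _ P a b nu X Y H a0 ab nu1 model M t i w t0 h.
have mA := measurable_light_edge model M.
have mp := measurable_light_prob model M.
have p01 := light_prob01 model M.
have Eprod := @light_Er_prod _ _ _ P a b nu X Y H model M.
have := neighbour_count_pois mA mp p01 Eprod (N t) (U t) eps0 peps m.
set lam := path_intensity _ _ _ _.
have lamE w : lam w = trunc M (Y t w) * VE t w by exact: path_intensityE.
set k := mean_sq X M * mean_leaf Y M.
have k0 : 0 <= k.
  by rewrite mulr_ge0// Er_ge0// => w; rewrite ?sqr_ge0 ?trunc_ge0.
set pw := path_weight a b nu t (N t) (U t).
set lam' := fun w => gam * k * trunc M (Y t w).
have mtr : measurable_fun setT (fun w => trunc M (Y t w)).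
  by apply: measurableT_comp => //; exact: measurable_trunc.
have mlam : measurable_fun setT lam.
  by rewrite (funext lamE); apply: measurable_funM => //; exact: measurable_V.
have mlam' : measurable_fun setT lam'.
  by apply: measurable_funM => //; exact: measurable_cst.
have lam0 w : 0 <= lam w by rewrite lamE mulr_ge0 ?trunc_ge0.
have lam'0 w : 0 <= lam' w by rewrite /lam' mulr_ge0 ?trunc_ge0 ?(mulr_ge0 g0 k0).
have ip1 := itg_pois P m mlam lam0.
have ip2 := itg_pois P m mlam' lam'0.
have [iV2 EV2] := weighted_paths_L2 a0 ab nu1 model M0 t0.
have mdev : measurable_fun setT (fun w => VE t w - k * pw).
  by apply: measurable_funB => //; exact: measurable_V.
have EV := Er_norm_le_sqr d0 mdev iV2.
have idev : itg P (fun w => `|VE t w - k * pw|).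
  apply: (@itg_le _ _ _ _ _ (fun w => 1 + (VE t w - k * pw) ^+ 2)).
  - exact: measurableT_comp.
  - move=> w; rewrite normr_id -[X in _ <= 1 + X]real_normK ?num_real//.
    have := normr_ge0 (VE t w - k * pw); move: `|_| => y y0; nra.
  - by apply: itgD => //; exact: itg_cst.
have second : `|Er P (fun w => pois (lam w) m) - Er P (fun w => pois (lam' w) m)| <=
   M * (del + M ^+ 6 * error_term a b nu t / del + k * `|pw - gam|).
  rewrite -ErB// (le_trans (Er_normr (itgB ip1 ip2)))//.
  have ib : itg P (fun w => M * (`|VE t w - k * pw| + k * `|pw - gam|)).
    by apply: itgZ; apply: itgD => //; exact: itg_cst.
  apply: le_trans (Er_le (itg_norm (itgB ip1 ip2)) ib _) _.
    move=> w; apply: le_trans (pois_lip m (lam0 w) (lam'0 w)) _.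
    rewrite lamE /lam' (_ : _ - _ = trunc M (Y t w) * ((VE t w - k * pw) + k * (pw - gam))); last ring.
    rewrite normrM (ger0_norm (trunc_ge0 _ _)).
    apply: ler_pM => //; rewrite ?trunc_ge0 ?trunc_le ?(ltW M0)//.
    by apply: le_trans (ler_normD _ _) _; rewrite normrM (ger0_norm k0).
  rewrite ErZ; last by apply: itgD => //; exact: itg_cst.
  rewrite ErD//; last exact: itg_cst.
  rewrite Er_cst ler_pM2l// lerD2r (le_trans EV)// lerD2l ler_pM2r ?invr_gt0//.
move=> first.
rewrite -[X in `|X|](subrKA (Er P (fun w => pois (lam w) m))) .
apply: le_trans (ler_normD _ _) _; apply: lerD; last exact: second.
apply: le_trans first _.
rewrite /error_term -/(N t) -/(U t) -/(edge_b t).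
set n := (N t)%:R; set u := (U t)%:R; set e := edge_b t in e0 *.
have T1 : 0 <= n * u ^+ 2 * e ^+ 3 by rewrite !mulr_ge0 ?exprn_ge0.
have T2 : 0 <= n * u ^+ 2 * e ^+ 4 by rewrite !mulr_ge0 ?exprn_ge0.
have T3 : 0 <= n ^+ 2 * u * e ^+ 4 by rewrite !mulr_ge0 ?exprn_ge0.
have M6 : 0 <= M ^+ 6 by rewrite exprn_ge0 ?ltW.
have M8 : 0 <= M ^+ 8 by rewrite exprn_ge0 ?ltW.
(* With edge probabilities at most [M ^+ 2 * e], the powers 3 and 4 of this bound produce [M ^+ 6]
   and [M ^+ 8]. *)
rewrite [X in X <= _](_ : _ = 2 * M ^+ 8 * (n * u ^+ 2 * e ^+ 4)
   + 2 * M ^+ 6 * (n * u ^+ 2 * e ^+ 3) + M ^+ 8 * (n ^+ 2 * u * e ^+ 4)); last by ring.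
move: (n * u ^+ 2 * e ^+ 3) (n * u ^+ 2 * e ^+ 4) (n ^+ 2 * u * e ^+ 4) (M ^+ 6) (M ^+ 8) T1 T2 T3 M6 M8.
by move=> x y z c c' *; nra.
Qed.

End TruncatedPoisson.

(** * Heavy vertices *)

Section HeavyVertices.
Context (R : realType) (d : measure_display) (T : measurableType d).
Variables (P : probability T R) (a b nu : R) (X Y : nat -> {RV P >-> R}).
Variable H : T -> nat -> nat -> bool.
Hypotheses (a0 : 0 < a) (ab : a < b) (nu1 : 1 < nu).
Hypothesis model : random_intersection_model a b (fun t => t%:R `^ nu) X Y H.
Hypothesis X2_itg : itg P (fun w => X 1%N w ^+ 2).
Hypothesis Y_itg : itg P (Y 1%N : T -> R).

Let D := [set i : nat | (0 < i)%N].
Let N t := centre_bound b nu t.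
Let U t := leaf_bound a b nu t.
Let a2 := Er P (fun w => X 1%N w ^+ 2).
Let b1 := Er P (Y 1%N).

(* The events [H w i j] need not be measurable if one of the indices is 0. *)
Definition full_edge (k : nat * nat) (w : T) : bool := positive k && H w k.1 k.2.

Definition degree t (w : T) : nat := neighbour_count full_edge t (N t) (U t) w.

Lemma measurable_full_edge k : measurable_fun setT (full_edge k).
Proof.
rewrite /full_edge; case: (boolP (positive k)) => pk /=; last exact: measurable_cst.
exact: (measurable_edge model).
Qed.

Lemma measurable_degree t m : measurable_fun setT (fun w => degree t w == m).
Proof. exact: (measurable_neighbour_count measurable_full_edge). Qed.

Variable M : R.
Hypothesis M1 : 1 <= M.
Let M0 : 0 < M. Proof. by apply: lt_le_trans M1. Qed.

Definition tail_sq := Er P (fun w => (M < X 1%N w)%R%:R * X 1%N w ^+ 2).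
Definition tail_leaf := Er P (fun w => (M < Y 1%N w)%R%:R * Y 1%N w).

Let sq (x : R) : R := x ^+ 2.
Let hsq (x : R) : R := (M < x)%R%:R * x ^+ 2.
(** The moment lemmas ask for test functions that are nonnegative on all of R; on the values of Y
    the absolute value changes nothing. *)
Let ab_ (x : R) : R := `|x|.
Let hab (x : R) : R := (M < x)%R%:R * `|x|.

Let msq : measurable_fun setT sq. Proof. exact: measurable_funX. Qed.
Let mab : measurable_fun setT ab_. Proof. exact: measurableT_comp. Qed.
Let mind : measurable_fun setT (fun x : R => (M < x)%R%:R : R).
Proof. by apply: measurable_natr; exact: measurable_fun_ltr. Qed.
Let mhsq : measurable_fun setT hsq. Proof. exact: measurable_funM. Qed.
Let mhab : measurable_fun setT hab. Proof. exact: measurable_funM. Qed.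
Let sq0 x : 0 <= sq x. Proof. exact: sqr_ge0. Qed.
Let ab0 x : 0 <= ab_ x. Proof. exact: normr_ge0. Qed.
Let hsq0 x : 0 <= hsq x. Proof. by rewrite mulr_ge0 ?sqr_ge0. Qed.
Let hab0 x : 0 <= hab x. Proof. by rewrite mulr_ge0. Qed.

Let D1 : D 1%N. Proof. by []. Qed.

Let isq : itg P (fun w => sq (X 1%N w)). Proof. exact: X2_itg. Qed.
Let iab : itg P (fun w => ab_ (Y 1%N w)). Proof. exact: itg_norm. Qed.
Let ihsq : itg P (fun w => hsq (X 1%N w)).
Proof.
apply: itg_le isq; first exact: measurableT_comp.
move=> w; rewrite ger0_norm// /hsq /sq; case: (_ < _); rewrite ?mul1r// mul0r.
exact: sqr_ge0.
Qed.
Let ihab : itg P (fun w => hab (Y 1%N w)).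
Proof.
apply: itg_le iab; first exact: measurableT_comp.
by move=> w; rewrite ger0_norm// /hab /ab_; case: (_ < _); rewrite ?mul1r// mul0r.
Qed.

Let absY i w : D i -> `|Y i w| = Y i w.
Proof. by move=> Di; rewrite ger0_norm// (Y_ge0 model). Qed.

Let EabE : Er P (fun w => ab_ (Y 1%N w)) = b1.
Proof. by congr (Er P _); apply/funext => w; exact: absY. Qed.
Let EhabE : Er P (fun w => hab (Y 1%N w)) = tail_leaf.
Proof. by congr (Er P _); apply/funext => w; rewrite /hab absY. Qed.

Lemma tail_sq_ge0 : 0 <= tail_sq. Proof. by apply: Er_ge0 => w; exact: hsq0. Qed.
(** The two edges of a path share their centre but have distinct ends, hence a second moment of X
    and only first moments of Y. *)
Let path_moment (f g : R -> R) i t u : D i -> D t -> D u -> t <> u ->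
  measurable_fun setT f -> measurable_fun setT g ->
  (forall x, 0 <= f x) -> (forall x, 0 <= g x) ->
  itg P (fun w => f (X 1%N w)) -> itg P (fun w => g (Y 1%N w)) ->
  itg P (fun w => f (X i w) * (ab_ (Y t w) * g (Y u w))) /\
  Er P (fun w => f (X i w) * (ab_ (Y t w) * g (Y u w))) =
    Er P (fun w => f (X 1%N w)) * (b1 * Er P (fun w => g (Y 1%N w))).
Proof.
move=> Di Dt Du tu mf mg f0 g0 hf hg.
have m1 : measurable_fun setT (cst 1 : R -> R) by exact: measurable_cst.
have [i2 e2] := iid_ErM (Y_iid model) Dt Du tu mab mg ab0 g0 iab hg.
have i1 : itg P (fun w => f (X i w) * cst 1 (X i w)).
  by under eq_fun do rewrite mulr1; exact: (iid_itg (X_iid model) Di mf f0 hf).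
have [] := pairs_ErM model Di Di Dt Du mf m1 mab mg f0 (fun=> ler01) ab0 g0 i1 i2.
have e : (fun w => f (X i w) * cst 1 (X i w)) = (fun w => f (X i w)).
  by apply/funext => w; rewrite mulr1.
have e' : (fun w => f (X i w) * cst 1 (X i w) * (ab_ (Y t w) * g (Y u w))) =
  (fun w => f (X i w) * (ab_ (Y t w) * g (Y u w))).
  by apply/funext => w; rewrite mulr1.
by rewrite e e' e2 EabE (iid_Er (X_iid model) Di mf f0).
Qed.

Let epm := ep a b nu X Y.
Let wt t i u : R := i%:R^-1 * t%:R `^ (- 2^-1) * u%:R `^ (- 2^-1).

Let ep_le k w : positive k ->
  epm k w <= X k.1 w * Y k.2 w / Num.sqrt (k.1%:R * k.2%:R).
Proof.
move=> /andP[k1 k2]; rewrite /epm /ep /edge_prob.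
have h : 0 <= X k.1 w * Y k.2 w / Num.sqrt (k.1%:R * k.2%:R).
  by rewrite divr_ge0 ?sqrtr_ge0// mulr_ge0 ?(X_ge0 model) ?(Y_ge0 model).
set c := (a * _ <= _ <= _).
apply: (@le_trans _ _ (Num.min 1 (X k.1 w * Y k.2 w / Num.sqrt (k.1%:R * k.2%:R)))).
  by rewrite ler_piMr ?le_min ?ler01// lern1; case: c.
by rewrite ge_min lexx orbT.
Qed.

Let ep_range k w : in_range a b nu k.2 k.1 = false -> epm k w = 0.
Proof.
by move=> h; rewrite /epm /ep /edge_prob -/(in_range a b nu k.2 k.1) h mulr0.
Qed.

Let two_full i t u w : R := (full_edge (i, t) w)%:R * (full_edge (i, u) w)%:R.

Let heavy_path (c : T -> bool) (g : T -> R) i t u : D t -> u != t ->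
  (positive (i, u) -> measurable_fun (setT : set (g_sigma_algebraType
     (sigma_gen D (fun i => X i : T -> R) `|` sigma_gen D (fun i => Y i : T -> R)))) c) ->
  measurable_fun setT c ->
  (positive (i, u) -> itg P g) ->
  (positive (i, u) -> forall w, (c w)%:R * (X i w ^+ 2 * (Y t w * Y u w)) = g w) ->
  itg P (fun w => (c w)%:R * two_full i t u w) /\
  Er P (fun w => (c w)%:R * two_full i t u w) <=
    if in_range a b nu t i && in_range a b nu u i then wt t i u * Er P g else 0.
Proof.
move=> Dt ut mc mc' ig gE.
have itwo : itg P (fun w => (c w)%:R * two_full i t u w).
  apply: (@itg_bounded _ _ _ _ _ 1).
    apply: measurable_funM; first exact: measurable_natr.
    by apply: measurable_funM; apply: measurable_natr; exact: measurable_full_edge.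
  move=> w; rewrite /two_full; case: (c w); case: (full_edge _ w); case: (full_edge _ w);
    by rewrite ?mul0r ?mulr0 ?mulr1 ?normr0 ?normr1.
split=> //.
case: (boolP (positive (i, u))) => pu; last first.
  have -> : (fun w => (c w)%:R * two_full i t u w) = (fun=> 0).
    by apply/funext => w; rewrite /two_full /full_edge (negbTE pu) /= !mulr0.
  rewrite Er_cst; case: ifP => // /andP[ti ui].
  (* Here [u = 0], and the range condition would force i <= b * 0^nu = 0. *)
  move: pu; rewrite /positive /= (in_range_gt0 a0 Dt ti) /= -leqNgt leqn0 => /eqP u0.
  move: ui; rewrite /in_range u0 powR0 ?gt_eqF ?(lt_trans _ nu1)// !mulr0 => /andP[_].
  by rewrite lern0 eqn0Ngt (in_range_gt0 a0 Dt ti).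
have pt : positive (i, t) by move: pu; rewrite /positive /= => /andP[-> _].
have us : uniq [:: (i, t); (i, u)].
  by rewrite /= inE xpair_eqE eqxx /= eq_sym ut.
have ps : all positive [:: (i, t); (i, u)] by rewrite /= pt pu.
have := cond_Er model us ps (mc pu).
have -> : (fun w => (c w)%:R * \prod_(k <- [:: (i, t); (i, u)]) (H w k.1 k.2)%:R) =
  (fun w => (c w)%:R * two_full i t u w) :> (T -> R).
  by apply/funext => w; rewrite !big_cons big_nil mulr1 /two_full /full_edge pt pu.
move=> ->.
have ipr : itg P (fun w => (c w)%:R * \prod_(k <- [:: (i, t); (i, u)]) ep a b nu X Y k w).
  apply: (@itg_bounded _ _ _ _ _ 1).
    apply: measurable_funM; first exact: measurable_natr.
    under eq_fun do rewrite !big_cons big_nil mulr1.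
    by apply: measurable_funM; exact: (measurable_ep model).
  move=> w; rewrite !big_cons big_nil mulr1.
  have /andP[h1 h2] := ep01 model w pt; have /andP[h3 h4] := ep01 model w pu.
  case: (c w); last by rewrite mul0r normr0.
  by rewrite mul1r (ger0_norm (mulr_ge0 h1 h3)) mulr_ile1.
case: (boolP (in_range a b nu t i && in_range a b nu u i)) => [/andP[ti ui]|]; last first.
  rewrite negb_and => h.
  rewrite (_ : (fun w => _) = fun=> 0) ?Er_cst//; apply/funext => w.
  rewrite !big_cons big_nil mulr1.
  have [/negbTE h1|/negbTE h1] := orP h.
    by rewrite (@ep_range (i, t) w h1 : ep a b nu X Y (i, t) w = 0) mul0r mulr0.
  by rewrite (@ep_range (i, u) w h1 : ep a b nu X Y (i, u) w = 0) !mulr0.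
rewrite -ErZ; last exact: ig.
apply: Er_le ipr (itgZ _ (ig pu)) _ => w.
rewrite !big_cons big_nil mulr1 -(gE pu w) [X in _ <= X]mulrCA.
apply: ler_wpM2l => //.
have /andP[h1 h2] := ep01 model w pt; have /andP[h3 h4] := ep01 model w pu.
apply: le_trans (ler_pM h1 h3 (@ep_le (i, t) w pt) (@ep_le (i, u) w pu)) _.
rewrite /= /wt path_weightE; last exact: in_range_gt0 ti.
by rewrite le_eqVlt; apply/orP; left; apply/eqP; ring.
Qed.

Let gen_measurable : (forall i, D i -> measurable_fun (setT : set (g_sigma_algebraType
     (sigma_gen D (fun i => X i : T -> R) `|` sigma_gen D (fun i => Y i : T -> R))))
     (fun w => M < X i w)) /\
  (forall i, D i -> measurable_fun (setT : set (g_sigma_algebraType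
     (sigma_gen D (fun i => X i : T -> R) `|` sigma_gen D (fun i => Y i : T -> R))))
     (fun w => M < Y i w)).
Proof.
split=> i Di; apply: measurable_fun_ltr => //.
  apply: (@measurable_sigma_gen _ _ _ P X _ i id) => //.
  by move=> B hB; apply: sub_sigma_algebra; left.
apply: (@measurable_sigma_gen _ _ _ P Y _ i id) => //.
by move=> B hB; apply: sub_sigma_algebra; right.
Qed.

Let heavy_centre i t u : D t -> u != t ->
  itg P (fun w => (M < X i w)%R%:R * two_full i t u w) /\
  Er P (fun w => (M < X i w)%R%:R * two_full i t u w) <=
    if in_range a b nu t i && in_range a b nu u i then
      wt t i u * (tail_sq * b1 ^+ 2) else 0.
Proof.
move=> Dt ut.
pose g w := hsq (X i w) * (ab_ (Y t w) * ab_ (Y u w)).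
have tu : t <> u by move=> e; rewrite e eqxx in ut.
have pm : positive (i, u) -> itg P g /\ Er P g = tail_sq * b1 ^+ 2.
  move=> /andP[i0 u0]; have [h1 h2] := path_moment i0 Dt u0 tu mhsq mab hsq0 ab0 ihsq iab.
  by split=> //; rewrite h2 EabE expr2.
have [||||h1 h2] := @heavy_path (fun w => M < X i w) g i t u Dt ut.
- by move=> /andP[i0 _]; have [h _] := gen_measurable; exact: h.
- exact: measurable_fun_ltr.
- by move=> /pm[].
- move=> /andP[i0 u0] w; rewrite /g /hsq /ab_ !absY//; ring.
split=> //; apply: le_trans h2 _; case: ifP => // /andP[ti ui].
have i0 := in_range_gt0 a0 Dt ti.
have u0 : (0 < u)%N.
  rewrite -(ltr_nat R); have /andP[+ _] := in_range_both a0 ab nu1 ti ui.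
  by apply: lt_le_trans; rewrite mulr_gt0 ?ltr0n// rho_gt0.
have [|_ ->//] := pm _.
by rewrite /positive i0 u0.
Qed.

Let heavy_leaf i t u : D t -> u != t ->
  itg P (fun w => (M < Y u w)%R%:R * two_full i t u w) /\
  Er P (fun w => (M < Y u w)%R%:R * two_full i t u w) <=
    if in_range a b nu t i && in_range a b nu u i then
      wt t i u * (a2 * b1 * tail_leaf) else 0.
Proof.
move=> Dt ut.
pose g w := sq (X i w) * (ab_ (Y t w) * hab (Y u w)).
have tu : t <> u by move=> e; rewrite e eqxx in ut.
have pm : positive (i, u) -> itg P g /\ Er P g = a2 * b1 * tail_leaf.
  move=> /andP[i0 u0]; have [h1 h2] := path_moment i0 Dt u0 tu msq mhab sq0 hab0 isq ihab.
  by split=> //; rewrite h2 EhabE mulrA.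
have [||||h1 h2] := @heavy_path (fun w => M < Y u w) g i t u Dt ut.
- by move=> /andP[_ u0]; have [_ h] := gen_measurable; exact: h.
- exact: measurable_fun_ltr.
- by move=> /pm[].
- move=> /andP[i0 u0] w; rewrite /g /sq /hab /ab_ !absY//; ring.
split=> //; apply: le_trans h2 _; case: ifP => // /andP[ti ui].
have i0 := in_range_gt0 a0 Dt ti.
have u0 : (0 < u)%N.
  rewrite -(ltr_nat R); have /andP[+ _] := in_range_both a0 ab nu1 ti ui.
  by apply: lt_le_trans; rewrite mulr_gt0 ?ltr0n// rho_gt0.
have [|_ ->//] := pm _.
by rewrite /positive i0 u0.
Qed.

Let heavy i t u w : R :=
  (M < X i w)%R%:R * two_full i t u w + (M < Y u w)%R%:R * two_full i t u w.

Let heavy_ge0 i t u w : 0 <= heavy i t u w.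
Proof. by rewrite addr_ge0 ?mulr_ge0. Qed.

(** If Y_t <= M and no path from [t] has a heavy centre or a heavy end, every path consists of light
    edges and the two degrees coincide. *)
Let degrees_differ t m w : D t ->
  `|(degree t w == m)%:R - (light_degree a b nu X Y H M t w == m)%:R| <=
  (M < Y t w)%R%:R + \sum_(i < N t) \sum_(u < U t | u != t :> nat) heavy i t u w.
Proof.
move=> Dt.
have s0 : 0 <= \sum_(i < N t) \sum_(u < U t | u != t :> nat) heavy i t u w.
  by apply: sumr_ge0 => i _; apply: sumr_ge0.
have [->|ne] := eqVneq (degree t w) (light_degree a b nu X Y H M t w).
  by rewrite subrr normr0 addr_ge0.
apply: (@le_trans _ _ 1).
  by do 2 case: (_ == m); rewrite ?subrr ?subr0 ?sub0r ?normrN ?normr1 ?normr0.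
case: (ltP M (Y t w)) => Yt; first by rewrite lerDl.
rewrite add0r.
have [[i [u [ut h]]]|nh] := pselect (exists i : 'I_(N t), exists u : 'I_(U t),
    u != t :> nat /\ 1 <= heavy i t u w).
  rewrite (bigD1 i)//= (bigD1 u)//=; apply: le_trans h _.
  rewrite -addrA lerDl addr_ge0//; first by apply: sumr_ge0.
  by apply: sumr_ge0 => j _; apply: sumr_ge0.
case/eqP: ne; apply: eq_bigr => u _; congr nat_of_bool; apply: eq_existsb => i.
case: (boolP (u != t :> nat)) => ut; last by rewrite !andbF.
rewrite !andbT.
rewrite /light_edge -/(full_edge _ _) /light /=.
have : ~~ (1 <= heavy i t u w) by apply/negP => h; apply: nh; exists i, u.
rewrite /heavy /two_full /full_edge Yt andbT /=.
case: (positive _) => //=; case: (positive _); rewrite ?andbF//=.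
case: (H w i t); rewrite /= ?andbF//; case: (H w i u); rewrite /= ?andbF//.
case: (leP (X i w) M) => /= Xi; last first.
  by rewrite !mulr1 lerDl => /negP[].
case: (leP (Y u w) M) => // Yu.
by rewrite !mulr1 lerDr => /negP[].
Qed.

Lemma degree_light t m : D t ->
  `|Er P (fun w => (degree t w == m)%:R)
    - Er P (fun w => (light_degree a b nu X Y H M t w == m)%:R)|
  <= tail_leaf + path_weight a b nu t (N t) (U t)
       * (tail_sq * b1 ^+ 2 + a2 * b1 * tail_leaf).
Proof.
move=> Dt.
have i1 := @itg_bool _ _ _ P _ (measurable_degree t m).
have i2 : itg P (fun w => (light_degree a b nu X Y H M t w == m)%:R).
  apply: itg_bool; apply: measurable_neighbour_count.
  exact: (measurable_light_edge model).
have i3 : itg P (fun w => (M < Y t w)%R%:R).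
  by apply: itg_bool; exact: measurable_fun_ltr.
have i4 i u : u != t -> itg P (heavy i t u).
  by move=> ut; apply: itgD; [have [] := heavy_centre i Dt ut|have [] := heavy_leaf i Dt ut].
have i5 i : itg P (fun w => \sum_(u < U t | u != t :> nat) heavy i t u w).
  by apply: itg_sum => u; exact: i4.
have i6 : itg P (fun w => \sum_(i < N t) \sum_(u < U t | u != t :> nat) heavy i t u w).
  by apply: itg_sum => i _.
rewrite -ErB// (le_trans (Er_normr (itgB i1 i2)))//.
apply: le_trans (Er_le (itg_norm (itgB i1 i2)) (itgD i3 i6) (fun w => degrees_differ m w Dt)) _.
rewrite ErD//; apply: lerD.
  have f0 (x : R) : 0 <= (M < x)%R%:R :> R by [].
  rewrite (iid_Er (Y_iid model) Dt mind f0) -EhabE; apply: Er_le => //.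
    by apply: itg_bool; exact: measurable_fun_ltr.
  (* As M >= 1, the indicator of {Y > M} is at most Y on that event. *)
  move=> w; rewrite /hab; case: (ltP M) => h; rewrite ?mul0r// mul1r.
  by rewrite (le_trans M1)// (le_trans (ltW h))// ler_norm.
rewrite Er_sum// /path_weight mulr_suml [X in _ <= X]big_mkcond; apply: ler_sum => i _.
rewrite Er_sum; last by move=> u; exact: i4.
case: ifP => ti; last first.
  rewrite big1// => u ut; apply/eqP; rewrite eq_le Er_ge0// andbT.
  rewrite ErD; [|by have [] := heavy_centre i Dt ut|by have [] := heavy_leaf i Dt ut].
  have [_] := heavy_centre i Dt ut; have [_] := heavy_leaf i Dt ut; rewrite ti /=.
  by move=> h1 h2; rewrite -(addr0 0) lerD.
rewrite mulr_suml big_mkcond [X in _ <= X]big_mkcond; apply: ler_sum => u _.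
rewrite andbC; case: (boolP (u != t :> nat)) => //= ut.
rewrite ErD; [|by have [] := heavy_centre i Dt ut|by have [] := heavy_leaf i Dt ut].
have [_] := heavy_centre i Dt ut; have [_] := heavy_leaf i Dt ut; rewrite ti /=.
case: ifP => ui h1 h2; last by rewrite -(addr0 0) lerD.
by rewrite mulrDr lerD.
Qed.

End HeavyVertices.

(** * The limit of the degree distribution *)

Section DegreeLimit.
Context (R : realType) (d : measure_display) (T : measurableType d).
Variables (P : probability T R) (a b nu : R) (X Y : nat -> {RV P >-> R}).
Variable H : T -> nat -> nat -> bool.
Hypotheses (a0 : 0 < a) (ab : a < b) (nu1 : 1 < nu).
Hypothesis model : random_intersection_model a b (fun t => t%:R `^ nu) X Y H.
Hypothesis X2_itg : itg P (fun w => X 1%N w ^+ 2).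
Hypothesis Y_itg : itg P (Y 1%N : T -> R).

Let D := [set i : nat | (0 < i)%N].
Let N t := centre_bound b nu t.
Let U t := leaf_bound a b nu t.
Let a2 := Er P (fun w => X 1%N w ^+ 2).
Let b1 := Er P (Y 1%N).
Let sigma : R := (2 * nu)^-1.

Definition gamma : R :=
  4 * nu * (b `^ sigma - a `^ sigma) * (a `^ (- sigma) - b `^ (- sigma)).

Lemma gamma_ge0 : 0 <= gamma.
Proof.
have b0 := lt_trans a0 ab; have nu0 : 0 < nu by apply: lt_trans nu1.
have s0 : 0 <= sigma by rewrite invr_ge0 mulr_ge0// ltW.
rewrite /gamma !mulr_ge0 ?(ltW nu0)// subr_ge0.
  by rewrite ge0_ler_powR ?nnegrE// ltW.
by apply: ler_powRN; rewrite ?oppr_le0// ltW.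
Qed.

Let X0 w : 0 <= X 1%N w. Proof. exact: (X_ge0 model). Qed.
Let Y0 w : 0 <= Y 1%N w. Proof. exact: (Y_ge0 model). Qed.

Let tails_cvg0 (K : R) :
  K * (tail_sq X n.+1%:R + tail_leaf Y n.+1%:R) @[n --> \oo] --> 0.
Proof.
have hX : tail_sq X n.+1%:R @[n --> \oo] --> 0.
  have := Er_tail X2_itg (fun w => sqr_ge0 (X 1%N w)).
  apply: (@squeeze_cvgr _ _ _ _ (cst 0)); last exact: cvg_cst.
  near=> n; rewrite tail_sq_ge0/=; apply: Er_le.
  - apply: itg_le X2_itg.
      apply: measurable_funM; last by apply: measurable_funX.
      by apply: measurable_natr; exact: measurable_fun_ltr.
    by move=> w; case: (_ < _); rewrite ?mul1r ?mul0r ?normr0 ?sqr_ge0// ger0_norm ?sqr_ge0.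
  - apply: itg_le X2_itg.
      apply: measurable_funM; last by apply: measurable_funX.
      by apply: measurable_natr; apply: measurable_fun_ltr => //; exact: measurable_funX.
    by move=> w; case: (_ < _); rewrite ?mul1r ?mul0r ?normr0 ?sqr_ge0// ger0_norm ?sqr_ge0.
  (* X_1 > n + 1 >= 1 implies X_1^2 > n, which brings in the tail of X_1^2 used in [Er_tail]. The
     successor also keeps the truncation level at least 1. *)
  - move=> w; case: (ltP n.+1%:R) => h; last by rewrite mul0r mulr_ge0 ?sqr_ge0.
    have -> : (n%:R < X 1%N w ^+ 2) = true; last by [].
    have : 1 <= n.+1%:R :> R by rewrite ler1n.
    have : n%:R < n.+1%:R :> R by rewrite ltr_nat.
    by move: h; nra.
have hY : tail_leaf Y n.+1%:R @[n --> \oo] --> 0.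
  rewrite (cvg_shiftS (fun n => tail_leaf Y n%:R)).
  exact: Er_tail Y_itg Y0.
rewrite -[X in _ --> X](mulr0 K) -[X in _ --> K * X](addr0 0).
by apply: cvgM (cvg_cst K) (cvgD hX hY).
Unshelve. all: by end_near. Qed.

Let mean_sqE M : mean_sq X M = a2 - tail_sq X M.
Proof.
rewrite /mean_sq /a2 /tail_sq -ErB//; last first.
  apply: itg_le X2_itg.
    apply: measurable_funM; last by apply: measurable_funX.
    by apply: measurable_natr; exact: measurable_fun_ltr.
  by move=> w; case: (_ < _); rewrite ?mul1r ?mul0r ?normr0 ?sqr_ge0// ger0_norm ?sqr_ge0.
congr (Er P _); apply/funext => w; rewrite truncE// ltNge.
by case: (_ <= _); rewrite /= ?mul1r ?mul0r ?subr0 ?subrr ?expr0n.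
Qed.

Let itg_tailY M : itg P (fun w => (M < Y 1%N w)%R%:R * Y 1%N w).
Proof.
apply: itg_le Y_itg.
  apply: measurable_funM => //.
  by apply: measurable_natr; exact: measurable_fun_ltr.
by move=> w; case: (_ < _); rewrite ?mul1r ?mul0r ?normr0// ger0_norm.
Qed.

Let truncY M w : trunc M (Y 1%N w) = Y 1%N w - (M < Y 1%N w)%R%:R * Y 1%N w.
Proof.
rewrite truncE// ltNge.
by case: (_ <= _); rewrite /= ?mul1r ?mul0r ?subr0 ?subrr.
Qed.

Let mean_leafE M : mean_leaf Y M = b1 - tail_leaf Y M.
Proof.
rewrite /mean_leaf /b1 /tail_leaf -ErB//.
by congr (Er P _); apply/funext => w; exact: truncY.
Qed.

Let a20 : 0 <= a2. Proof. by apply: Er_ge0 => w; exact: sqr_ge0. Qed.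
Let b10 : 0 <= b1. Proof. exact: Er_ge0. Qed.

Let mean_sq_ge0 M : 0 <= mean_sq X M. Proof. by apply: Er_ge0 => w; exact: sqr_ge0. Qed.
Let mean_leaf_ge0 M : 0 <= mean_leaf Y M.
Proof. by apply: Er_ge0 => w; exact: trunc_ge0. Qed.

Definition limit_pmf m := Er P (fun w => pois (gamma * a2 * b1 * Y 1%N w) m).

(** Y_t may be replaced by Y_1 in an expectation; then the masses are compared through their
    parameters, whose difference consists of the tails lost in the two means and in Y_1 itself. *)
Let trunc_limit t m M : D t ->
  `|Er P (fun w => pois (gamma * (mean_sq X M * mean_leaf Y M) * trunc M (Y t w)) m)
    - limit_pmf m|
  <= gamma * (a2 + b1) * b1 * (tail_sq X M + tail_leaf Y M)
     + gamma * a2 * b1 * (tail_sq X M + tail_leaf Y M).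
Proof.
move=> Dt; have g0 := gamma_ge0.
set c := gamma * (mean_sq X M * mean_leaf Y M).
have c0 : 0 <= c := mulr_ge0 g0 (mulr_ge0 (mean_sq_ge0 M) (mean_leaf_ge0 M)).
have gab0 : 0 <= gamma * a2 * b1 := mulr_ge0 (mulr_ge0 g0 a20) b10.
pose f (y : R) := pois (c * trunc M y) m.
have mf : measurable_fun setT f.
  apply: measurable_pois; apply: measurable_funM => //; exact: measurable_trunc.
have f0 y : 0 <= f y by rewrite pois_ge0// mulr_ge0 ?trunc_ge0.
rewrite -[X in X - _]/(Er P (fun w => f (Y t w))) (iid_Er (Y_iid model) Dt mf f0).
have l10 w : 0 <= c * trunc M (Y 1%N w) by rewrite mulr_ge0 ?trunc_ge0.
have l20 w : 0 <= gamma * a2 * b1 * Y 1%N w := mulr_ge0 gab0 (Y0 w).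
have i1 : itg P (fun w => f (Y 1%N w)).
  apply: itg_pois => //; apply: measurable_funM => //.
  by apply: measurableT_comp => //; exact: measurable_trunc.
have i2 : itg P (fun w => pois (gamma * a2 * b1 * Y 1%N w) m).
  by apply: itg_pois => //; apply: measurable_funM.
have tX := tail_sq_ge0 X M.
have tY : 0 <= tail_leaf Y M by apply: Er_ge0 => w; rewrite mulr_ge0.
have i3 : itg P (fun w => gamma * (a2 * b1 - mean_sq X M * mean_leaf Y M) * Y 1%N w
  + gamma * a2 * b1 * ((M < Y 1%N w)%R%:R * Y 1%N w)).
  by apply: itgD; apply: itgZ.
have ms := mean_sqE M; have ml := mean_leafE M.
have ms0 := mean_sq_ge0 M; have ml0 := mean_leaf_ge0 M.
have msle : mean_sq X M <= a2 by rewrite ms gerBl.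
have mlle : mean_leaf Y M <= b1 by rewrite ml gerBl.
have prodle : mean_sq X M * mean_leaf Y M <= a2 * b1 by exact: ler_pM.
rewrite -ErB// (le_trans (Er_normr (itgB i1 i2)))//.
apply: le_trans (Er_le (itg_norm (itgB i1 i2)) i3 _) _.
  move=> w; apply: le_trans (pois_lip m (l10 w) (l20 w)) _.
  rewrite /c truncY; set y := Y 1%N w; set ind := (M < y)%R%:R.
  rewrite (_ : _ - _ = - (gamma * (a2 * b1 - mean_sq X M * mean_leaf Y M) * y
     + gamma * (mean_sq X M * mean_leaf Y M) * (ind * y))); last by ring.
  have y0 : 0 <= ind * y by rewrite mulr_ge0 ?Y0.
  rewrite normrN ger0_norm; last first.
    rewrite addr_ge0//; last by rewrite (mulr_ge0 _ y0)// (mulr_ge0 g0)// mulr_ge0.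
    by rewrite (mulr_ge0 _ (Y0 w))// (mulr_ge0 g0)// subr_ge0.
  by rewrite lerD2l -(mulrA gamma a2) ler_wpM2r// ler_wpM2l.
rewrite ErD ?ErZ//; try by apply: itgZ.
rewrite -/b1 -/(tail_leaf Y M); apply: lerD; last first.
  by rewrite ler_wpM2l// lerDr.
rewrite [X in _ <= X](_ : _ =
  gamma * ((a2 + b1) * (tail_sq X M + tail_leaf Y M)) * b1); last by ring.
rewrite ler_wpM2r// ler_wpM2l//.
rewrite (_ : a2 * b1 - _ = tail_sq X M * b1 + mean_sq X M * tail_leaf Y M); last first.
  by rewrite ms ml; ring.
rewrite mulrDl mulrDr [X in _ <= _ + X]mulrDr.
have h1 : mean_sq X M * tail_leaf Y M <= a2 * tail_leaf Y M by rewrite ler_wpM2r.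
have h2 : 0 <= a2 * tail_sq X M by rewrite mulr_ge0.
have h3 : 0 <= b1 * tail_leaf Y M by rewrite mulr_ge0.
by move: h1 h2 h3; rewrite (mulrC (tail_sq X M)); lra.
Qed.

(** Order of the choices: [M] makes the tails contribute at most e / 2, uniformly in t; then [del]
    is fixed; for large t the remaining errors are at most e / 4 each. *)
Lemma degree_cvg m :
  Er P (fun w => (degree a b nu H t w == m)%:R) @[t --> \oo] --> limit_pmf m.
Proof.
have g0 := gamma_ge0.
have pw : path_weight a b nu t (N t) (U t) @[t --> \oo] --> gamma.
  apply: (cvg_path_weight a0 ab nu1); first exact: centre_bound_gt.
  exact: leaf_bound_gt.
apply/cvgrPdist_le => e e0.
(* The coefficients of the tails in [B1'] and [B3]; [gamma + 1] eventually dominates the path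
   weight. *)
pose K := 1 + (gamma + 1) * (b1 ^+ 2 + a2 * b1) + gamma * (a2 + b1) * b1 + gamma * a2 * b1.
have e2 : 0 < e / 2 by rewrite divr_gt0.
have /cvgrPdist_le/(_ _ e2) [n _ /(_ n (leqnn n))] := tails_cvg0 K.
rewrite /= sub0r normrN => hn.
set M : R := n.+1%:R in hn.
have M1 : 1 <= M by rewrite ler1n.
have M0 : 0 < M by apply: lt_le_trans M1.
(* Chosen so that [M * del = e / 4]. *)
pose del := e / (4 * M).
have d0 : 0 < del by rewrite divr_gt0// mulr_gt0.
pose C1 := 2 * (M ^+ 6 + M ^+ 8) + M * (M ^+ 6 / del).
pose C2 := M * (mean_sq X M * mean_leaf Y M).
have lim0 : C1 * error_term a b nu t + C2 * `|path_weight a b nu t (N t) (U t) - gamma|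
    @[t --> \oo] --> 0.
  rewrite -[X in _ --> X](addr0 0); apply: cvgD.
    rewrite -(mulr0 C1); apply: cvgM (cvg_cst C1) _.
    exact: error_term_cvg0.
  rewrite -(mulr0 C2); apply: cvgM (cvg_cst C2) _; rewrite -(normr0 R).
  by apply: cvg_norm; rewrite -(subrr gamma); apply: cvgB pw (cvg_cst _).
have e4 : 0 < e / 4 by rewrite divr_gt0.
have Minv : 0 < (M ^+ 2)^-1 by rewrite invr_gt0 exprn_gt0.
near=> t.
have Dt : D t by near: t; exact: nbhs_infty_gt.
have hlim : C1 * error_term a b nu t + C2 * `|path_weight a b nu t (N t) (U t) - gamma| <= e / 4.
  have : `|0 - (C1 * error_term a b nu t + C2 * `|path_weight a b nu t (N t) (U t) - gamma|)| <= e / 4.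
    by near: t; move/cvgrPdist_le : lim0; exact.
  by rewrite sub0r normrN; apply: le_trans; exact: ler_norm.
have heb : M ^+ 2 * edge_bound a b nu t <= 1.
  rewrite mulrC -ler_pdivlMr ?exprn_gt0// mul1r.
  have : `|0 - edge_bound a b nu t| <= (M ^+ 2)^-1.
    by near: t; move/cvgrPdist_le : (edge_bound_cvg0 a0 ab nu1); exact.
  by rewrite sub0r normrN; apply: le_trans; exact: ler_norm.
have hpw : path_weight a b nu t (N t) (U t) <= gamma + 1.
  have : `|gamma - path_weight a b nu t (N t) (U t)| <= 1.
    by near: t; move/cvgrPdist_le : pw; exact.
  by rewrite ler_norml => /andP[]; lra.
have B1 := degree_light a0 ab nu1 model X2_itg Y_itg M1 m Dt.
have B2 := light_degree_pois a0 ab nu1 model M0 m Dt heb g0 d0.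
have B3 := trunc_limit m M Dt.
have tX := tail_sq_ge0 X M.
have tY : 0 <= tail_leaf Y M by apply: Er_ge0 => w; rewrite mulr_ge0 ?Y0.
have B1' : `|Er P (fun w => (degree a b nu H t w == m)%:R)
    - Er P (fun w => (light_degree a b nu X Y H M t w == m)%:R)| <=
   (1 + (gamma + 1) * (b1 ^+ 2 + a2 * b1)) * (tail_sq X M + tail_leaf Y M).
  apply: le_trans B1 _; rewrite -/b1 -/a2.
  have s1 : 0 <= tail_sq X M * b1 ^+ 2 + a2 * b1 * tail_leaf Y M.
    by rewrite addr_ge0 ?mulr_ge0 ?sqr_ge0.
  have s2 := ler_wpM2r s1 hpw.
  have s3 : tail_sq X M * b1 ^+ 2 + a2 * b1 * tail_leaf Y M <=
      (b1 ^+ 2 + a2 * b1) * (tail_sq X M + tail_leaf Y M).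
    have h1 : 0 <= b1 ^+ 2 * tail_leaf Y M by rewrite mulr_ge0 ?sqr_ge0.
    have h2 : 0 <= a2 * b1 * tail_sq X M by rewrite !mulr_ge0.
    by rewrite mulrDl !mulrDr; move: h1 h2; rewrite (mulrC (tail_sq X M)); lra.
  have g1 : 0 <= gamma + 1 by rewrite addr_ge0.
  have s4 := ler_wpM2l g1 s3.
  rewrite mulrDl mul1r -mulrA; move: s2 s4; rewrite /N /U; lra.
have B2' : `|Er P (fun w => (light_degree a b nu X Y H M t w == m)%:R) -
    Er P (fun w => pois (gamma * (mean_sq X M * mean_leaf Y M) * trunc M (Y t w)) m)|
   <= e / 4 + e / 4.
  apply: le_trans B2 _.
  apply: le_trans (lerD hlim (lexx (e / 4))).
  rewrite [X in _ <= _ + X](_ : _ = M * del); last first.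
    by rewrite /del; field; rewrite gt_eqF.
  rewrite /C1 /C2 /N /U le_eqVlt; apply/orP; left; apply/eqP; ring.
rewrite distrC.
have tri (x y z w : R) : `|x - w| <= `|x - y| + (`|y - z| + `|z - w|).
  rewrite (_ : x - w = (x - y) + ((y - z) + (z - w))); last by ring.
  by rewrite (le_trans (ler_normD _ _))// lerD2l ler_normD.
apply: le_trans (tri _ _ _ _) _.
apply: le_trans (lerD B1' (lerD B2' B3)) _.
have hK : K * (tail_sq X M + tail_leaf Y M) <= e / 2.
  by apply: le_trans hn; exact: ler_norm.
move: hK; rewrite /K; move: (tail_sq X M + tail_leaf Y M) => x hK.
rewrite [X in X <= _](_ : _ = (1 + (gamma + 1) * (b1 ^+ 2 + a2 * b1)
   + gamma * (a2 + b1) * b1 + gamma * a2 * b1) * x + (e / 4 + e / 4)); last by ring.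
lra.
Unshelve. all: by end_near. Qed.

End DegreeLimit.

(** * Convergence in distribution *)

Section CountBelow.
Context (d : measure_display) (T : measurableType d) (R : realType).
Variable P : probability T R.

(** The number of natural numbers at most [x]; [truncn] alone does not separate negative [x] from
    those in [0, 1). *)
Definition count_below (x : R) : nat := if 0 <= x then (Num.truncn x).+1 else 0.

Lemma count_belowP (x : R) (n : nat) : (n%:R <= x) = (n < count_below x)%N.
Proof.
rewrite /count_below; case: ifPn => [x0|]; last first.
  by rewrite -ltNge ltn0 => x0; apply/negbTE; rewrite -ltNge (lt_le_trans x0).
rewrite ltnS; apply/idP/idP => [h|h].
  by rewrite -ltnS -(ltr_nat R) (le_lt_trans h)// truncnS_gt.
by apply: le_trans (_ : (Num.truncn x)%:R <= x); rewrite ?ler_nat// truncn_le.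
Qed.

Lemma eq_measure_off_null (A B Z : set T) : measurable A -> measurable B ->
  measurable Z -> P Z = 0%E -> (forall w, ~ Z w -> A w <-> B w) -> P A = P B.
Proof.
move=> mA mB mZ Z0 AB.
rewrite -(measureU0 mA mZ Z0) -(measureU0 mB mZ Z0); congr (P _).
apply/seteqP; split=> w [h|h]; try (by right);
  by have [z|z] := pselect (Z w); [right|left; apply/(AB w z)].
Qed.

(** Serves both sides of the limit: the degree may be infinite, and the limit variable may fail to
    be a natural number, each on a null set. [n w m] stands for the event that the value is [m]. *)
Lemma prob_le_sum (f : T -> \bar R) (n : T -> nat -> bool) (Z : set T) (x : R) :
  measurable [set w | (f w <= x%:E)%E] ->
  (forall m, measurable_fun setT (n ^~ m)) ->
  measurable Z -> P Z = 0%E ->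
  (forall w, ~ Z w -> exists2 k : nat, f w = k%:R%:E & forall m, n w m = (k == m)) ->
  P [set w | (f w <= x%:E)%E] =
  (\sum_(m < count_below x) Er P (fun w => (n w m)%:R))%:E.
Proof.
move=> mf mn mZ Z0 h.
pose e w := [exists m : 'I_(count_below x), n w m].
have me : measurable_fun setT e.
  exact: (measurable_existsb (b := fun m w => n w m)).
rewrite (eq_measure_off_null (B := [set w | e w]) mf _ mZ Z0); last first.
- move=> w /h[k fk nk] /=; rewrite fk lee_fin count_belowP; split=> [kx|/existsP[m]].
    by apply/existsP; exists (Ordinal kx); rewrite nk /=.
  by rewrite nk => /eqP->.
- exact/measurable_bool.
rewrite -Er_sum; last by move=> m _; apply: itg_bool.
have hn w : ~ Z w -> (e w)%:R = \sum_(m < count_below x) (n w m)%:R :> R.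
  move=> /h[k _ nk]; rewrite /e.
  case: existsP => [[m]|nex].
    rewrite nk => /eqP km; rewrite (bigD1 m)//= nk km eqxx big1 ?addr0// => j jm.
    rewrite nk km; case: eqP => // mj; move: jm; rewrite (_ : j = m) ?eqxx//.
    exact: val_inj.
  rewrite big1// => m _; case nm : (n w m) => //.
  by case: nex; exists m; rewrite nm.
rewrite -Er_bool// !Er_EFin; last 2 first.
- by apply: itg_sum => m _; apply: itg_bool.
- exact: itg_bool.
apply: ae_eq_integral => //.
- by apply/measurable_EFinP; exact: measurable_natr.
- apply/measurable_EFinP; apply: measurable_sum => m; exact: measurable_natr.
- exists Z; split => // w /= hw; apply: contrapT => nz; apply: hw => _.
  by rewrite hn.
Qed.

End CountBelow.

(** * Distribution function of a Poisson mixture *)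

Section PoissonMixture.
Context (d : measure_display) (T : measurableType d) (R : realType).
Variable P : probability T R.

Lemma pois_series (l : R) : 0 <= l ->
  (\sum_(n <oo) (pois l n)%:E = 1)%E.
Proof.
move=> l0; rewrite [RHS](_ : _ = (expR (- l))%:E * (expR l)%:E)%E; last first.
  by rewrite -EFinM expRN mulVf ?gt_eqF ?expR_gt0.
under eq_eseriesr do rewrite /pois EFinM.
rewrite nneseriesZl/=; last first.
  by move=> n _; rewrite lee_fin divr_ge0// exprn_ge0.
congr *%E; rewrite expRE -EFin_lim; last first.
  rewrite /pseries/=; under eq_fun do rewrite mulrC.
  exact: is_cvg_series_exp_coeff.
apply/congr_lim/funext => n/=; rewrite /pseries/= /series/= -sumEFin//.
by under eq_bigr do rewrite mulrC.
Qed.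

Context (d' : measure_display) (T' : measurableType d') (Q : probability T' R).
Variables (L : {RV Q >-> R}) (lam : T -> R).
Hypothesis mlam : measurable_fun setT lam.
Hypothesis lam0 : forall w, 0 <= lam w.
Hypothesis L_pois : forall r : nat,
  Q (L @^-1` [set r%:R]) = (\int[P]_w (pois (lam w) r)%:E)%E.

Let Z := ~` \bigcup_(m : nat) (L @^-1` [set m%:R]).

Let mLm m : measurable (L @^-1` [set m%:R]).
Proof. by rewrite -[X in measurable X]setTI; exact: measurable_funP. Qed.

Let mZ : measurable Z.
Proof. by apply: measurableC; apply: bigcupT_measurable. Qed.

(** Only the masses of [L] at natural numbers are given; they add up to 1, by exchanging sum and
    integral, so [L] is almost surely a natural number. *)
Let Z0 : Q Z = 0%E.
Proof.
rewrite /Z probability_setC; last exact: bigcupT_measurable.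
rewrite measure_bigcup//=; last first.
  apply/trivIsetP => i j _ _ ij; apply/seteqP; split=> // w [/= -> /eqP].
  by rewrite eqr_nat (negbTE ij).
have -> : (\sum_(m <oo | m \in setT) Q (L @^-1` [set m%:R]) = 1)%E.
  transitivity (\sum_(m <oo) \int[P]_w (pois (lam w) m)%:E)%E.
    under eq_eseriesr do rewrite L_pois.
    by apply: eq_eseriesl => i; rewrite in_setT.
  rewrite -integral_nneseries//.
  - under eq_integral do rewrite pois_series//.
    by rewrite integral_cst//= mul1e probability_setT.
  - by move=> n; apply/measurable_EFinP; exact: measurable_pois.
  - by move=> n w _; rewrite lee_fin pois_ge0.
by rewrite subee.
Qed.

Lemma cdf_pois_mixture (x : R) :
  cdf L x = (\sum_(m < count_below x) Er P (fun w => pois (lam w) m))%:E.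
Proof.
rewrite /cdf /distribution /pushforward.
have mnL m : measurable_fun setT (fun w => L w == m%:R).
  apply/measurable_bool; rewrite (_ : [set w | _] = L @^-1` [set m%:R]) //.
  by apply/seteqP; split=> w /= /eqP.
rewrite (_ : _ @^-1` _ = [set w | ((L w)%:E <= x%:E)%E]); last first.
  by apply/seteqP; split=> w /=; rewrite in_itv /= lee_fin.
rewrite (@prob_le_sum _ _ _ Q _ (fun w m => L w == m%:R) Z)//.
- congr (_%:E); apply: eq_bigr => m _; apply: EFin_inj.
  rewrite Er_bool// Er_EFin; last exact: itg_pois.
  rewrite -L_pois; congr (Q _).
  by apply/seteqP; split=> w /= /eqP.
- rewrite (_ : [set w | _] = L @^-1` `]-oo, x]); last first.
    by apply/seteqP; split=> w /=; rewrite in_itv /= lee_fin.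
  exact: measurable_funPTI.
- move=> w; rewrite /Z /= => /contrapT[k _ /= Lk]; exists k; first by rewrite Lk.
  by move=> m; rewrite Lk eqr_nat.
Qed.

End PoissonMixture.

(** * From the truncated neighbour count to the degree in the graph *)

Section IntersectionDegree.
Context (R : realType) (d : measure_display) (T : measurableType d).
Variables (P : probability T R) (a b nu : R) (X Y : nat -> {RV P >-> R}).
Variable H : T -> nat -> nat -> bool.
Hypotheses (a0 : 0 < a) (ab : a < b) (nu1 : 1 < nu).
Hypothesis model : random_intersection_model a b (fun t => t%:R `^ nu) X Y H.

(** Edges outside the admissible range have probability 0 but may exist at some sample points, where
    the degree may even be infinite; there are countably many of them. *)
Definition stray_edge (k : nat * nat) : set T :=
  [set w | (~~ in_range a b nu k.2 k.1) && full_edge H k w].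

Definition stray : set T := \bigcup_i \bigcup_u stray_edge (i, u).

Let mstray_edge k : measurable (stray_edge k).
Proof.
apply/measurable_bool; apply: measurable_and; first exact: measurable_cst.
exact: (measurable_full_edge model).
Qed.

Lemma measurable_stray : measurable stray.
Proof. by apply: bigcupT_measurable => i; exact: bigcupT_measurable. Qed.

Let P_stray_edge k : P (stray_edge k) = 0%E.
Proof.
rewrite /stray_edge; case: (boolP (in_range a b nu k.2 k.1)) => kr /=.
  by rewrite (_ : [set w | _] = set0) ?measure0//; apply/seteqP; split.
rewrite -Er_bool; last exact: (measurable_full_edge model).
rewrite /full_edge; case: (boolP (positive k)) => pk /=; last by rewrite Er_cst.
have ps : all positive [:: k] by rewrite /= pk.
have us : uniq [:: k] by [].
have := cond_Er model us ps (measurable_cst true).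
have e (F : nat * nat -> T -> R) :
    (fun w => (cst true w)%:R * \prod_(j <- [:: k]) F j w) = F k.
  by apply/funext => w; rewrite big_seq1 mul1r.
rewrite (e (fun k w => (H w k.1 k.2)%:R)) (e (ep a b nu X Y)) => ->.
rewrite (_ : ep a b nu X Y k = fun=> 0) ?Er_cst//; apply/funext => w.
by rewrite /ep /edge_prob -/(in_range a b nu k.2 k.1) (negbTE kr) mulr0.
Qed.

Lemma P_stray : P stray = 0%E.
Proof.
apply: measure_negligible; first exact: measurable_stray.
apply: negligible_bigcup => i; apply: negligible_bigcup => u.
by apply/negligibleP => //; exact: P_stray_edge.
Qed.

Let adjacent t (w : T) : set nat := [set u : nat | (0 < u)%N /\ intersection_adj (H w) t u].

(** Without stray edges, all common neighbours lie below [centre_bound] and all neighbours below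
    [leaf_bound], so the finite count sees everything. *)
Lemma intersection_degreeE t w : (0 < t)%N -> ~ stray w ->
  intersection_degree R (H w) t = (degree a b nu H t w)%:R%:E.
Proof.
move=> t0 ns.
have ranged i u : (0 < i)%N -> (0 < u)%N -> H w i u -> in_range a b nu u i.
  move=> i0 u0 h; apply: contrapT => /negP nr; apply: ns; exists i => //; exists u => //.
  by rewrite /stray_edge /= nr /full_edge /positive /= i0 u0 h.
pose E u := [exists i : 'I_(centre_bound b nu t),
  [&& full_edge H ((i : nat), t) w, full_edge H ((i : nat), u) w & u != t]].
pose F := [fset u in [seq u <- iota 0 (leaf_bound a b nu t) | E u]]%fset.
rewrite /intersection_degree.
have -> : [set u | (0 < u)%N /\ intersection_adj (H w) t u] = [set` F].
  apply/seteqP; split => u /=.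
    move=> [u0 [tu [i i0 [it iu]]]].
    have ti := ranged _ _ i0 t0 it; have ui := ranged _ _ i0 u0 iu.
    rewrite inE mem_filter mem_iota /= add0n; apply/andP; split.
      have iN : (i < centre_bound b nu t)%N.
        rewrite -(ltr_nat R); have /andP[_ h] := ti.
        exact: le_lt_trans h (centre_bound_gt _ _ _).
      apply/existsP; exists (Ordinal iN) => /=.
      by rewrite /full_edge /positive /= i0 t0 u0 it iu /= eq_sym; apply/eqP.
    rewrite -(ltr_nat R); have /andP[_ h] := in_range_both a0 ab nu1 ti ui.
    exact: le_lt_trans h (leaf_bound_gt _ _ _ _).
  rewrite inE mem_filter => /andP[/existsP[i /and3P[it iu ut]] _].
  move: it iu; rewrite /full_edge /positive /= => /andP[/andP[i0 _] it] /andP[/andP[_ u0] iu].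
  split=> //; split; first by move=> e; rewrite e eqxx in ut.
  by exists i.
rewrite /counting asboolT; last exact: finite_fset.
rewrite set_fsetK card_fseq undup_id; last by rewrite filter_uniq ?iota_uniq.
rewrite size_filter /degree /neighbour_count -sum1_count.
rewrite -[X in iota 0 X]subn0 -/(index_iota 0 _) big_mkcond /= big_mkord.
congr (_%:R%:E); apply: eq_bigr => u _.
Qed.

Let mE t u : (0 < t)%N -> measurable [set w | adjacent t w u].
Proof.
move=> t0; case: (boolP ((0 < u)%N && (t != u))) => [/andP[u0 /eqP tu]|h]; last first.
  rewrite (_ : [set w | _] = set0) ?measurable0//; apply/seteqP; split=> // w [u0 [tu _]].
  by move: h; rewrite u0; move/eqP : tu => ->.
rewrite (_ : [set w | _] = \bigcup_i [set w | full_edge H (i, t) w && full_edge H (i, u) w]).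
  apply: bigcupT_measurable => i; apply/measurable_bool; apply: measurable_and;
    exact: (measurable_full_edge model).
apply/seteqP; split => w /=.
  by move=> [_ [_ [i i0 [it iu]]]]; exists i => //=; rewrite /full_edge /positive /= i0 t0 u0 it iu.
move=> [i _ /andP[/andP[/andP[/= i0 _] it] /andP[_ iu]]]; split=> //; split=> //.
by exists i.
Qed.

Lemma measurable_intersection_degree t : (0 < t)%N ->
  measurable_fun setT (fun w => intersection_degree R (H w) t).
Proof.
move=> t0; rewrite /intersection_degree.
(* As a series of Dirac masses, the degree is a countable sum of indicators of adjacency events. *)
under eq_fun => w do rewrite counting_dirac.
rewrite (_ : (fun w => _) =
  (fun w => \sum_(n <oo | n \in xpredT) (\d_ n (adjacent t w) : \bar R))%E)//.
apply: ge0_emeasurable_sum => // n _.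
rewrite (_ : (fun w => _) = (fun w => (\1_[set w | adjacent t w n] w)%:E)).
  apply/measurable_EFinP; apply: measurable_indic; exact: mE.
apply/funext => w; rewrite diracE indicE; congr (_%:R%:E).
Qed.

End IntersectionDegree.

Theorem theorem2 (R : realType)
    (d : measure_display) (T : measurableType d) (P : probability T R)
    (a b nu : R) (X Y : nat -> {RV P >-> R}) (H : T -> nat -> nat -> bool)
    (d' : measure_display) (T' : measurableType d') (Q : probability T' R)
    (Lambda3 : {RV Q >-> R}) :
  0 < a -> a < b -> 1 < nu ->
  random_intersection_model a b (fun t => t%:R `^ nu) X Y H ->
  ('E_P[fun w => (X 1%N w ^+ 2)%R] < +oo)%E ->
  ('E_P[Y 1%N] < +oo)%E ->
  let a2 := fine 'E_P[fun w => (X 1%N w ^+ 2)%R] in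
  let b1 := fine 'E_P[Y 1%N] in
  let gamma := 4 * nu * (b `^ (1 / (2 * nu)) - a `^ (1 / (2 * nu))) *
                        (a `^ (- (1 / (2 * nu))) - b `^ (- (1 / (2 * nu)))) in
  let lambda3 := fun w => gamma * a2 * b1 * Y 1%N w in
  (forall r : nat, Q (Lambda3 @^-1` [set r%:R]) =
     'E_P[fun w => (expR (- lambda3 w) * (lambda3 w ^+ r / r`!%:R))%R]%E) ->
  cvg_in_distribution P (fun t w => intersection_degree R (H w) t) Lambda3.
Proof.
move=> a0 ab nu1 model EX2 EY a2 b1 gam lambda3 L_pois x _.
rewrite unlock in EX2; rewrite unlock in EY.
have X2_itg : itg P (fun w => X 1%N w ^+ 2).
  by apply: itg_ge0P EX2; [exact: measurable_funX|move=> w; exact: sqr_ge0].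
have Y0 w : 0 <= Y 1%N w by exact: (Y_ge0 model).
have Y_itg : itg P (Y 1%N : T -> R) by apply: itg_ge0P EY.
have a2E : a2 = Er P (fun w => X 1%N w ^+ 2) by rewrite /a2 unlock.
have b1E : b1 = Er P (Y 1%N) by rewrite /b1 unlock.
have gamE : gam = gamma a b nu by rewrite /gam div1r.
have lam0 w : 0 <= lambda3 w.
  rewrite /lambda3 a2E b1E gamE; apply: mulr_ge0 => //; apply: mulr_ge0; last exact: Er_ge0.
  by apply: mulr_ge0; [exact: gamma_ge0|apply: Er_ge0 => w'; exact: sqr_ge0].
have mlam : measurable_fun setT lambda3 by exact: measurable_funM.
have Lp r : Q (Lambda3 @^-1` [set r%:R]) = (\int[P]_w (pois (lambda3 w) r)%:E)%E.
  by rewrite L_pois unlock.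
rewrite (cdf_pois_mixture mlam lam0 Lp).
(* At [x], both distribution functions are sums of the same finite number of point masses, so
   convergence of each mass suffices. *)
have lim K : \sum_(m < K) Er P (fun w => (degree a b nu H t w == m)%:R)
    @[t --> \oo] --> \sum_(m < K) Er P (fun w => pois (lambda3 w) m).
  elim: K => [|K IH].
    by under eq_fun do rewrite big_ord0; rewrite big_ord0; exact: cvg_cst.
  under eq_fun do rewrite big_ord_recr; rewrite big_ord_recr /=.
  apply: cvgD IH _; rewrite /lambda3 a2E b1E gamE.
  exact: (degree_cvg a0 ab nu1 model X2_itg Y_itg).
have limE : (\sum_(m < count_below x)
      Er P (fun w => (degree a b nu H t w == m)%:R))%:E @[t --> \oo] -->
    (\sum_(m < count_below x) Er P (fun w => pois (lambda3 w) m))%:E.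
  by apply: cvg_EFin; [exact: nearW|exact: lim].
apply: cvg_trans limE.
apply: near_eq_cvg; near=> t.
have t0 : (0 < t)%N by near: t; exact: nbhs_infty_gt.
apply/esym/(@prob_le_sum _ _ _ P _ (fun w m => degree a b nu H t w == m) (stray a b nu H)).
- rewrite -[X in measurable X]setTI.
  rewrite (_ : [set w | _] = (fun w => intersection_degree R (H w) t) @^-1` `]-oo, x%:E]).
    by apply: measurable_intersection_degree model _ t0 _ _ _ => //; exact: emeasurable_itv.
  by apply/seteqP; split=> w /=; rewrite in_itv.
- by move=> m; exact: (measurable_degree model).
- exact: (measurable_stray model).
- exact: (P_stray model).
- move=> w nw; exists (degree a b nu H t w) => //.
  exact: (intersection_degreeE a0 ab nu1).
Unshelve. all: by end_near. Qed.
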